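(* Let $\mathcal X\subset\mathbb R^d$ be bounded and let $k$ be a (periodic translation-invariant) quantum fidelity kernel on $\mathcal X$ built on $m$ qubits such that, for some $\tau\in(0,\infty)^d$, for all $x,z\in\mathcal X$: $k(x,z)=1\iff x-z\in\tau\odot\mathbb Z^d$. Let $\mu$ be a probability measure on $\mathcal X$ with full support, with density $g\in L^1(\mathbb R^d)\cap L^p(\mathbb R^d)$ for some $p>1$ (possibly $p=+\infty$). Let $(x_i,y_i)$ be i.i.d. with $x_i\sim\mu$, $y_i=f^*(x_i)+\varepsilon_i$, $f^*\in\mathcal H_k$, $\mathbb E[\varepsilon_i\mid x_i]=0$, $\mathbb E[\varepsilon_i^2\mid x_i]=\sigma^2$. Let $\frac1p+\frac1{p'}=1$ and $\beta=\frac d{p'}$. Choose $\alpha>0$ and $0<\alpha_0<1$. Let $\{\delta_n\}_{n\ge1}$, $\{\rho_n\}_{n\ge1}$ be sequences of positive reals and $\{q_n\}_{n\ge1}$ a sequence of positive integers satisfying $$\delta_n=o\big(n^{-\frac{2+\alpha}{\beta}}\big),\qquad \rho_n n^{\alpha_0}\xrightarrow[n\to\infty]{}0,\qquad \rho_n n\xrightarrow[n\to\infty]{}+\infty,$$ $$q_n\ge\frac{c_\alpha\log n}{-\log m(\delta_n)}\quad\text{with}\quad c_\alpha>\tfrac{6+\alpha}{2},\qquad\text{where } m(\delta):=\sup_{(x,z)\in S(\delta)^c}k(x,z).$$ Write $$\Delta(X_n)=\min_{1\le i<j\le n}\ \inf_{(x',z')\in Z}\|(x_i,x_j)-(x',z')\|_2,\qquad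 P_n=\mathbb P(\Delta(X_n)<\delta_n).$$ Then $P_n\to0$ as $n\to\infty$, and with probability at least $(1-O(n^{-\alpha_0}))(1-O(n^{-\alpha}))(1-P_n)$, the ridgeless estimator $\hat f_{\rho_n,q_n,n}$ built on the kernel $k_{\rho_n,q_n}=k+\rho_nk^{q_n}$ satisfies $$\mathbb E_x\big[|\hat f_{\rho_n,q_n,n}(x)-f^*(x)|^2\big]\le B_{0,n}+B_{1,n}+B_{2,n},$$ with $$B_{0,n}=2\sigma^2 4^{m}n^{\alpha_0-1}\Big(1+\frac1{\rho_nn}\Big)+2\|f^*\|_{\mathcal H_k}^2\,\rho_nn^{\alpha_0}\Big(1+\frac1{\rho_nn}\Big)^2,$$ $$B_{1,n}=4C_y\,\frac{n^{4+\alpha}m(\delta_n)^{2q_n}}{\rho_n^2\big(1-n\,m(\delta_n)^{q_n}\big)^2},\qquad C_y=\mathbb E_x[f^*(x)^2]+\sigma^2,$$ $$B_{2,n}=4C_y\,\frac{n^{2+\alpha}\big(C_\mu\delta_n^\beta+m(\delta_n)^{2q_n}\big)}{\big(1-n\,m(\delta_n)^{q_n}\big)^2},\qquad C_\mu=N_{\mathcal X}\,\|g\|_{L^p}\,\big(v_d\,(\sqrt2)^{d}\big)^{1/p'}.$$ Furthermore $B_{i,n}\to0$ as $n\to\infty$ for $i=0,1,2$. Hence the sequence of estimators $\{\hat f_{\rho_n,q_n,n}\}_n$ is consistent in probability, i.e. for every $\varepsilon>0$, $\mathbb P\big(\mathbb E_x[|\hat f_{\rho_n,q_n,n}(x)-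f^*(x)|^2]>\varepsilon\big)\to0$.
   Context: Quantum fidelity kernel on $m$ qubits: there is a map $x\mapsto\psi(x)\in\mathbb C^{2^m}$ on $\mathcal X$, $\psi(x)=U(x)e_0$ with $U(x)$ unitary and $e_0=|0^m\rangle$ a fixed unit (first basis) vector, so $\|\psi(x)\|_2=1$, and $k(x,z)=|\langle\psi(x),\psi(z)\rangle|^2=\mathrm{Tr}[\rho(x)\rho(z)]$ with $\rho(x)=\psi(x)\psi(x)^\dagger$; in particular $0\le k\le1$. Standing assumption: $k$ is translation invariant, $k(x,z)=\kappa(x-z)$, and periodic with period vector $\tau$. $\odot$ is the entrywise product, so $\tau\odot\mathbb Z^d=\{(\tau_1a_1,\dots,\tau_da_d):a\in\mathbb Z^d\}$. The symbol $m$ alone is the number of qubits, while $m(\delta)$ is the function defined in the claim; the condition on $q_n$ presupposes $m(\delta_n)<1$. $\mathcal H_k$ is the RKHS of $k$ on $\mathcal X$. Full support: $\mu(B(x,t))>0$ for all $x\in\mathcal X$, $t>0$. $\mathbb E_x$ is expectation over $x\sim\mu$ independent of the sample; $\mathbb P$ is over the training sample $(x_i,y_i)_{i=1}^n$; $X_n=\{x_1,\dots,x_n\}$, $Y_n=(y_1,\dots,y_n)^\top$. Spike set: $Z=\{(x,z)\in\mathcal X^2:k(x,z)=1\}$. For $\delta>0$, $S(\delta)=\{(x,z)\in\mathcal X^2:\inf_{(x',z')\in Z}\|(x,z)-(x',z')\|_2\le\delta\}$, and $S(\delta)^c=\mathcal X^2\setminus S(\delta)$. $N_{\mathcal X}$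 is the (finite) number of $a\in\mathbb Z^d$ for which $\{(x,z)\in\mathcal X^2:x-z=\tau\odot a\}$ is nonempty. $v_d$ is the volume of the unit ball of $\mathbb R^d$. Ridgeless estimator: with $k_{\rho,q}(x,z)=k(x,z)+\rho\,k(x,z)^q$, $K_{\rho,q}=(k_{\rho,q}(x_i,x_j))_{i,j\le n}$ and $k_{\rho,q}(x,X_n)=(k_{\rho,q}(x,x_1),\dots,k_{\rho,q}(x,x_n))^\top$, set $\hat f_{\rho,q,n}(x)=k_{\rho,q}(x,X_n)^\top K_{\rho,q}^+Y_n$, where $(\cdot)^+$ is the Moore–Penrose pseudoinverse. *)

(* Defs.v *)
From HB Require Import structures.
From mathcomp Require Import all_boot all_order all_algebra finmap.
From mathcomp Require Import all_classical all_reals all_analysis.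
From mathcomp Require Import complex.

Set Implicit Arguments.
Unset Strict Implicit.
Unset Printing Implicit Defensive.
Import Order.TTheory GRing.Theory Num.Theory.
Import numFieldNormedType.Exports.

Local Open Scope classical_set_scope.
Local Open Scope ring_scope.

(* R^d is [d.-tuple R], which the library equips with the product of the
   Borel sigma-algebras (it has no Borel structure on ['rV[R]_d]). *)
Section euclidean.
Context {R : realType} {d : nat}.
Implicit Types x y tau : d.-tuple R.

Definition esub x y : d.-tuple R := [tuple tnth x i - tnth y i | i < d].

Definition enorm x : R := Num.sqrt (\sum_(i < d) tnth x i ^+ 2).

Definition eball x (r : R) : set (d.-tuple R) :=
  [set y | enorm (esub y x) < r].

Definition ebounded (X : set (d.-tuple R)) : Prop :=
  exists M : R, forall x, X x -> enorm x <= M.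

(* the Euclidean distance of R^d * R^d = R^(2d) *)
Definition edist2 (p q : d.-tuple R * d.-tuple R) : R :=
  Num.sqrt (enorm (esub p.1 q.1) ^+ 2 + enorm (esub p.2 q.2) ^+ 2).

Definition lattice_pt tau (a : d.-tuple int) : d.-tuple R :=
  [tuple tnth tau i * (tnth a i)%:~R | i < d].

End euclidean.

Section lebesgue_measure_Rd.
Context {R : realType}.

(* [lebesgue_measure] lives on [measurableTypeR R], whose measurable sets are
   those of R but whose display differs, hence the domain of [cons_pair]. *)
Definition cons_pair n (p : measurableTypeR R * n.-tuple R) : n.+1.-tuple R :=
  [the n.+1.-tuple R of p.1 :: p.2].

Lemma measurable_cons_pair n : measurable_fun setT (@cons_pair n).
Proof.
apply: measurable_cons; last exact: measurable_snd.
by move=> mT Y mY; exact: (@measurable_fst _ _ (measurableTypeR R)).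
Qed.

Section step.
Variables (n : nat) (mu : {sigma_finite_measure set (n.-tuple R) -> \bar R}).

Definition leb_step : set (n.+1.-tuple R) -> \bar R :=
  pushforward (@lebesgue_measure R \x mu)%E (@cons_pair n).

Let leb_step0 : leb_step set0 = 0%E.
Proof. by rewrite /leb_step /pushforward preimage_set0 measure0. Qed.

Let leb_step_ge0 A : (0 <= leb_step A)%E.
Proof. exact: (measure_ge0 (@lebesgue_measure R \x mu)%E). Qed.

Let leb_step_sigma_additive : semi_sigma_additive leb_step.
Proof.
move=> F mF tF mUF; rewrite /leb_step /pushforward preimage_bigcup.
have mpre A : measurable A -> measurable (@cons_pair n @^-1` A).
  by move=> mA; rewrite -[X in measurable X]setTI; exact: measurable_cons_pair.
apply: measure_semi_sigma_additive.
- by move=> i; exact: mpre.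
- apply/trivIsetP => /= i j _ _ ij; rewrite -preimage_setI.
  by move/trivIsetP : tF => /(_ _ _ _ _ ij) ->//; rewrite preimage_set0.
- by rewrite -preimage_bigcup; exact: mpre.
Qed.

HB.instance Definition _ := isMeasure.Build _ _ _ leb_step
  leb_step0 leb_step_ge0 leb_step_sigma_additive.

Let leb_step_sigma_finite : sigma_finite setT leb_step.
Proof.
have /sigma_finiteP[F [TF ndF Foo]] := sigma_finiteT (@lebesgue_measure R).
have /sigma_finiteP[G [TG ndG Goo]] := sigma_finiteT mu.
pose uncons (t : n.+1.-tuple R) : measurableTypeR R * n.-tuple R :=
  (thead t, [tuple of behead t]).
have muncons : measurable_fun setT uncons.
  apply: measurable_fun_pair; last exact: measurable_behead.
  exact: measurable_tnth.
exists (fun i => uncons @^-1` (F i `*` G i)).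
  rewrite -preimage_bigcup; apply/esym/seteqP; split=> // t _ /=.
  have [i _ Fi] : (\bigcup_i F i) (thead t) by rewrite -TF.
  have [j _ Gj] : (\bigcup_i G i) [tuple of behead t] by rewrite -TG.
  exists (maxn i j) => //; split => /=.
    by move: Fi; exact/subsetPset/ndF/leq_maxl.
  by move: Gj; exact/subsetPset/ndG/leq_maxr.
move=> i; have [mFi Fioo] := Foo i; have [mGi Gioo] := Goo i; split.
  rewrite -[X in measurable X]setTI.
  by apply: muncons => //; exact: measurableX.
rewrite /leb_step /pushforward.
have -> : @cons_pair n @^-1` (uncons @^-1` (F i `*` G i)) = F i `*` G i.
  apply/funext => -[r v] /=; rewrite /uncons /cons_pair /=.
  by congr ((F i _ /\ G i _)); apply/val_inj.
by rewrite product_measure1E// lte_mul_pinfty// ge0_fin_numE.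
Qed.

HB.instance Definition _ := Measure_isSigmaFinite.Build _ _ _ leb_step
  leb_step_sigma_finite.

End step.

Fixpoint leb (n : nat) : {sigma_finite_measure set (n.-tuple R) -> \bar R} :=
  match n with
  | 0 => \d_([tuple] : 0.-tuple R)
  | n'.+1 => leb_step (leb n')
  end.

Lemma leb_box n (A : 'I_n -> set R) : (forall i, measurable (A i)) ->
  leb n [set x | forall i, A i (tnth x i)] =
  (\prod_(i < n) @lebesgue_measure R (A i))%E.
Proof.
elim: n A => [|n IHn] A mA.
  rewrite big_ord0 /= diracE mem_set//.
  by move=> -[].
rewrite big_ord_recl -IHn//= /leb_step /pushforward.
rewrite (_ : _ @^-1` _ = A ord0 `*`
    [set x : n.-tuple R | forall i, A (lift ord0 i) (tnth x i)]).
  rewrite product_measure1E//; first exact: mA.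
  rewrite (_ : mkset _ = \bigcap_(i in [set: 'I_n])
      ((@tnth n R)^~ i @^-1` A (lift ord0 i))); last first.
    by apply/seteqP; split => x /= xA i => [_|]; exact: xA.
  apply: fin_bigcap_measurable => // i _.
  by rewrite -[X in measurable X]setTI; exact: measurable_tnth.
have cons0 r v : tnth (@cons_pair n (r, v)) ord0 = r by rewrite (tnth_nth 0).
have consS r v i : tnth (@cons_pair n (r, v)) (lift ord0 i) = tnth v i.
  by rewrite !(tnth_nth 0).
apply/seteqP; split => -[r v] /=.
  move=> rvA; split => [|i]; first by have := rvA ord0; rewrite cons0.
  by have := rvA (lift ord0 i); rewrite consS.
move=> [Ar Av] i; have [<-|i0] := eqVneq ord0 i; first by rewrite cons0.
by have [j -> _] := unlift_some i0; rewrite consS.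
Qed.

End lebesgue_measure_Rd.

Section fidelity_kernel.
Context {R : realType} {d : nat}.
Implicit Types (X : set (d.-tuple R)) (k : d.-tuple R -> d.-tuple R -> R).

Definition ket0 m : 'cV[R[i]]_(2 ^ m) := \col_j (j == 0%N :> nat)%:R.

Definition quantum_state m (U : d.-tuple R -> 'M[R[i]]_(2 ^ m)) x :=
  U x *m ket0 m.

Definition hermitian_dot n (u v : 'cV[R[i]]_n) : R[i] :=
  \sum_(j < n) (u j 0)^* * v j 0.

(* Only the values of [k] on [X * X] matter, here and below. *)
Definition quantum_fidelity_kernel X m k : Prop :=
  exists U : d.-tuple R -> 'M[R[i]]_(2 ^ m),
    (forall x, X x -> U x \is unitarymx) /\
    forall x z, X x -> X z ->
      k x z = ComplexField.Normc.normc
                (hermitian_dot (quantum_state U x) (quantum_state U z)) ^+ 2.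

Definition translation_invariant_periodic X (tau : d.-tuple R) k : Prop :=
  exists kappa : d.-tuple R -> R,
    (forall x z, X x -> X z -> k x z = kappa (esub x z)) /\
    forall u v a, esub u v = lattice_pt tau a -> kappa u = kappa v.

Definition spike X k : set (d.-tuple R * d.-tuple R) :=
  [set p | [/\ X p.1, X p.2 & k p.1 p.2 = 1]].

Definition dist_spike X k (p : d.-tuple R * d.-tuple R) : \bar R :=
  ereal_inf [set (edist2 p q)%:E | q in spike X k].

Definition spike_nbhd X k (delta : R) : set (d.-tuple R * d.-tuple R) :=
  [set p | [/\ X p.1, X p.2 & (dist_spike X k p <= delta%:E)%E]].

(* [sup] is the real supremum; on the empty set it is 0 *)
Definition off_spike_sup X k (delta : R) : R :=
  sup [set k p.1 p.2 | p in (X `*` X) `\` spike_nbhd X k delta].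

Definition lattice_count X (tau : d.-tuple R) : nat :=
  #|` fset_set [set a : d.-tuple int |
        exists x z, [/\ X x, X z & esub x z = lattice_pt tau a]] |.

(* The sample X_n is [xs 0, ..., xs n.-1]; the minimum over no pair is +oo. *)
Definition separation X k (xs : nat -> d.-tuple R) (n : nat) : \bar R :=
  \big[Order.min/+oo%E]_(ij : 'I_n * 'I_n | (ij.1 < ij.2)%N)
     dist_spike X k (xs ij.1, xs ij.2).

End fidelity_kernel.

Section rkhs.
Context {R : realType} {T : Type}.

(* [H], with inner product [ip], is the Hilbert space of functions with
   reproducing kernel [k]; it is unique by the Moore-Aronszajn theorem. *)
Record is_rkhs (k : T -> T -> R) (H : set (T -> R))
    (ip : (T -> R) -> (T -> R) -> R) : Prop := IsRkhs {
  rkhs0 : H (cst 0);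
  rkhs_lin : forall (a : R) f g, H f -> H g -> H (a *: f + g);
  rkhs_ipC : forall f g, H f -> H g -> ip f g = ip g f;
  rkhs_ip_lin : forall (a : R) f g h, H f -> H g -> H h ->
    ip (a *: f + g) h = a * ip f h + ip g h;
  rkhs_ip_ge0 : forall f, H f -> 0 <= ip f f;
  rkhs_ip_eq0 : forall f, H f -> ip f f = 0 -> f = cst 0;
  rkhs_complete : forall u : nat -> T -> R, (forall n, H (u n)) ->
    (forall e : R, 0 < e -> exists N, forall i j, (N <= i)%N -> (N <= j)%N ->
       ip (u i - u j) (u i - u j) < e) ->
    exists2 f, H f & (fun n => ip (u n - f) (u n - f)) @ \oo --> (0 : R);
  rkhs_kernel : forall x, H (k x);
  rkhs_reproducing : forall f x, H f -> ip f (k x) = f x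
}.

Definition rkhs_norm (ip : (T -> R) -> (T -> R) -> R) (f : T -> R) : R :=
  Num.sqrt (ip f f).

End rkhs.

Section probability.
Context {R : realType} {d0 d1 : measure_display}.
Context {Omega : measurableType d0} {T : measurableType d1}.
Variable P : probability Omega R.

Definition mutually_independent (Z : nat -> Omega -> T) : Prop :=
  forall (J : {fset nat}) (B : nat -> set T), (forall i, measurable (B i)) ->
    P (\bigcap_(i in [set` J]) Z i @^-1` B i) =
    (\prod_(i <- J) P (Z i @^-1` B i))%E.

Definition identically_distributed (Z : nat -> Omega -> T) : Prop :=
  forall i j B, measurable B -> P (Z i @^-1` B) = P (Z j @^-1` B).

(* h o Z is a version of the conditional expectation E[W | Z] *)
Definition is_cond_expectation (Z : Omega -> T) (W : Omega -> R)
    (h : T -> R) : Prop :=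
  [/\ P.-integrable setT (EFin \o W), measurable_fun setT h &
   forall B, measurable B ->
     (\int[P]_(w in Z @^-1` B) (W w)%:E =
      \int[P]_(w in Z @^-1` B) (h (Z w))%:E)%E].

End probability.

Section ridgeless.
Context {R : realType} {d : nat}.

Definition is_moore_penrose n (A B : 'M[R]_n) : Prop :=
  [/\ A *m B *m A = A, B *m A *m B = B,
      (A *m B)^T = A *m B & (B *m A)^T = B *m A].

Definition moore_penrose n (A : 'M[R]_n) : 'M[R]_n :=
  xget 0 (is_moore_penrose A).

Definition spiked_kernel (k : d.-tuple R -> d.-tuple R -> R) (rho : R) (q : nat)
    x z : R := k x z + rho * k x z ^+ q.

Definition ridgeless (k : d.-tuple R -> d.-tuple R -> R) (n : nat)
    (xs : nat -> d.-tuple R) (ys : nat -> R) (x : d.-tuple R) : R :=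
  ((\row_(j < n) k x (xs j))
    *m moore_penrose (\matrix_(i < n, j < n) k (xs i) (xs j))
    *m \col_(i < n) ys i) 0 0.

End ridgeless.

(* Main.v *)
Require Import Defs.
From HB Require Import structures.
From mathcomp Require Import all_boot all_order all_algebra finmap.
From mathcomp Require Import all_classical all_reals all_analysis.
From mathcomp Require Import complex.
From mathcomp Require Import measurable_realfun ess_sup_inf ring lra.

Set Implicit Arguments.
Unset Strict Implicit.
Unset Printing Implicit Defensive.
Import Order.TTheory GRing.Theory Num.Theory.
Import numFieldNormedType.Exports.

Local Open Scope classical_set_scope.
Local Open Scope ring_scope.

(** The kernel has finitely many real features, so off a null set it is
    [psi(x) G^-1 psi(z)^T] for a vector [psi] of finitely many kernel sections
    with invertible Gram matrix [G] and invertible second moment matrix [S],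
    and the reproducing property makes [fstar = psi c]. On a sample whose points
    are pairwise away from the spikes, the entrywise power [K^q] is close to the
    identity, and the kernel matrix is [Psi G^-1 Psi^T + rho Q] with [Q] close
    to [1]. Hence the estimator is, up to this error, a ridge regression on
    [psi]: its coefficient error [e] solves
    [(Psi^T Psi + rho G) e = Psi^T eps - rho G c + small].
    Separation, the size of the labels, the convergence of [Psi^T Psi / n] to
    [S] and the size of the noise [Psi^T eps] fail with probability
    [O(n^-alpha0) + O(n^-alpha)], by the density bound on small cubes and the
    inequalities of Markov and Chebyshev. The constants depending on [S] and
    [G] are absorbed by scaling the thresholds, which only changes the
    constants in the [O]. *)

(** * Finite-dimensional kernels and the pseudoinverse *)

Section gram.
Context {R : realFieldType}.

(** The stated bounds carry fixed constants such as [4 ^+ m] and [Cmu], while the regression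
    analysis produces constants that depend on the conditioning of [S] and [G]. Scaled thresholds
    cure this for the noise and the labels, but not for the bias, which is deterministic. The bias
    is quadratic in [rho] where the bound allows a linear term, so it is dominated for large [n],
    unless the RKHS norm of [fstar] is zero; then [fstar] vanishes on [X] and so does the bias. Two
    further obstacles are measure-theoretic. The kernel is uncontrolled outside [X], so kernel and
    target are extended by zero to functions on the whole space. The probability inequalities need
    the risk to be a measurable function of the sample although the pseudoinverse is discontinuous;
    it is obtained as a limit of Tikhonov inverses. Neighbourhoods of the spikes are enlarged to
    finite unions of cubes, whose measurability and Lebesgue measure are immediate. *)

Lemma mulmx_tr_eq0 m n (A : 'M[R]_(m, n)) : A *m A^T = 0 -> A = 0.
Proof.
move=> AA0; apply/matrixP => i j.
have /matrixP/(_ i i) := AA0; rewrite !mxE => /eqP.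
rewrite psumr_eq0; last by move=> l _; rewrite mxE -expr2 sqr_ge0.
by move=> /allP/(_ j (mem_index_enum _)); rewrite mxE -expr2 sqrf_eq0 => /eqP.
Qed.

Lemma gram_unitmx m n (A : 'M[R]_(m, n)) : row_free A -> A *m A^T \in unitmx.
Proof.
move=> fA; rewrite -row_free_unit; apply: inj_row_free => v vAA0.
apply/(row_free_inj fA); rewrite mul0mx; apply: mulmx_tr_eq0.
by rewrite trmx_mul mulmxA -[v *m A *m A^T]mulmxA vAA0 mul0mx.
Qed.

End gram.

Section kernel_basis.
Context {R : realFieldType} {T : Type}.

(** The points [Z] are taken in [X'] with linearly independent feature vectors and [s] maximal.
    Every [phi x] is then a combination [w *m F], and pairing with the rows of [F] identifies [w] as
    the row of values [k x (Z a)] times the inverse Gram matrix. Only [x] is confined to [X']: with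
    [z] free in [X] this is an identity between kernel sections. *)
Lemma kernel_skeleton N (X X' : set T) (phi : T -> 'rV[R]_N)
    (k : T -> T -> R) :
  (forall x z, X x -> X z -> k x z = (phi x *m (phi z)^T) 0 0) ->
  X' `<=` X ->
  exists (s : nat) (Z : 'I_s -> T),
    [/\ forall a, X' (Z a),
        (\matrix_(a, b) k (Z a) (Z b)) \in unitmx &
        forall x z, X' x -> X z ->
          k x z = \sum_a \sum_b k x (Z a) *
            invmx (\matrix_(a, b) k (Z a) (Z b)) a b * k (Z b) z].
Proof.
move=> kE X'X.
pose Q s := exists Z : 'I_s -> T, (forall a, X' (Z a)) /\
  row_free (\matrix_(a < s) phi (Z a)).
have Q0 : exists s, `[< Q s >].
  exists 0%N; apply/asboolP.
  have e : 'I_0 -> T by case.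
  exists e; split; first by case.
  by rewrite /row_free flatmx0 mxrank0.
have QN s : `[< Q s >] -> (s <= N)%N.
  by move=> /asboolP[Z [_ /eqP <-]]; exact: rank_leq_col.
case: (ex_maxnP Q0 QN) => s /asboolP[Z [ZX' fZ]] smax.
exists s, Z; set G := \matrix_(a, b) _; set F := \matrix_(a < s) phi (Z a).
have GE : G = F *m F^T.
  apply/matrixP => a b; rewrite !mxE kE; [|exact: X'X..].
  by rewrite !mxE; apply: eq_bigr => j _; rewrite !mxE.
have uG : G \in unitmx by rewrite GE gram_unitmx.
split=> // x z X'x Xz.
have phiF : (phi x <= F)%MS.
  (* Otherwise [x] could be adjoined to the family, against the maximality of [s]. *)
  apply: contraT => phiF; suff /smax : `[< Q s.+1 >] by rewrite ltnn.
  apply/asboolP.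
  exists (fun i : 'I_s.+1 => if unlift ord0 i is Some j then Z j else x).
  split; first by move=> i; case: unlift.
  rewrite (_ : \matrix_(_ < _) _ = col_mx (phi x) F :> 'M[R]_(1 + s, N)); last first.
    apply/matrixP => i j; rewrite !mxE; case: splitP => i' ii'.
      rewrite (_ : i = ord0) ?unlift_none//.
        by rewrite [i']ord1.
      by apply/val_inj; rewrite /= ii' ord1.
    by rewrite (_ : i = lift ord0 i') ?liftK ?mxE//; apply/val_inj.
  have phi0 : phi x != 0.
    by apply: contraNneq phiF => ->; rewrite sub0mx.
  have rkE : \rank (col_mx (phi x) F) = \rank (phi x + F)%MS.
    by rewrite addsmxE.
  rewrite /row_free rkE mxrank_disjoint_sum.
    by move/eqP: fZ => ->; rewrite rank_rV phi0.
  (* A nonzero subspace of the line spanned by [phi x] is the whole line, which would put [phi x] in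
     the span of [F]. *)
  apply/eqP; rewrite -mxrank_eq0; apply: contraT; rewrite -lt0n => cap0.
  have := mxrankS (capmxSl (phi x) F); rewrite rank_rV phi0 => cap1.
  have /eqP : \rank (phi x :&: F)%MS = \rank (phi x).
    by apply/eqP; rewrite rank_rV phi0 eqn_leq cap1.
  rewrite mxrank_leqif_sup; last exact: capmxSl.
  by rewrite sub_capmx submx_refl (negbTE phiF).
have [w phiE] : exists w, phi x = w *m F by apply/submxP.
have wE : w *m G = \row_a k x (Z a).
  rewrite GE mulmxA -phiE; apply/rowP => a; rewrite !mxE kE; [|exact: X'X..].
  by rewrite mxE; apply: eq_bigr => j _; rewrite !mxE.
have -> : k x z = (w *m \col_b k (Z b) z) 0 0.
  rewrite kE//; last exact: X'X.
  rewrite phiE -mulmxA; congr ((w *m _) 0 0).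
  apply/colP => b; rewrite !mxE kE//; last exact: X'X.
  by rewrite mxE; apply: eq_bigr => j _; rewrite !mxE.
have -> : w = (\row_a k x (Z a)) *m invmx G by rewrite -wE mulmxK.
rewrite -mulmxA !mxE; apply: eq_bigr => a _.
rewrite !mxE mulr_sumr; apply: eq_bigr => b _.
by rewrite !mxE mulrA.
Qed.

End kernel_basis.

Section moore_penrose_theory.
Context {R : realType}.

(** Full-rank factorization: for A = C D the pseudoinverse is D^T (D D^T)^-1 (C^T C)^-1 C^T, both
    Gram matrices being invertible. *)
Lemma moore_penrose_exists n (A : 'M[R]_n) : exists B, is_moore_penrose A B.
Proof.
suff MP r (C : 'M[R]_(n, r)) (D : 'M[R]_(r, n)) :
    D *m D^T \in unitmx -> C^T *m C \in unitmx ->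
    exists B, is_moore_penrose (C *m D) B.
  rewrite -(mulmx_base A); apply: MP; first by rewrite gram_unitmx// row_base_free.
  rewrite -{2}[col_base A]trmxK gram_unitmx// /row_free mxrank_tr.
  exact: col_base_full.
move=> uD uC; have [A1 AE] : exists A1, C *m D = A1 by exists (C *m D).
pose B := D^T *m invmx (D *m D^T) *m invmx (C^T *m C) *m C^T.
rewrite AE; have AB : A1 *m B = C *m invmx (C^T *m C) *m C^T.
  by rewrite -AE /B !mulmxA -(mulmxA C D) mulmxK.
have BA : B *m A1 = D^T *m invmx (D *m D^T) *m D.
  by rewrite -AE /B !mulmxA -(mulmxA _ C^T C) mulmxKV.
exists B; split.
- by rewrite AB -AE !mulmxA -(mulmxA _ C^T C) mulmxKV.
- by rewrite BA /B !mulmxA -(mulmxA _ D D^T) mulmxKV.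
- by rewrite AB !trmx_mul trmxK trmx_inv trmx_mul trmxK mulmxA.
- by rewrite BA !trmx_mul trmxK trmx_inv trmx_mul trmxK mulmxA.
Qed.

Lemma moore_penroseP n (A : 'M[R]_n) : is_moore_penrose A (moore_penrose A).
Proof.
have [B AB] := moore_penrose_exists A; rewrite /moore_penrose.
by case: xgetP => [C -> //|/(_ B)].
Qed.

Lemma moore_penrose_unit n (A : 'M[R]_n) :
  A \in unitmx -> moore_penrose A = invmx A.
Proof.
move=> uA; have [ABA _ _ _] := moore_penroseP A.
apply: (can_inj (mulKmx uA)); apply: (can_inj (mulmxK uA)).
by rewrite ABA mulmxV// mul1mx.
Qed.

Lemma tr_mulmx_ge0 n (u : 'cV[R]_n) : 0 <= (u^T *m u) 0 0.
Proof. by rewrite mxE sumr_ge0// => i _; rewrite mxE -expr2 sqr_ge0. Qed.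

(** The operator e (A^T A + e)^-1 is a contraction: testing the equation against [u] gives |u|^2 <=
    <u, v>, and |u - v|^2 >= 0 concludes. *)
Lemma tikhonov_le n (A : 'M[R]_n) (e : R) (u v : 'cV[R]_n) : 0 < e ->
  (A^T *m A + e%:M) *m u = e *: v -> (u^T *m u) 0 0 <= (v^T *m v) 0 0.
Proof.
move=> e0 Suv.
have := tr_mulmx_ge0 (u - v); rewrite [(u - v)^T]linearB /= mulmxBl !mulmxBr.
have := tr_mulmx_ge0 (A *m u); rewrite trmx_mul mulmxA -(mulmxA u^T).
have : (v^T *m u) 0 0 = (u^T *m v) 0 0.
  by rewrite -[v^T *m u]trmxK trmx_mul trmxK [LHS]mxE.
have : e * (u^T *m v) 0 0 = (u^T *m (A^T *m A) *m u) 0 0 + e * (u^T *m u) 0 0.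
  transitivity ((u^T *m (e *: v)) 0 0); first by rewrite -scalemxAr [RHS]mxE.
  rewrite -Suv mulmxDl mulmxDr [LHS]mxE mulmxA mul_scalar_mx -scalemxAr.
  by rewrite [X in _ + X]mxE.
have subE (a b : 'M[R]_1) : (a - b) 0 0 = a 0 0 - b 0 0 by rewrite !mxE.
rewrite !subE !mulmxA.
move=> eab -> b0 h.
have : e * (u^T *m u) 0 0 <= e * (u^T *m v) 0 0 by rewrite eab lerDr.
by rewrite ler_pM2l// => uv; lra.
Qed.

Lemma tikhonov_unitmx n (A : 'M[R]_n) (e : R) : 0 < e ->
  A^T *m A + e%:M \in unitmx.
Proof.
move=> e0; rewrite -unitmx_tr -row_free_unit; apply: inj_row_free => v vS0.
have /(tikhonov_le e0) : (A^T *m A + e%:M) *m v^T = e *: 0.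
  by rewrite -[LHS]trmxK trmx_mul trmxK vS0 scaler0 trmx0.
rewrite trmx0 mul0mx [leRHS]mxE => v0; apply: mulmx_tr_eq0.
apply/matrixP => i j; rewrite !ord1 [RHS]mxE.
move: v0 (tr_mulmx_ge0 v^T); rewrite trmxK => v0 v0'.
by apply/eqP; rewrite eq_le v0 v0'.
Qed.

(** Tikhonov regularization. It presents the pseudoinverse, which is not continuous in [A], as a
    pointwise limit of genuine inverses, and thus gives its measurability. *)
Lemma cvg_moore_penrose n (A : 'M[R]_n) i j :
  (fun l => (invmx (A^T *m A + (l.+1%:R^-1)%:M) *m A^T) i j) @ \oo -->
  moore_penrose A i j.
Proof.
move: (moore_penrose A) (moore_penroseP A) => B [ABA BAB ABT BAT].
have AAB : A^T *m A *m B = A^T.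
  by rewrite -mulmxA -ABT -trmx_mul ABA.
(* [C] solves A^T A C = B, so the regularized inverse differs from [B] by [e l] times a bounded
   matrix. *)
pose C := B *m B^T *m B.
have BC : B = A^T *m A *m C.
  rewrite /C !mulmxA AAB -trmx_mul BAT BAB//.
pose e (l : nat) : R := l.+1%:R^-1.
have e_gt0 l : 0 < e l by rewrite invr_gt0.
pose S l := A^T *m A + (e l)%:M.
have SE l : invmx (S l) *m A^T = B - e l *: (C - e l *: (invmx (S l) *m C)).
  have uS : S l \in unitmx by exact: tikhonov_unitmx.
  apply: (can_inj (mulKmx uS)); rewrite mulKVmx// mulmxBr -scalemxAr mulmxBr.
  rewrite -scalemxAr mulKVmx// /S !mulmxDl -BC AAB !mul_scalar_mx.
  by rewrite addrK addrK.
have e0 : e @ \oo --> (0 : R) by exact: cvg_harmonic.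
pose M := `|C i j| + ((col j C)^T *m col j C) 0 0 + 1.
(* Columnwise contraction by [tikhonov_le] bounds the remainder uniformly in [l]; the added 1 comes
   from t <= t^2 + 1. *)
have bnd l : `|(e l *: (invmx (S l) *m C)) i j| <= ((col j C)^T *m col j C) 0 0 + 1.
  pose u := e l *: (invmx (S l) *m col j C).
  have uE : (e l *: (invmx (S l) *m C)) i j = u i 0.
    by rewrite !mxE; congr (_ * _); apply: eq_bigr => a _; rewrite !mxE.
  have : (A^T *m A + (e l)%:M) *m u = e l *: col j C.
    by rewrite -/(S l) -scalemxAr mulKVmx// tikhonov_unitmx.
  move=> /(tikhonov_le (e_gt0 l)) uC; rewrite uE.
  have : `|u i 0| ^+ 2 <= (u^T *m u) 0 0.
    rewrite [leRHS]mxE (bigD1 i)//= [u^T 0 i]mxE -expr2 real_normK ?num_real// lerDl.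
    by rewrite sumr_ge0// => a _; rewrite mxE -expr2 sqr_ge0.
  have := sqr_ge0 (`|u i 0| - 1); move: uC; nra.
have Me0 : (fun l => M * e l) @ \oo --> (0 : R).
  by rewrite -(mulr0 M); exact: cvgMr.
apply: (@squeeze_cvgr _ _ _ _ (fun l => B i j - M * e l)
  (fun l => B i j + M * e l)).
- near=> l; rewrite -/(e l) -/(S l) SE -ler_distlC.
  set z := e l *: (invmx (S l) *m C).
  have -> : B i j - (B - e l *: (C - z)) i j = e l * (C i j - z i j).
    by rewrite !mxE; ring.
  rewrite normrM gtr0_norm// mulrC ler_wpM2r ?(ltW (e_gt0 l))//.
  apply: le_trans (ler_normB _ _) _; rewrite /M -addrA lerD2l; exact: bnd.
- by rewrite -[X in _ --> X]subr0; apply: cvgB => //; exact: cvg_cst.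
- by rewrite -[X in _ --> X]addr0; apply: cvgD => //; exact: cvg_cst.
Unshelve. all: by end_near. Qed.
End moore_penrose_theory.

(** * Perturbed ridge regression *)

Section regression.
Context {R : realFieldType}.

Definition sqnorm n (v : 'cV[R]_n) : R := \sum_i v i 0 ^+ 2.

Lemma sqnorm_ge0 n (v : 'cV[R]_n) : 0 <= sqnorm v.
Proof. by apply: sumr_ge0 => i _; exact: sqr_ge0. Qed.

(** Cauchy-Schwarz through Lagrange's identity: twice the gap is the sum of the squares (a_i b_j -
    a_j b_i)^2. *)
Lemma sqr_dot_le (I : finType) (a b : I -> R) :
  (\sum_i a i * b i) ^+ 2 <= (\sum_i a i ^+ 2) * (\sum_i b i ^+ 2).
Proof.
pose z i j := a i * b j - a j * b i.
have := @sumr_ge0 R I (index_enum _) xpredT (fun i => \sum_j z i j ^+ 2)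
  (fun i _ => sumr_ge0 _ (fun j _ => sqr_ge0 _)).
suff -> : \sum_i \sum_j z i j ^+ 2 =
    2 * ((\sum_i a i ^+ 2) * (\sum_i b i ^+ 2) - (\sum_i a i * b i) ^+ 2).
  by rewrite pmulr_rge0// subr_ge0.
have zE i j : z i j ^+ 2 = a i ^+ 2 * b j ^+ 2 + a j ^+ 2 * b i ^+ 2
    - 2 * ((a i * b i) * (a j * b j)) by rewrite /z; ring.
have sumE (f g : I -> R) :
    \sum_i \sum_j f i * g j = (\sum_i f i) * (\sum_j g j).
  by rewrite mulr_suml; apply: eq_bigr => i _; rewrite mulr_sumr.
under eq_bigr do under eq_bigr do rewrite zE.
under eq_bigr do rewrite !big_split/=.
rewrite !big_split/= !sumE.
under [X in _ + X + _]eq_bigr do under eq_bigr do rewrite mulrC.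
rewrite sumE.
under [X in _ + X]eq_bigr do rewrite sumrN -mulr_sumr -mulr_sumr.
rewrite sumrN -mulr_sumr -mulr_suml; ring.
Qed.

Lemma sqr_sum_le n (a : 'I_n -> R) :
  (\sum_i a i) ^+ 2 <= n%:R * \sum_i a i ^+ 2.
Proof.
have := sqr_dot_le (fun=> 1) a; rewrite sumr_const card_ord expr1n.
by under eq_bigr do rewrite mul1r.
Qed.

Section near_identity.
Variables (n : nat) (K Q : 'M[R]_n) (rho eta : R).
Hypothesis K_psd : forall v : 'cV_n, 0 <= (v^T *m K *m v) 0 0.
Hypothesis Q1 : forall i, Q i i = 1.
Hypothesis Q_eta : forall i j, i != j -> `|Q i j| <= eta.
Hypothesis rho_gt0 : 0 < rho.
Hypothesis eta_ge0 : 0 <= eta.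
Hypothesis eta_lt1 : n%:R * eta < 1.

(** The comparison holds for each pair (i, j), since |Q_ij v_i v_j| <= eta (v_i^2 + v_j^2) / 2 off
    the diagonal. Diagonal pairs are charged [eta] as well, which gives the simple factor n eta. *)
Lemma near_identity_form (v : 'cV_n) :
  (1 - n%:R * eta) * sqnorm v <= (v^T *m Q *m v) 0 0.
Proof.
have -> : (v^T *m Q *m v) 0 0 = \sum_i \sum_j v i 0 * Q i j * v j 0.
  rewrite mxE exchange_big/=; apply: eq_bigr => j _.
  by rewrite !mxE mulr_suml; apply: eq_bigr => i _; rewrite !mxE.
have -> : (1 - n%:R * eta) * sqnorm v = \sum_i \sum_j
    ((i == j)%:R * v i 0 ^+ 2 - eta * ((v i 0 ^+ 2 + v j 0 ^+ 2) / 2)).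
  have rowE i : \sum_j ((i == j)%:R * v i 0 ^+ 2
      - eta * ((v i 0 ^+ 2 + v j 0 ^+ 2) / 2)) =
      v i 0 ^+ 2 - eta * ((n%:R * v i 0 ^+ 2 + sqnorm v) / 2).
    rewrite sumrB -[in X in _ - X = _]mulr_sumr; congr (_ - _ * _).
      rewrite (bigD1 i)//= eqxx mul1r.
      by rewrite big1 ?addr0// => j /negbTE; rewrite eq_sym => ->; rewrite mul0r.
    by rewrite -mulr_suml big_split/= sumr_const card_ord -[_ ^+ 2 *+ n]mulr_natl.
  under eq_bigr do rewrite rowE.
  rewrite sumrB -mulr_sumr -mulr_suml big_split/= sumr_const card_ord.
  rewrite -mulr_sumr -/(sqnorm v) -[sqnorm v *+ n]mulr_natl; by field.
apply: ler_sum => i _; apply: ler_sum => j _.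
have [->|ij] := eqVneq i j.
  rewrite Q1 mul1r mulr1 -expr2 lerBlDr lerDl mulr_ge0// divr_ge0//.
  by rewrite addr_ge0// sqr_ge0.
have := Q_eta ij; rewrite ler_norml mul0r sub0r => /andP[Ql Qr].
have : 0 <= (eta - Q i j) * (v i 0 - v j 0) ^+ 2.
  by rewrite mulr_ge0 ?sqr_ge0// subr_ge0.
have : 0 <= (eta + Q i j) * (v i 0 + v j 0) ^+ 2.
  by rewrite mulr_ge0 ?sqr_ge0// -lerBlDl sub0r.
nra.
Qed.

(** Testing the system against [u] discards the positive semidefinite [K] and leaves l |u|^2 <= <u,
    Y> with l = rho (1 - n eta); expanding |l u - Y|^2 >= 0 concludes. *)
Lemma near_identity_le (u Y : 'cV_n) : (K + rho *: Q) *m u = Y ->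
  (rho * (1 - n%:R * eta)) ^+ 2 * sqnorm u <= sqnorm Y.
Proof.
move=> uY; set l := rho * _.
have l0 : 0 < l by rewrite mulr_gt0// subr_gt0.
have uYl : l * sqnorm u <= \sum_i u i 0 * Y i 0.
  rewrite (_ : \sum_i _ = (u^T *m Y) 0 0); last first.
    by rewrite mxE; apply: eq_bigr => i _; rewrite mxE.
  rewrite -uY mulmxDl mulmxDr -scalemxAl -scalemxAr !mulmxA.
  rewrite mxE [X in _ + X]mxE -[leLHS]add0r lerD// /l -mulrA.
  by rewrite ler_wpM2l ?(ltW rho_gt0)// near_identity_form.
have : 0 <= \sum_i (l * u i 0 - Y i 0) ^+ 2.
  by apply: sumr_ge0 => i _; exact: sqr_ge0.
have -> : \sum_i (l * u i 0 - Y i 0) ^+ 2 = l ^+ 2 * sqnorm u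
    - 2 * l * (\sum_i u i 0 * Y i 0) + sqnorm Y.
  rewrite /sqnorm !mulr_sumr -sumrB -big_split/=.
  by apply: eq_bigr => i _; ring.
have := ler_wpM2l (ltW l0) uYl.
by rewrite mulrA -expr2 -mulrA; lra.
Qed.

Lemma near_identity_unitmx : K + rho *: Q \in unitmx.
Proof.
rewrite -unitmx_tr -row_free_unit; apply: inj_row_free => v vA0.
have /near_identity_le : (K + rho *: Q) *m v^T = 0.
  by rewrite -[LHS]trmxK trmx_mul trmxK vA0 trmx0.
rewrite [X in _ <= X]big1; last by move=> i _; rewrite mxE expr0n.
rewrite pmulr_rle0; last by rewrite exprn_gt0// mulr_gt0// subr_gt0.
move=> v0; have /eqP : sqnorm v^T = 0 by apply/le_anti; rewrite v0 sqnorm_ge0.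
rewrite psumr_eq0; last by move=> i _; rewrite sqr_ge0.
move=> /allP v0'; apply/rowP => i.
by have := v0' i (mem_index_enum _); rewrite sqrf_eq0 !mxE => /eqP.
Qed.

Lemma near_identity_residual (u : 'cV_n) :
  sqnorm (u - Q *m u) <= (n%:R * eta) ^+ 2 * sqnorm u.
Proof.
have h i : (u - Q *m u) i 0 ^+ 2 <= eta ^+ 2 * (n%:R * sqnorm u).
  have -> : (u - Q *m u) i 0 = - \sum_j (if j == i then 0 else Q i j * u j 0).
    rewrite !mxE (bigD1 i)//= Q1 mul1r opprD addrA subrr add0r; congr (- _).
    rewrite [RHS](bigD1 i)//= eqxx add0r; apply: eq_bigr => j.
    by move=> /negbTE ->.
  rewrite sqrrN (le_trans (sqr_sum_le _))// mulrCA ler_wpM2l ?ler0n//.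
  rewrite /sqnorm mulr_sumr ler_sum// => j _.
  case: eqP => [_|/eqP ji]; first by rewrite expr0n mulr_ge0// sqr_ge0.
  rewrite exprMn ler_wpM2r ?sqr_ge0// -[leLHS]real_normK ?num_real//.
  by rewrite lerXn2r ?nnegrE// Q_eta// eq_sym.
apply: (@le_trans _ _ (\sum_(i < n) eta ^+ 2 * (n%:R * sqnorm u))).
  by apply: ler_sum => i _; exact: h.
rewrite sumr_const card_ord -[_ *+ n]mulr_natl.
by rewrite le_eqVlt; apply/orP; left; apply/eqP; ring.
Qed.

End near_identity.

(** In the fixed-point form e = S^-1 (w - (N - S) e), the smallness condition lets the maximum norm
    [E] of [e] absorb the perturbation: E <= s L W + E / 2. *)
Lemma perturbed_solution_le s (N S : 'M[R]_s) (L h W : R) (e w : 'cV[R]_s) :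
  S \in unitmx -> 0 <= L -> 0 <= h -> 0 <= W ->
  (forall a b, `|invmx S a b| <= L) -> (forall a b, `|N a b - S a b| <= h) ->
  s%:R * s%:R * L * h <= 2^-1 -> N *m e = w -> (forall a, `|w a 0| <= W) ->
  forall a, `|e a 0| <= 2 * s%:R * L * W.
Proof.
move=> uS L0 h0 W0 SL Nh sLh New wW.
pose E := \big[Num.max/0]_a `|e a 0|.
have eE a : `|e a 0| <= E by exact: le_bigmax.
have E0 : 0 <= E by rewrite bigmax_ge_id.
have eLE a : `|e a 0| <= s%:R * L * W + E / 2.
  have -> : e = invmx S *m (w - (N - S) *m e).
    by apply: (can_inj (mulKmx uS)); rewrite mulKVmx// mulmxBl New opprB addrC subrK.
  rewrite mxE (le_trans (ler_norm_sum _ _ _))//.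
  have le1 b : `|invmx S a b * (w - (N - S) *m e) b 0| <= L * (W + s%:R * h * E).
    rewrite normrM ler_pM// mxE [X in _ + X]mxE (le_trans (ler_normB _ _))//.
    rewrite lerD// mxE (le_trans (ler_norm_sum _ _ _))//.
    apply: (@le_trans _ _ (\sum_(j < s) h * E)).
      apply: ler_sum => j _; rewrite normrM ler_pM//.
      by have := Nh b j; rewrite !mxE.
    by rewrite sumr_const card_ord -[_ *+ s]mulr_natl mulrA.
  apply: (@le_trans _ _ (\sum_(b < s) L * (W + s%:R * h * E))).
    by apply: ler_sum => b _; exact: le1.
  rewrite sumr_const card_ord -[_ *+ s]mulr_natl mulrDr mulrDr -!mulrA lerD2l.
  have := ler_wpM2r E0 sLh; rewrite -!mulrA; lra.
have : E <= s%:R * L * W + E / 2.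
  apply: bigmax_le => //.
  by rewrite addr_ge0 ?divr_ge0// mulr_ge0// mulr_ge0.
by move=> hE a; rewrite (le_trans (eE a))//; move: hE; lra.
Qed.

End regression.

Section regression_error.
Context {R : rcfType}.

(** Passage from the dual system, of size [n], to the primal one, of size [s]. The coefficients [th]
    of the estimator satisfy G th = Psi^T u; writing rho Q u as rho u minus the residual rho (u - Q
    u) and multiplying by Psi^T turns [G] into the ridge regularizer. *)
Lemma residual_equation n s (Psi : 'M[R]_(n, s)) (G : 'M[R]_s) (Q : 'M[R]_n)
    (rho : R) (u eps : 'cV[R]_n) (c : 'cV[R]_s) : G \in unitmx ->
  (Psi *m invmx G *m Psi^T + rho *: Q) *m u = Psi *m c + eps ->
  (Psi^T *m Psi + rho *: G) *m (invmx G *m Psi^T *m u - c) =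
  Psi^T *m eps - rho *: (G *m c) + Psi^T *m (rho *: (u - Q *m u)).
Proof.
move=> uG uE; set th := invmx G *m Psi^T *m u.
have Gth : G *m th = Psi^T *m u by rewrite /th -mulmxA mulKVmx.
have {}uE : Psi *m th + rho *: u =
    Psi *m c + eps + rho *: (u - Q *m u).
  rewrite -uE mulmxDl -scalemxAl scalerBr addrA [X in _ = X - _]addrAC addrK.
  by rewrite /th !mulmxA.
have -> : (Psi^T *m Psi + rho *: G) *m (th - c) =
    Psi^T *m (Psi *m th + rho *: u) - Psi^T *m (Psi *m c) - rho *: (G *m c).
  rewrite mulmxBr !mulmxDl -!scalemxAl Gth mulmxDr -scalemxAr !mulmxA.
  by rewrite opprD addrA.
rewrite uE !mulmxDr; set w := Psi^T *m (rho *: _).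
move: (Psi^T *m (Psi *m c)) (Psi^T *m eps) (rho *: (G *m c)) w => A B C w.
by apply/matrixP => i j; rewrite !mxE; ring.
Qed.

Variables (n s : nat) (Psi : 'M[R]_(n, s)) (G S : 'M[R]_s) (Q : 'M[R]_n).
Variables (rho eta L h tau gamma : R) (u eps : 'cV[R]_n) (c : 'cV[R]_s).
Hypothesis n_gt0 : (0 < n)%N.
Hypothesis Psi_le1 : forall i a, `|Psi i a| <= 1.
Hypothesis G_unit : G \in unitmx.
Hypothesis K_psd : forall v : 'cV[R]_n,
  0 <= (v^T *m (Psi *m invmx G *m Psi^T) *m v) 0 0.
Hypothesis Q1 : forall i, Q i i = 1.
Hypothesis Q_eta : forall i j, i != j -> `|Q i j| <= eta.
Hypothesis rho_gt0 : 0 < rho.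
Hypothesis eta_ge0 : 0 <= eta.
Hypothesis eta_lt1 : n%:R * eta < 1.
Hypothesis S_unit : S \in unitmx.
Hypothesis S_le : forall a b, `|invmx S a b| <= L.
Hypothesis L_ge0 : 0 <= L.
Hypothesis PsiPsi_S : forall a b,
  `|n%:R^-1 * (Psi^T *m Psi) a b - S a b| <= h / 2.
Hypothesis rhoG_le : forall a b, `|n%:R^-1 * rho * G a b| <= h / 2.
Hypothesis Lh_le : s%:R * s%:R * L * h <= 2^-1.
Hypothesis h_ge0 : 0 <= h.
Hypothesis noise_le : forall a, `|(Psi^T *m eps) a 0| <= tau.
Hypothesis bias_le : forall a, `|(G *m c) a 0| <= gamma.
Hypothesis tau_ge0 : 0 <= tau.
Hypothesis gamma_ge0 : 0 <= gamma.
Hypothesis uE :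
  (Psi *m invmx G *m Psi^T + rho *: Q) *m u = Psi *m c + eps.

Let Y := Psi *m c + eps.
Let D := sqnorm Y / (1 - n%:R * eta) ^+ 2.
Let nr : 0 < n%:R :> R. Proof. by rewrite ltr0n. Qed.
Let neta : 0 < 1 - n%:R * eta. Proof. by rewrite subr_gt0. Qed.

Let rho2u_le : rho ^+ 2 * sqnorm u <= D.
Proof.
rewrite /D ler_pdivlMr ?exprn_gt0// mulrAC -exprMn.
exact: near_identity_le uE.
Qed.

Let resid_le : sqnorm (rho *: (u - Q *m u)) <= (n%:R * eta) ^+ 2 * D.
Proof.
have -> : sqnorm (rho *: (u - Q *m u)) = rho ^+ 2 * sqnorm (u - Q *m u).
  rewrite /sqnorm mulr_sumr; apply: eq_bigr => i _.
  by rewrite [X in X ^+ 2 = _]mxE exprMn.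
rewrite (le_trans _ (ler_wpM2l (sqr_ge0 _) rho2u_le))// mulrCA.
by rewrite ler_wpM2l ?sqr_ge0// (near_identity_residual Q1 Q_eta eta_ge0).
Qed.

Let W2 := tau ^+ 2 + rho ^+ 2 * gamma ^+ 2 + n%:R * ((n%:R * eta) ^+ 2 * D).

Lemma coefficient_error_le a :
  (invmx G *m Psi^T *m u - c) a 0 ^+ 2 <=
  3 * (2 * s%:R * L) ^+ 2 / n%:R ^+ 2 * W2.
Proof.
set d := Num.sqrt (n%:R * ((n%:R * eta) ^+ 2 * D)).
have D0 : 0 <= D by rewrite divr_ge0 ?sqnorm_ge0// sqr_ge0.
have d2 : d ^+ 2 = n%:R * ((n%:R * eta) ^+ 2 * D).
  by rewrite sqr_sqrtr// mulr_ge0 ?ler0n// mulr_ge0// sqr_ge0.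
pose W := n%:R^-1 * (tau + rho * gamma + d).
have := residual_equation G_unit uE; set e := _ - c => eE.
have {}eE : (n%:R^-1 *: (Psi^T *m Psi + rho *: G)) *m e =
  n%:R^-1 *: (Psi^T *m eps - rho *: (G *m c) + Psi^T *m (rho *: (u - Q *m u))).
  by rewrite -scalemxAl eE.
have W0 : 0 <= W.
  rewrite mulr_ge0 ?invr_ge0 ?ler0n// !addr_ge0 ?sqrtr_ge0//.
  by rewrite mulr_ge0// ltW.
have eW : `|e a 0| <= 2 * s%:R * L * W.
  apply: (perturbed_solution_le S_unit L_ge0 h_ge0 W0 S_le _ Lh_le eE).
    (* One half of [h] pays for the deviation of the empirical moments, the other half for the
       regularizer. *)
    move=> b b'; rewrite mxE [(Psi^T *m Psi + _) b b']mxE mulrDr.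
    rewrite [(rho *: G) b b']mxE addrAC mulrA [h]splitr.
    by rewrite (le_trans (ler_normD _ _))// lerD.
  move=> b; rewrite mxE normrM gtr0_norm ?invr_gt0// ler_wpM2l ?invr_ge0 ?ler0n//.
  rewrite mxE (le_trans (ler_normD _ _))// lerD//.
    rewrite mxE (le_trans (ler_normD _ _))// lerD// mxE normrN mxE normrM.
    by rewrite gtr0_norm// ler_wpM2l// ltW.
  rewrite -sqrtr_sqr ler_sqrt; last first.
    by rewrite mulr_ge0 ?ler0n// mulr_ge0// sqr_ge0.
  rewrite mxE (le_trans (sqr_dot_le _ _))// ler_pM//.
  - by apply: sumr_ge0 => i _; exact: sqr_ge0.
  - exact: sqnorm_ge0.
  - rewrite -[n%:R]mulr1 mulr_natl -[X in _ *+ X]card_ord -sumr_const ler_sum// => i _.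
    by rewrite mxE -[leLHS]real_normK ?num_real// expr_le1.
have : `|e a 0| ^+ 2 <= (2 * s%:R * L * W) ^+ 2.
  by rewrite lerXn2r ?nnegrE// (le_trans _ eW).
rewrite real_normK ?num_real// => /le_trans; apply.
have -> : 3 * (2 * s%:R * L) ^+ 2 / n%:R ^+ 2 * W2 =
    (2 * s%:R * L) ^+ 2 * (n%:R^-1 ^+ 2 * (3 * W2)).
  by rewrite -exprVn; ring.
rewrite [in leLHS]exprMn ler_wpM2l ?sqr_ge0// /W exprMn ler_wpM2l ?sqr_ge0//.
rewrite /W2 -d2 -exprMn; set r := rho * gamma.
have := sqr_ge0 (tau - r); have := sqr_ge0 (tau - d); have := sqr_ge0 (r - d).
nra.
Qed.

(** The error at a point splits into the regression part [psi *m e] and the spike part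
    [rho *: (kq *m u)]. In 24 = 2 * 3 * 2^2, the 2 comes from squaring this sum and the rest from
    [coefficient_error_le]; of the four factors [s], two come from Cauchy-Schwarz over the
    coordinates and two from the coefficients. *)
Lemma prediction_error_le (psi : 'rV[R]_s) (kq : 'rV[R]_n) :
  (forall a, `|psi 0 a| <= 1) ->
  ((psi *m invmx G *m Psi^T + rho *: kq) *m u - psi *m c) 0 0 ^+ 2 <=
  24 * s%:R ^+ 4 * L ^+ 2 / n%:R ^+ 2 * W2 + 2 * D * \sum_i kq 0 i ^+ 2.
Proof.
move=> psi1; set e := invmx G *m Psi^T *m u - c.
have -> : (psi *m invmx G *m Psi^T + rho *: kq) *m u - psi *m c =
    psi *m e + rho *: (kq *m u).
  by rewrite /e mulmxBr mulmxDl -scalemxAl !mulmxA addrAC.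
rewrite mxE [X in (_ + X) ^+ 2]mxE.
set x := (psi *m e) 0 0; set y := (kq *m u) 0 0.
have xle : x ^+ 2 <= s%:R * (s%:R * (3 * (2 * s%:R * L) ^+ 2 / n%:R ^+ 2 * W2)).
  rewrite /x mxE (le_trans (sqr_dot_le _ _))// ler_pM//.
  - by apply: sumr_ge0 => i _; exact: sqr_ge0.
  - by apply: sumr_ge0 => i _; exact: sqr_ge0.
  - rewrite -[s%:R]mulr1 mulr_natl -[X in _ *+ X]card_ord -sumr_const ler_sum// => i _.
    by rewrite -[leLHS]real_normK ?num_real// expr_le1.
  - rewrite mulr_natl -[X in _ *+ X]card_ord -sumr_const ler_sum// => i _.
    exact: coefficient_error_le.
have yle : y ^+ 2 <= (\sum_i kq 0 i ^+ 2) * sqnorm u.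
  by rewrite /y mxE sqr_dot_le.
have kq0 : 0 <= \sum_i kq 0 i ^+ 2.
  by apply: sumr_ge0 => i _; exact: sqr_ge0.
have {}yle : (rho * y) ^+ 2 <= D * \sum_i kq 0 i ^+ 2.
  rewrite exprMn (le_trans (ler_wpM2l (sqr_ge0 _) yle))// mulrCA mulrC.
  by rewrite ler_wpM2r.
have : (x + rho * y) ^+ 2 <= 2 * x ^+ 2 + 2 * (rho * y) ^+ 2.
  by have := sqr_ge0 (x - rho * y); nra.
move=> /le_trans; apply; apply: lerD.
  rewrite (le_trans (ler_wpM2l _ xle))// le_eqVlt; apply/orP; left; apply/eqP.
  by ring.
by rewrite -mulrA ler_wpM2l.
Qed.

End regression_error.

(** * Moments and independence *)

Lemma measurable_lt_set {R : realType} {d0} {T : measurableType d0}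
    (f g : T -> R) :
  measurable_fun setT f -> measurable_fun setT g -> measurable [set x | f x < g x].
Proof.
move=> mf mg; rewrite (_ : [set _ | _] = setT `&` [set x | (f x)%:E < (g x)%:E]%E).
  by apply: measurable_lte => //; exact/measurable_EFinP.
by rewrite setTI; apply/seteqP; split=> x /=; rewrite lte_fin.
Qed.

Lemma measurable_le_set {R : realType} {d0} {T : measurableType d0}
    (f g : T -> R) :
  measurable_fun setT f -> measurable_fun setT g -> measurable [set x | f x <= g x].
Proof. by move=> mf mg; rewrite -[X in measurable X]setTI; exact: measurable_fun_le. Qed.

Section moments.
Context {R : realType} {d0 : measure_display} {Omega : measurableType d0}.
Variable P : probability Omega R.
Local Open Scope ereal_scope.

(** Markov's inequality with the scale [A] kept apart from the threshold [t], so that the bound b /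
    t survives when [A] is zero. This happens when the noise variance, or the second moment of the
    labels, vanishes. *)
Lemma markov_scaled (W : Omega -> R) (A b t : R) :
  measurable_fun setT W -> (forall w, (0 <= W w)%R) ->
  (0 <= A)%R -> (0 <= b)%R -> (0 < t)%R ->
  \int[P]_w (W w)%:E <= (A * b)%:E ->
  P [set w | (A * t < W w)%R] <= (b / t)%:E.
Proof.
move=> mW W0 A0 b0 t0 WA.
have mE : measurable [set w | (A * t < W w)%R].
  exact: measurable_lt_set.
have [A0'|A0'] := eqVneq A 0%R; last first.
  have {}A0 : (0 < A)%R by rewrite lt_def A0'.
  have : (A * t)%:E * P [set w | (A * t < W w)%R] <= (A * b)%:E.
    apply: le_trans WA; rewrite -integral_cst//.
    apply: (@le_trans _ _ (\int[P]_(w in [set w | (A * t < W w)%R]) (W w)%:E)).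
      apply: ge0_le_integral => //.
      - by move=> w _; rewrite lee_fin mulr_ge0// ltW.
      - exact/measurable_EFinP/measurable_funTS.
      - by move=> w /= /ltW; rewrite lee_fin.
    apply: ge0_subset_integral => //; first exact/measurable_EFinP.
    by move=> w _; rewrite lee_fin.
  rewrite -lee_pdivlMl ?mulr_gt0//; move=> /le_trans; apply.
  rewrite -EFinM lee_fin invfM mulrAC mulrA mulVf// mul1r.
  by rewrite mulrC.
(* For A = 0 the expectation of [W] is zero, so [W] vanishes almost surely and the event is
   negligible. *)
have W0' : \int[P]_w `|(W w)%:E| = 0.
  apply/eqP; rewrite eq_le integral_ge0// andbT.
  by move: WA; rewrite A0' mul0r; under eq_integral do
    rewrite -[(W _)%:E]gee0_abs ?lee_fin//.
have mEW : measurable_fun setT (EFin \o W) by exact/measurable_EFinP.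
have /(ae_eq_integral_abs P measurableT mEW) W0ae := W0'.
rewrite measure_negligible// ?lee_fin; last first.
  apply: negligibleS W0ae => w /=; rewrite A0' mul0r => Ww /(_ I) [W0w].
  by move: Ww; rewrite W0w ltxx.
by rewrite divr_ge0// ltW.
Qed.

End moments.

Section conditional_mean.
Context {R : realType} {d0 d1 : measure_display}.
Context {Omega : measurableType d0} {T : measurableType d1}.
Variable P : probability Omega R.
Local Open Scope ereal_scope.

Import HBNNSimple.

(** The conditional expectation is defined by testing on events only. Simple functions increasing to
    [h] extend the test to [h]; they stay between 0 and 1, so |W| dominates and the limit passes
    through the integral. *)
Lemma cond_mean0_ge0 (X : {mfun Omega >-> T}) (W : Omega -> R) (h : T -> R) :
  is_cond_expectation P X W (cst 0%R) -> measurable_fun setT h ->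
  (forall x, (0 <= h x <= 1)%R) -> \int[P]_w (h (X w) * W w)%:E = 0.
Proof.
move=> [iW _ W0] mh h01.
have mW : measurable_fun setT W by apply/measurable_EFinP; exact: measurable_int iW.
have {}W0 B : measurable B -> \int[P]_(w in X @^-1` B) (W w)%:E = 0.
  by move=> mB; rewrite W0//= integral0.
have mH : measurable_fun setT (EFin \o h) by exact/measurable_EFinP.
pose g := nnsfun_approx measurableT mH.
have gh x : EFin \o g^~ x @ \oo --> (h x)%:E.
  by apply: cvg_nnsfun_approx => // y _; rewrite lee_fin; case/andP: (h01 y).
have g_le n x : (0 <= g n x <= 1)%R.
  apply/andP; split; first exact: fun_ge0.
  rewrite nnsfun_approxE; have /andP[h0 h1] := h01 x; apply: le_trans h1.
  rewrite -lee_fin; apply: (@le_approx _ _ _ setT (EFin \o h)) => // y _.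
  by rewrite lee_fin; case/andP: (h01 y).
have mgX n : measurable_fun setT (g n \o X) by exact: measurableT_comp.
have m1X A : measurable A -> measurable_fun setT (fun w => \1_A (X w) : R).
  move=> mA; rewrite (_ : (fun w => _) = \1_(X @^-1` A)).
    by apply: measurable_indic; rewrite -[X in measurable X]setTI; exact: measurable_funP.
  by apply/funext => w; rewrite !indicE; congr (_%:R); apply/idP/idP; rewrite !inE.
have g0 n : \int[P]_w (g n (X w) * W w)%:E = 0.
  under eq_integral => w _ do rewrite fimfunE fsbig_finite//= mulr_suml -sumEFin.
  rewrite integral_sum//=; last first.
    move=> r; apply: (le_integrable measurableT _ _ (integrableZl measurableT r iW)).
      apply/measurable_EFinP; apply: measurable_funM => //.
      apply: measurable_funM => //.
      exact: m1X.
    move=> w _ /=; rewrite lee_fin !normrM ler_wpM2r// ler_piMr//.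
    by rewrite indicE; case: (_ \in _); rewrite ?normr1 ?normr0.
  rewrite big1// => r _.
  under eq_integral do rewrite -mulrA EFinM.
  have mgr : measurable (g n @^-1` [set r]) by [].
  rewrite integralZl//; last first.
    apply: (le_integrable measurableT _ _ iW).
      apply/measurable_EFinP; apply: measurable_funM => //.
      exact: m1X.
    move=> w _ /=; rewrite lee_fin !normrM ler_piMl//.
    by rewrite indicE; case: (_ \in _); rewrite ?normr1 ?normr0.
  rewrite [X in _ * X](_ : _ = 0) ?mule0// -[RHS](W0 _ mgr) [RHS]integral_mkcond.
  apply: eq_integral => w _; rewrite /patch indicE.
  rewrite (_ : (X w \in _) = (w \in X @^-1` (g n @^-1` [set r]))).
    by case: ifPn => _; rewrite ?mul1r ?mul0r.
  by apply/idP/idP; rewrite !inE.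
have := @dominated_convergence _ _ _ P setT measurableT
  (fun n w => (g n (X w) * W w)%:E) (fun w => (h (X w) * W w)%:E)
  (fun w => `|(W w)%:E|).
case.
- by move=> n; apply/measurable_EFinP; apply: measurable_funM => //; exact: mgX.
- by apply/measurable_EFinP; apply: measurable_funM => //; exact: measurableT_comp.
- apply: aeW => w _; under eq_fun do rewrite EFinM; rewrite EFinM.
  by apply: cvgeZr => //; exact: gh.
- exact: integrable_abse.
- apply: aeW => w n _ /=; rewrite lee_fin normrM ler_piMl//.
  by have /andP[? ?] := g_le n (X w); rewrite ger0_norm.
- move=> _ _; under eq_fun do rewrite g0.
  by move=> /cvg_lim <- //; rewrite lim_cst.
Qed.

End conditional_mean.

Section independence.
Context {R : realType} {d0 d1 : measure_display}.
Context {Omega : measurableType d0} {T : measurableType d1}.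
Variable P : probability Omega R.
Variable Z : nat -> {mfun Omega >-> T}.
Hypothesis indepZ : mutually_independent P (fun i w => Z i w).
Local Open Scope ereal_scope.

Lemma indep_pair i j A B : i != j -> measurable A -> measurable B ->
  P (Z i @^-1` A `&` Z j @^-1` B) = P (Z i @^-1` A) * P (Z j @^-1` B).
Proof.
move=> ij mA mB.
have := indepZ [fset i; j]%fset (B := fun l => if l == i then A else B).
rewrite big_fsetU1 ?inE//= big_seq_fset1 eqxx eq_sym (negbTE ij) => <-; last first.
  by move=> l; case: ifP.
congr (P _); apply/seteqP; split => [w [Aw Bw] l /=|w /= ABw].
  by rewrite !inE => /orP[/eqP ->|/eqP ->]; rewrite ?eqxx// eq_sym (negbTE ij).
split.
  by have := ABw i; rewrite /= !inE eqxx/= => /(_ isT).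
by have := ABw j; rewrite /= !inE eqxx orbT => /(_ isT); rewrite eq_sym (negbTE ij).
Qed.

Let law i : probability T R := distribution P (Z i).

Let pair i j (w : Omega) := (Z i w, Z j w).

Let mpair i j : measurable_fun setT (pair i j).
Proof. exact: measurable_fun_pair. Qed.

Lemma joint_law i j (A : set (T * T)) : i != j -> measurable A ->
  P (pair i j @^-1` A) = (law i \x law j) A.
Proof.
move=> ij mA.
pose mixin := isMeasurableFun.Build _ _ _ _ _ (mpair i j).
pose W : {mfun Omega >-> (T * T)%type} := HB.pack (pair i j) mixin.
have := @product_measure_unique _ _ _ _ R (law i) (law j) (pushforward P W).
move=> ->//.
by move=> B C mB mC; exact: indep_pair.
Qed.

Lemma pair_preimage_le i j (A : set (T * T)) (c : \bar R) : i != j ->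
  measurable A ->
  (forall x, P (Z j @^-1` [set y | A (x, y)]) <= c) ->
  P (pair i j @^-1` A) <= c.
Proof.
move=> ij mA Ac; rewrite joint_law// /product_measure1.
have c0 : 0 <= c by apply: le_trans (Ac point).
apply: (@le_trans _ _ (\int[law i]_x c)).
  apply: ge0_le_integral => //.
  - exact: measurable_fun_xsection.
  - by move=> x _; rewrite /= xsectionE; exact: Ac.
rewrite integral_cst// -[leRHS]mule1 lee_wpmul2l//. exact: (@probability_le1 _ _ _ (law i)).
Qed.

Lemma indep_integral_mul0 i j (u v : T -> R) : i != j ->
  measurable_fun setT u -> measurable_fun setT v ->
  P.-integrable setT (fun w => (u (Z i w))%:E) ->
  P.-integrable setT (fun w => (v (Z j w))%:E) ->
  P.-integrable setT (fun w => (u (Z i w) * v (Z j w))%:E) ->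
  \int[P]_w (v (Z j w))%:E = 0 ->
  \int[P]_w (u (Z i w) * v (Z j w))%:E = 0.
Proof.
move=> ij mu mv iu iv iuv v0.
pose f (z : T * T) : \bar R := (u z.1 * v z.2)%:E.
have mf : measurable_fun setT f.
  apply/measurable_EFinP; apply: measurable_funM.
    by apply: measurableT_comp => //; exact: measurable_fst.
  by apply: measurableT_comp => //; exact: measurable_snd.
have := @integral_pushforward _ _ _ _ _ _ (mpair i j) P setT f mf iuv measurableT.
rewrite preimage_setT => <-.
rewrite (eq_measure_integral (law i \x law j)); last first.
  by move=> A mA _; exact: joint_law.
have mev : measurable_fun setT (EFin \o v) by exact/measurable_EFinP.
have meu : measurable_fun setT (EFin \o u) by exact/measurable_EFinP.
have iv' : (law j).-integrable setT (EFin \o v) by exact: integrable_pushforward.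
have iu' : (law i).-integrable setT (EFin \o u) by exact: integrable_pushforward.
have v0' : \int[law j]_y (v y)%:E = 0 by rewrite integral_pushforward.
rewrite -integral12_prod_meas1//; last first.
  apply/integrable12ltyP => //.
  under eq_integral => x _.
    under eq_integral do rewrite /f /= normrM EFinM.
    rewrite ge0_integralZl//; last by apply/measurable_EFinP; exact: measurableT_comp.
    over.
  have nv : \int[law j]_x `|v x|%:E < +oo by have /integrableP[] := iv'.
  have nu : \int[law i]_x `|u x|%:E < +oo by have /integrableP[] := iu'.
  have nv0 : 0 <= \int[law j]_x `|v x|%:E by exact: integral_ge0.
  have nu0 : 0 <= \int[law i]_x `|u x|%:E by exact: integral_ge0.
  rewrite ge0_integralZr//; last by apply/measurable_EFinP; exact: measurableT_comp.
  by rewrite lte_mul_pinfty// ge0_fin_numE.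
rewrite /fubini_F integral0_eq// => x _.
under eq_integral do rewrite /f /= EFinM.
by rewrite integralZl// v0' mule0.
Qed.

(** In the expanded square the cross terms vanish by independence and centering, which leaves [n]
    second moments. *)
Lemma variance_indep_sum (n : nat) (u : T -> R) (v : R) :
  measurable_fun setT u ->
  (forall i, P.-integrable setT (fun w => (u (Z i w) ^+ 2)%:E)) ->
  (forall i, \int[P]_w (u (Z i w))%:E = 0) ->
  (forall i, \int[P]_w (u (Z i w) ^+ 2)%:E <= v%:E) ->
  \int[P]_w ((\sum_(i < n) u (Z i w)) ^+ 2)%:E <= (n%:R * v)%:E.
Proof.
move=> mu iu2 u0 uv.
have muZ i : measurable_fun setT (fun w => u (Z i w)) by exact: measurableT_comp.
have iuu i j : P.-integrable setT (fun w => (u (Z i w) * u (Z j w))%:E).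
  apply: (le_integrable measurableT _ _ (integrableD measurableT (iu2 i) (iu2 j))).
    by apply/measurable_EFinP; exact: measurable_funM.
  move=> w _ /=; rewrite lee_fin normrM [leRHS]ger0_norm ?addr_ge0 ?sqr_ge0//.
  rewrite -[X in (_ <= X + _)%R]real_normK ?num_real//.
  rewrite -[X in (_ <= _ + X)%R]real_normK ?num_real//.
  have := sqr_ge0 (`|u (Z i w)| - `|u (Z j w)|).
  by have := normr_ge0 (u (Z i w)); have := normr_ge0 (u (Z j w)); nra.
have iu i : P.-integrable setT (fun w => (u (Z i w))%:E).
  have i1 : P.-integrable setT (EFin \o cst (1 : R)%R).
    exact: finite_measure_integrable_cst.
  apply: (le_integrable measurableT _ _ (integrableD measurableT (iu2 i) i1)).
    exact/measurable_EFinP.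
  move=> w _ /=; rewrite lee_fin [leRHS]ger0_norm ?addr_ge0 ?sqr_ge0//.
  rewrite -[X in (_ <= X + _)%R]real_normK ?num_real//.
  by have := sqr_ge0 (`|u (Z i w)| - 1); nra.
under eq_integral => w _.
  rewrite expr2 mulr_suml -sumEFin.
  under eq_bigr do rewrite mulr_sumr -sumEFin.
  over.
rewrite integral_sum//=; last by move=> i; apply: integrable_sum => // j _; exact: iuu.
rewrite (_ : (n%:R * v)%:E = \sum_(i < n) v%:E); last first.
  by rewrite sumEFin sumr_const card_ord mulr_natl.
apply: lee_sum => i _; rewrite integral_sum//=.
rewrite (bigD1 i)//= big1 ?adde0.
  by under eq_integral do rewrite -expr2; exact: uv.
move=> j ji; apply: indep_integral_mul0 => //; rewrite eq_sym.
by apply: contra_neq ji => /val_inj.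
Qed.

End independence.

(** * Hölder bound for the density, and the Euclidean norm *)

Section density.
Context {R : realType} {d1 : measure_display} {T : measurableType d1}.
Variable m : {measure set T -> \bar R}.
Local Open Scope ereal_scope.

Lemma hoelder_conjugate_fin (p : \bar R) : 1 < p ->
  (0 < fine (hoelder_conjugate p))%R.
Proof.
case: p => [r| |] p1 //.
move: p1; rewrite lte_fin /hoelder_conjugate/= => r1.
have r0 : (0 < r)%R by rewrite (lt_trans ltr01).
by rewrite eqe gt_eqF// inver subr_eq0 gt_eqF//= divr_gt0 ?subr_gt0.
Qed.

(** Hölder's inequality for |g| against the indicator of [A]; at p = +oo the conjugate exponent is 1
    and the essential bound is integrated directly. *)
Lemma density_le (p : \bar R) (g : T -> R) (A : set T) (l : R) :
  0 < m setT -> 1 < p -> g \in Lfun m p -> measurable A -> m A = l%:E ->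
  \int[m]_(x in A) (g x)%:E <=
  (fine 'N[m]_p[EFin \o g] * l `^ (fine (hoelder_conjugate p))^-1)%:E.
Proof.
move=> mT p1 gp mA mAl.
have mg : measurable_fun setT g.
  by have := sub_Lfun_mfun gp; rewrite inE.
have gfin : 'N[m]_p[EFin \o g] < +oo.
  by have := sub_Lfun_finLfun gp; rewrite inE.
have g0 : 0 <= 'N[m]_p[EFin \o g] by exact: Lnorm_ge0.
have l0 : (0 <= l)%R by rewrite -lee_fin -mAl.
rewrite EFinM fineK ?ge0_fin_numE//.
have mEg : measurable_fun A (EFin \o g) by apply/measurable_EFinP; exact: measurable_funTS.
apply: le_trans (lee_abs _) _; apply: (le_trans (le_abse_integral m mA mEg)).
case: p p1 gp gfin g0 => [r| |] p1 gp gfin g0 //; last first.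
  (* Positive total mass selects the branch of the norm that is an essential supremum. *)
  rewrite /hoelder_conjugate eqxx/= invr1 powRr1// -mAl.
  apply: (@integral_le_bound _ _ _ m A (EFin \o g)) => //; rewrite unlock mT.
  by apply: filterS (ess_sup_ge m (abse \o (EFin \o g))) => x + _.
rewrite lte_fin in p1; have r0 : (0 < r)%R by rewrite (lt_trans ltr01).
set q := fine _; have q0 : (0 < q)%R by exact: hoelder_conjugate_fin.
have rq : (r^-1 + q^-1 = 1)%R.
  rewrite /q /hoelder_conjugate/= eqe gt_eqF// inver subr_eq0 gt_eqF//=.
  by rewrite invf_div; field; rewrite gt_eqF.
have := hoelder m mg (measurable_indic mA) r0 q0 rq.
rewrite Lnorm1 [X in X <= _](_ : _ = \int[m]_(x in A) `|(EFin \o g) x|); last first.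
  rewrite [RHS]integral_mkcond; apply: eq_integral => x _.
  rewrite /patch /= indicE; case: ifPn => _; first by rewrite mulr1.
  by rewrite mulr0 normr0.
move=> /le_trans; apply; rewrite lee_wpmul2l//.
rewrite unlock (_ : \int[m]_x _ = l%:E) ?lee_fin//.
rewrite -mAl -[in RHS](setIT A) -integral_indic//; apply: eq_integral => x _.
rewrite /= indicE; case: (_ \in _); rewrite ?normr1 ?normr0 ?powR1//.
by rewrite powR0// gt_eqF.
Qed.

End density.

Section l2_norm.
Context {R : rcfType} {I : finType}.
Implicit Types f g : I -> R.

Definition l2 f : R := Num.sqrt (\sum_i f i ^+ 2).

Lemma l2_le_sum f : l2 f <= \sum_i `|f i|.
Proof.
have [s0 sle] : 0 <= \sum_i `|f i| /\ \sum_i f i ^+ 2 <= (\sum_i `|f i|) ^+ 2.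
  apply: (big_ind2 (fun x y => 0 <= y /\ x <= y ^+ 2)).
  - by rewrite expr0n.
  - move=> x1 y1 x2 y2 [y10 h1] [y20 h2]; split; first exact: addr_ge0.
    by have := mulr_ge0 y10 y20; nra.
  - by move=> i _; rewrite real_normK ?num_real.
by rewrite -[leRHS]ger0_norm// -sqrtr_sqr ler_sqrt ?sqr_ge0.
Qed.

Lemma ler_l2D f g : l2 (fun i => f i + g i) <= l2 f + l2 g.
Proof.
have f0 : 0 <= \sum_i f i ^+ 2 by apply: sumr_ge0 => i _; exact: sqr_ge0.
have g0 : 0 <= \sum_i g i ^+ 2 by apply: sumr_ge0 => i _; exact: sqr_ge0.
have fg0 : 0 <= l2 f + l2 g by rewrite addr_ge0// sqrtr_ge0.
rewrite -[leRHS]ger0_norm// -sqrtr_sqr ler_sqrt ?sqr_ge0//.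
rewrite sqrrD !sqr_sqrtr// -sqrtrM//.
have : \sum_i f i * g i <= Num.sqrt ((\sum_i f i ^+ 2) * (\sum_i g i ^+ 2)).
  rewrite (le_trans (ler_norm _))// -sqrtr_sqr ler_sqrt ?mulr_ge0//.
  exact: sqr_dot_le.
have -> : \sum_i (f i + g i) ^+ 2 =
    \sum_i f i ^+ 2 + 2 * (\sum_i f i * g i) + \sum_i g i ^+ 2.
  by rewrite mulr_sumr -!big_split/=; apply: eq_bigr => i _; ring.
by move=> h; rewrite lerD2r lerD2l mulr_natl ler_pMn2r.
Qed.

End l2_norm.

(** * Geometry of the spike set *)

Section cubes.
Context {R : realType} {d : nat}.
Implicit Types (x z c : d.-tuple R) (r : R).

(** Balls of the maximum norm are boxes, so [leb_box] gives their volume and their measurability is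
    coordinatewise. *)
Definition cube c r : set (d.-tuple R) :=
  [set x | forall i, `|tnth x i - tnth c i| <= r].

Lemma measurable_forall_ord d0 (T : measurableType d0) n (F : 'I_n -> set T) :
  (forall i, measurable (F i)) -> measurable [set x | forall i, F i x].
Proof.
move=> mF; rewrite (_ : [set _ | _] = \bigcap_(i in [set: 'I_n]) F i).
  by apply: fin_bigcap_measurable.
by apply/seteqP; split => x xF i => [_|]; exact: xF.
Qed.

Lemma cubeE c r : cube c r = [set x | forall i,
  [set` `[tnth c i - r, tnth c i + r]] (tnth x i)].
Proof.
apply/seteqP; split => x xc i; have := xc i; rewrite /= in_itv/=.
  by rewrite ler_distl.
by rewrite -ler_distl.
Qed.

Lemma measurable_cube c r : measurable (cube c r).
Proof.
rewrite cubeE; apply: (measurable_forall_ord (F := fun i => [set x |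
  [set` `[tnth c i - r, tnth c i + r]] (tnth x i)])) => i.
have := @measurable_tnth _ R d i measurableT _
  (measurable_itv `[tnth c i - r, tnth c i + r]).
by rewrite setTI.
Qed.

Lemma leb_cube c r : 0 < r -> leb d (cube c r) = ((2 * r) ^+ d)%:E.
Proof.
move=> r0; rewrite cubeE (leb_box (A := fun i => [set` `[tnth c i - r, tnth c i + r]]))//.
transitivity (\prod_(i < d) (2 * r)%:E)%E.
  apply: eq_bigr => i _; rewrite lebesgue_measure_itv/= lte_fin ltrBlDr -addrA ltrDl.
  rewrite addr_gt0//.
  by rewrite -EFinB; congr EFin; ring.
by rewrite prodEFin prodr_const card_ord.
Qed.

Lemma finite_int_tuples (N : nat) :
  finite_set [set a : d.-tuple int | forall i, `|tnth a i| <= N%:Z].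
Proof.
pose f (u : {ffun 'I_d -> 'I_(N + N).+1}) : d.-tuple int :=
  [tuple (u i)%:Z - N%:Z | i < d].
apply: (@sub_finite_set _ _ (f @` setT)); last exact/finite_image/finite_finset.
move=> a aN; exists [ffun i => inord (absz (tnth a i + N%:Z))] => //.
apply: eq_from_tnth => i; rewrite tnth_mktuple ffunE.
have := aN i; rewrite ler_norml => /andP[l1 l2].
have aN0 : 0 <= tnth a i + N%:Z by rewrite -lerBlDr sub0r.
rewrite inordK; first by rewrite gez0_abs// addrK.
by rewrite ltnS -lez_nat gez0_abs// PoszD lerD2r.
Qed.

Lemma finite_lattice (X : set (d.-tuple R)) (tau : d.-tuple R) :
  ebounded X -> (forall i, 0 < tnth tau i) ->
  finite_set [set a : d.-tuple int |
    exists x z, [/\ X x, X z & esub x z = lattice_pt tau a]].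
Proof.
move=> [M XM] tau0.
pose b i := Num.bound (2 * `|M| / tnth tau i).
(* The sum of the coordinate bounds serves as one bound for all coordinates. *)
apply: sub_finite_set (finite_int_tuples (\sum_i b i)).
move=> a [x [z [Xx Xz xz]]] i.
have coord y : X y -> `|tnth y i| <= `|M|.
  move=> /XM yM; rewrite (le_trans _ (ler_norm M))// (le_trans _ yM)//.
  rewrite -sqrtr_sqr ler_sqrt; last by apply: sumr_ge0 => j _; rewrite sqr_ge0.
  by rewrite (bigD1 i)//= lerDl sumr_ge0// => j _; rewrite sqr_ge0.
have : tnth x i - tnth z i = tnth tau i * (tnth a i)%:~R.
  by move/(congr1 (fun t => tnth t i)): xz; rewrite !tnth_mktuple.
move=> xzi.
have : `|tnth tau i * (tnth a i)%:~R| <= 2 * `|M|.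
  rewrite -xzi (le_trans (ler_normB _ _))//.
  by have := coord _ Xx; have := coord _ Xz; lra.
rewrite normrM gtr0_norm// mulrC -ler_pdivlMr// => aM.
have : 0 <= 2 * `|M| / tnth tau i by rewrite divr_ge0 ?mulr_ge0// ltW.
move=> /archi_boundP /(le_lt_trans aM); rewrite -/(b i) -intr_norm.
rewrite -[X in _ < X]/(((b i)%:Z)%:~R) ltr_int => /ltW /le_trans; apply.
by rewrite lez_nat (bigD1 i)//= leq_addr.
Qed.

End cubes.

Section spike_geometry.
Context {R : realType} {d : nat}.
Variables (X : set (d.-tuple R)) (k : d.-tuple R -> d.-tuple R -> R).
Variable tau : d.-tuple R.
Hypothesis X_bounded : ebounded X.
Hypothesis tau_gt0 : forall i, 0 < tnth tau i.
Hypothesis k_eq1 : forall x z, X x -> X z ->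
  (k x z = 1 <-> exists a : d.-tuple int, esub x z = lattice_pt tau a).

Let lattice := [set a : d.-tuple int |
  exists x z, [/\ X x, X z & esub x z = lattice_pt tau a]].

Let shift (z : d.-tuple R) a : d.-tuple R :=
  [tuple tnth z i + tnth (lattice_pt tau a) i | i < d].

(** A measurable superset of the points [x] for which [(x, z)] is within [r] of a spike: cubes
    around the finitely many lattice translates of [z]. *)
Definition near_spike (r : R) (z : d.-tuple R) : set (d.-tuple R) :=
  \big[setU/set0]_(a <- fset_set lattice) cube (shift z a) (4 * r).

Lemma lattice_count_gt0 : X !=set0 -> (0 < lattice_count X tau)%N.
Proof.
move=> [x Xx]; rewrite cardfs_gt0; apply/fset0Pn; exists [tuple 0 | i < d].
rewrite in_fset_set; last exact: finite_lattice.
rewrite inE; exists x, x; split => //; apply: eq_from_tnth => i.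
by rewrite !tnth_mktuple subrr mulr0.
Qed.

Lemma le_coord_edist2 (p q : d.-tuple R * d.-tuple R) i :
  `|tnth p.1 i - tnth q.1 i| <= edist2 p q /\
  `|tnth p.2 i - tnth q.2 i| <= edist2 p q.
Proof.
have le_enorm (x y : d.-tuple R) : `|tnth x i - tnth y i| <= enorm (esub x y).
  rewrite -sqrtr_sqr ler_sqrt; last by apply: sumr_ge0 => j _; rewrite sqr_ge0.
  rewrite (bigD1 i)//= tnth_mktuple lerDl.
  by apply: sumr_ge0 => j _; rewrite sqr_ge0.
split; apply: (le_trans (le_enorm _ _)).
  rewrite -[leLHS]ger0_norm ?sqrtr_ge0// -sqrtr_sqr ler_sqrt ?addr_ge0 ?sqr_ge0//.
  by rewrite lerDl sqr_ge0.
rewrite -[leLHS]ger0_norm ?sqrtr_ge0// -sqrtr_sqr ler_sqrt ?addr_ge0 ?sqr_ge0//.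
by rewrite lerDr sqr_ge0.
Qed.

(** The infimum need not be attained, so a spike (x', z') is chosen at distance below 2 r. As x' -
    z' is a lattice point, x - z differs from it by at most 2 r + 2 r in each coordinate; hence the
    half-side 4 r of the cubes. *)
Lemma dist_spike_near (r : R) x z : 0 < r ->
  (dist_spike X k (x, z) <= r%:E)%E -> near_spike r z x.
Proof.
move=> r0 xzr.
have : (dist_spike X k (x, z) < (2 * r)%:E)%E.
  by rewrite (le_lt_trans xzr)// lte_fin; lra.
move=> /ereal_inf_lt[_ [[x' z'] [/= Xx' Xz' /(k_eq1 Xx' Xz')[a xza]] <-]].
rewrite lte_fin => /ltW xz2r.
have aL : a \in fset_set lattice.
  rewrite in_fset_set; last exact: finite_lattice.
  by rewrite inE; exists x', z'.
rewrite /near_spike -bigcup_seq; exists a => //= i.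
have [/le_trans/(_ xz2r)/= h1 /le_trans/(_ xz2r)/= h2] :=
  le_coord_edist2 (x, z) (x', z') i.
rewrite tnth_mktuple -xza tnth_mktuple; move: h1 h2.
rewrite !ler_norml => /andP[? ?] /andP[? ?]; apply/andP; split; lra.
Qed.

Lemma measurable_near_spike (r : R) :
  measurable [set p : d.-tuple R * d.-tuple R | near_spike r p.2 p.1].
Proof.
rewrite (_ : [set _ | _] = \big[setU/set0]_(a <- fset_set lattice)
   [set p | forall i, `|tnth p.1 i - (tnth p.2 i + tnth (lattice_pt tau a) i)| <= 4 * r]).
  apply: bigsetU_measurable => a _.
  apply: (measurable_forall_ord (F := fun i => [set p |
    `|tnth p.1 i - (tnth p.2 i + tnth (lattice_pt tau a) i)| <= 4 * r])) => i.
  apply: measurable_le_set => //; apply: measurableT_comp => //.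
  apply: measurable_funB.
    by apply: (measurableT_comp (measurable_tnth i)); exact: measurable_fst.
  apply: measurable_funD => //.
  by apply: (measurableT_comp (measurable_tnth i)); exact: measurable_snd.
apply/seteqP; split => [[x z]|[x z]]; rewrite /= /near_spike -!bigcup_seq /=.
  by move=> [a aL xa]; exists a => // i; have := xa i; rewrite !tnth_mktuple.
by move=> [a aL xa]; exists a => // i; have := xa i; rewrite !tnth_mktuple.
Qed.

Lemma measurable_near_spike1 (r : R) z : measurable (near_spike r z).
Proof. by apply: bigsetU_measurable => a _; exact: measurable_cube. Qed.

Lemma near_spike_le (mu : {measure set (d.-tuple R) -> \bar R}) (r c : R) z :
  (forall y, (mu (cube y (4 * r)) <= c%:E)%E) ->
  (mu (near_spike r z) <= ((lattice_count X tau)%:R * c)%:E)%E.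
Proof.
move=> muc.
have muS (s : seq (d.-tuple int)) :
    (mu (\big[setU/set0]_(a <- s) cube (shift z a) (4 * r)) <=
    ((size s)%:R * c)%:E)%E.
  elim: s => [|a s ih]; first by rewrite big_nil measure0 mul0r.
  rewrite big_cons (le_trans (measureU2 _ _ _))//.
  - exact: measurable_cube.
  - by apply: bigsetU_measurable => b _; exact: measurable_cube.
  have -> : ((size (a :: s))%:R * c)%:E = (c%:E + ((size s)%:R * c)%:E)%E.
    by rewrite -EFinD /= -nat1r mulrDl mul1r.
  by apply: leeD => //; exact: muc.
by rewrite (le_trans (muS _))// lee_fin cardfE.
Qed.

End spike_geometry.

Section measurable_distance.
Context {R : realType} {d : nat}.
Let T := (d.-tuple R * d.-tuple R)%type.

(** Flattening a pair to its 2d coordinates turns [edist2] into [l2], whose triangle inequality is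
    available. *)
Let coord (p : T) (s : 'I_d + 'I_d) : R :=
  match s with inl i => tnth p.1 i | inr i => tnth p.2 i end.

Let edist2E (p q : T) : edist2 p q = l2 (fun s => coord p s - coord q s).
Proof.
rewrite /edist2 /l2 big_sumType/= /enorm !sqr_sqrtr; last 2 first.
- by apply: sumr_ge0 => i _; exact: sqr_ge0.
- by apply: sumr_ge0 => i _; exact: sqr_ge0.
by congr (Num.sqrt (_ + _)); apply: eq_bigr => i _; rewrite tnth_mktuple.
Qed.

Let edist2_triangle (p q r : T) : edist2 p r <= edist2 p q + edist2 q r.
Proof.
rewrite !edist2E (le_trans _ (ler_l2D _ _))//.
by under [X in l2 X]eq_fun => s do rewrite -(subrK (coord q s) (coord p s)) -addrA.
Qed.

Let measurable_edist2 (q : T) (c : R) : measurable [set p | edist2 p q < c].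
Proof.
have [c0|c0] := leP c 0.
  rewrite (_ : [set _ | _] = set0)//; apply/seteqP; split => // p /=.
  by rewrite ltNge (le_trans c0)// sqrtr_ge0.
rewrite (_ : [set _ | _] = [set p | \sum_s (coord p s - coord q s) ^+ 2 < c ^+ 2]).
  apply: measurable_lt_set => //; apply: measurable_sum => s.
  apply: measurable_funX; apply: measurable_funB => //.
  case: s => i /=.
    by apply: (measurableT_comp (measurable_tnth i)); exact: measurable_fst.
  by apply: (measurableT_comp (measurable_tnth i)); exact: measurable_snd.
have distE p : (edist2 p q < c) = (\sum_s (coord p s - coord q s) ^+ 2 < c ^+ 2).
  by rewrite edist2E /l2 -[X in _ < X]gtr0_norm// -sqrtr_sqr ltr_sqrt ?exprn_gt0.
by apply/seteqP; split => p /=; rewrite distE.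
Qed.

(* Every point of [Q] may be replaced by one of countably many, selected in the
   rational cubes that meet [Q]. *)
Lemma measurable_dist_lt (Q : set T) (c : R) :
  measurable [set p | exists2 q, Q q & edist2 p q < c].
Proof.
pose I := ({ffun 'I_d + 'I_d -> rat} * nat)%type.
pose near (i : I) := [set q : T | Q q /\
  forall s, `|coord q s - ratr (i.1 s)| < i.2.+1%:R^-1].
pose F i := if pselect (near i !=set0) is left e
  then [set p | edist2 p (projT1 (cid e)) < c] else set0.
rewrite (_ : [set _ | _] = \bigcup_i F i).
  apply: countable_bigcupT_measurable; first exact: countableP.
  by move=> i; rewrite /F; case: pselect.
apply/seteqP; split => p /=; last first.
  move=> [i _]; rewrite /F; case: pselect => // e /=.
  by case: cid => /= q [Qq _] pq; exists q.
move=> [q Qq pq].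
(* Each of the 2d coordinates costs at most 2 e; dividing by 2d + 1 keeps the total strictly below
   the gap c - edist2 p q, also for d = 0. *)
pose e := (c - edist2 p q) / (2 * (#|{: 'I_d + 'I_d}|.+1)%:R).
have e0 : 0 < e by rewrite divr_gt0 ?subr_gt0.
have [l le] : exists l, l.+1%:R^-1 < e.
  exists (Num.bound e^-1); rewrite invf_plt ?posrE//.
  by rewrite (lt_trans (archi_boundP _)) ?invr_ge0 ?ltW// ltr_nat.
have li0 : 0 < l.+1%:R^-1 :> R by rewrite invr_gt0.
have ex_rat s : exists r : rat, `|coord q s - ratr r| < l.+1%:R^-1.
  have : coord q s - l.+1%:R^-1 < coord q s + l.+1%:R^-1.
    by rewrite ltrBlDr -addrA ltrDl addr_gt0.
  move=> /rat_in_itvoo[r]; rewrite in_itv/= => /andP[r1 r2]; exists r.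
  move: r1 r2; move: (l.+1%:R^-1) => h r1 r2.
  by rewrite ltr_norml; apply/andP; split; lra.
pose rr : {ffun 'I_d + 'I_d -> rat} := [ffun s => projT1 (cid (ex_rat s))].
have rrP s : `|coord q s - ratr (rr s)| < l.+1%:R^-1.
  by rewrite ffunE; case: cid.
exists (rr, l) => //; rewrite /F; case: pselect => [en|]; last first.
  by case; exists q; split.
case: cid => q' [Qq' q'rr] /=; rewrite (le_lt_trans (edist2_triangle p q q'))//.
rewrite -ltrBrDl edist2E (le_lt_trans (l2_le_sum _))//.
apply: (@le_lt_trans _ _ (\sum_(s : 'I_d + 'I_d) 2 * e)).
  apply: ler_sum => s _.
  have := q'rr s; have := rrP s; move: le; rewrite /=.
  move: (l.+1%:R^-1) => h he; rewrite !ltr_norml ler_norml.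
  move=> /andP[? ?] /andP[? ?]; apply/andP; split; lra.
rewrite sumr_const -[_ *+ _]mulr_natl /e.
set g := c - _; set N := #|_|; set M := N.+1.
have g0 : 0 < g by rewrite subr_gt0.
rewrite (_ : N%:R * _ = g * (N%:R / M%:R)); last by field; rewrite pnatr_eq0.
by rewrite gtr_pMr// ltr_pdivrMr ?ltr0n// mul1r ltr_nat.
Qed.

End measurable_distance.

(** * Features, RKHS and the patched kernel *)

Section fidelity_features.
Context {R : realType} {d : nat}.

(** This is Tr[rho(u) rho(v)] in real form: the two brackets in each product are the real and
    imaginary parts of the entries of the rank-one matrices of [u] and [v]. *)
Lemma hermitian_dot_normc n (u v : 'cV[R[i]]_n) :
  ComplexField.Normc.normc (hermitian_dot u v) ^+ 2 =
  \sum_a \sum_b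
    ((complex.Re (u a 0) * complex.Re (u b 0) + complex.Im (u a 0) * complex.Im (u b 0)) *
     (complex.Re (v a 0) * complex.Re (v b 0) + complex.Im (v a 0) * complex.Im (v b 0)) +
     (complex.Re (u a 0) * complex.Im (u b 0) - complex.Im (u a 0) * complex.Re (u b 0)) *
     (complex.Re (v a 0) * complex.Im (v b 0) - complex.Im (v a 0) * complex.Re (v b 0))).
Proof.
have ReE : complex.Re (hermitian_dot u v) = \sum_a
    (complex.Re (u a 0) * complex.Re (v a 0) + complex.Im (u a 0) * complex.Im (v a 0)).
  rewrite /hermitian_dot (big_morph (@complex.Re R) (id1 := 0) (op1 := +%R)) //=;
    last by case=> ? ? [? ?].
  by apply: eq_bigr => a _; case: (u a 0) => x y; case: (v a 0) => x' y' /=; ring.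
have ImE : complex.Im (hermitian_dot u v) = \sum_a
    (complex.Re (u a 0) * complex.Im (v a 0) - complex.Im (u a 0) * complex.Re (v a 0)).
  rewrite /hermitian_dot (big_morph (@complex.Im R) (id1 := 0) (op1 := +%R)) //=;
    last by case=> ? ? [? ?].
  by apply: eq_bigr => a _; case: (u a 0) => x y; case: (v a 0) => x' y' /=; ring.
have -> (h : R[i]) : ComplexField.Normc.normc h ^+ 2 =
    complex.Re h ^+ 2 + complex.Im h ^+ 2.
  by case: h => a b /=; rewrite sqr_sqrtr// addr_ge0 ?sqr_ge0.
rewrite ReE ImE !expr2 !mulr_suml -big_split/=; apply: eq_bigr => a _.
by rewrite !mulr_sumr -big_split/=; apply: eq_bigr => b _; ring.
Qed.

(** The features are the real and imaginary parts of the entries of the density matrix, 2 * 4^m in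
    number; the boolean index tells them apart. *)
Lemma fidelity_features X m (k : d.-tuple R -> d.-tuple R -> R) :
  quantum_fidelity_kernel X m k ->
  exists N (phi : d.-tuple R -> 'rV[R]_N),
    forall x z, X x -> X z -> k x z = (phi x *m (phi z)^T) 0 0.
Proof.
move=> [U [_ kE]].
pose n := (2 ^ m)%N; pose s x := quantum_state U x.
pose f x (c : bool * ('I_n * 'I_n)) : R :=
  let a := s x c.2.1 0 in let b := s x c.2.2 0 in
  if c.1 then complex.Re a * complex.Re b + complex.Im a * complex.Im b
  else complex.Re a * complex.Im b - complex.Im a * complex.Re b.
exists #|{: bool * ('I_n * 'I_n)}|, (fun x => \row_j f x (enum_val j)) => x z Xx Xz.
rewrite kE// hermitian_dot_normc mxE.
under [RHS]eq_bigr do rewrite !mxE.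
transitivity (\sum_c f x c * f z c); last first.
  rewrite [LHS](reindex (@enum_val _ {: bool * ('I_n * 'I_n)}))//=.
  by apply: onW_bij; exact: enum_val_bij.
rewrite -(pair_bigA _ (fun b c => f x (b, c) * f z (b, c)))/= big_bool/=.
rewrite -(pair_bigA _ (fun a b => f x (true, (a, b)) * f z (true, (a, b))))/=.
rewrite -(pair_bigA _ (fun a b => f x (false, (a, b)) * f z (false, (a, b))))/=.
rewrite -big_split/=; apply: eq_bigr => a _.
by rewrite -big_split/=.
Qed.

End fidelity_features.

Section second_moments.
Context {R : realType} {d1 : measure_display} {T : measurableType d1}.
Variable mu : probability T R.

Definition second_moment s (psi : 'I_s -> T -> R) : 'M[R]_s :=
  \matrix_(a, b) \int[mu]_x (psi a x * psi b x).

Variables (s : nat) (psi : 'I_s -> T -> R).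
Hypothesis psi_meas : forall a, measurable_fun setT (psi a).
Hypothesis psi_le1 : forall a x, `|psi a x| <= 1.

Lemma integrable_bounded (f : T -> R) : measurable_fun setT f ->
  (exists M, forall x, `|f x| <= M) -> mu.-integrable setT (EFin \o f).
Proof.
move=> mf [M fM]; apply: measurable_bounded_integrable => //.
  by apply: le_lt_trans (probability_le1 mu measurableT) _; rewrite ltry.
exists M; split; first exact: num_real.
by move=> y My x _ /=; rewrite (le_trans (fM x))// ltW.
Qed.

Lemma Rintegral_sum_bounded n (f : 'I_n -> T -> R) :
  (forall a, mu.-integrable setT (EFin \o f a)) ->
  \int[mu]_x (\sum_a f a x) = \sum_a \int[mu]_x f a x.
Proof.
move=> fi; rewrite /Rintegral.
under eq_integral do rewrite -sumEFin.
rewrite integral_sum//; apply/esym/sum_fine => a _.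
exact: (integrable_fin_num measurableT (fi a)).
Qed.

Lemma second_moment_mul (v : 'rV[R]_s) b :
  (v *m second_moment psi) 0 b = \int[mu]_x ((\sum_a v 0 a * psi a x) * psi b x).
Proof.
have ipsi a : mu.-integrable setT (EFin \o (fun x => v 0 a * (psi a x * psi b x))).
  apply: integrable_bounded; first by
      apply: measurable_funM => //; exact: measurable_funM.
  exists `|v 0 a| => x; rewrite normrM ler_piMr// normrM -[leRHS]mulr1.
  by rewrite ler_pM.
have ipsi' a : mu.-integrable setT (EFin \o (fun x => (psi a x * psi b x))).
  apply: integrable_bounded; first exact: measurable_funM.
  by exists 1 => x; rewrite normrM -[leRHS]mulr1 ler_pM.
under eq_Rintegral => x _.
  rewrite mulr_suml; under eq_bigr do rewrite -mulrA.
  over.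
rewrite Rintegral_sum_bounded// mxE; apply: eq_bigr => a _; rewrite mxE.
by rewrite RintegralZl.
Qed.

(** v S v^T is the integral of the square of the combination with coefficients [v], so kernel
    vectors are exactly the linear relations that hold almost everywhere. *)
Lemma second_moment_ker (v : 'rV[R]_s) : v *m second_moment psi = 0 <->
  {ae mu, forall x, \sum_a v 0 a * psi a x = 0}.
Proof.
set f := fun x => \sum_a v 0 a * psi a x.
have mf : measurable_fun setT f by apply: measurable_sum => a; exact: measurable_funM.
split=> [v0|f0].
  have : (v *m second_moment psi *m v^T) 0 0 = 0 by rewrite v0 mul0mx mxE.
  have fM x : `|f x| <= \sum_a `|v 0 a|.
    rewrite (le_trans (ler_norm_sum _ _ _))// ler_sum// => a _.
    by rewrite normrM ler_piMr.
  have ifp b : mu.-integrable setT (EFin \o (fun x => v 0 b * (f x * psi b x))).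
    apply: integrable_bounded; first by
      apply: measurable_funM => //; exact: measurable_funM.
    exists (`|v 0 b| * (\sum_a `|v 0 a|)) => x; rewrite normrM ler_wpM2l// normrM.
    by rewrite -[leRHS]mulr1 ler_pM.
  have ifp' b : mu.-integrable setT (EFin \o (fun x => f x * psi b x)).
    apply: integrable_bounded; first exact: measurable_funM.
    by exists (\sum_a `|v 0 a|) => x; rewrite normrM -[leRHS]mulr1 ler_pM.
  have -> : (v *m second_moment psi *m v^T) 0 0 = \int[mu]_x (f x ^+ 2).
    rewrite mxE; under eq_bigr do rewrite second_moment_mul mxE mulrC.
    under [in RHS]eq_Rintegral => x _.
      rewrite expr2 {2}/f mulr_sumr; under eq_bigr do rewrite mulrCA.
      over.
    rewrite Rintegral_sum_bounded//; apply: eq_bigr => b _.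
    by rewrite RintegralZl.
  have mf2 : measurable_fun setT (EFin \o (fun x => f x ^+ 2)).
    by apply/measurable_EFinP; exact: measurable_funX.
  have if2 : mu.-integrable setT (EFin \o (fun x => f x ^+ 2)).
    apply: integrable_bounded; first exact: measurable_funX.
    exists ((\sum_a `|v 0 a|) ^+ 2) => x.
    by rewrite normrX lerXn2r// nnegrE sumr_ge0.
  rewrite /Rintegral => f20.
  have {f20} : (\int[mu]_x `|(f x ^+ 2)%:E| = 0)%E.
    under eq_integral do rewrite gee0_abs ?lee_fin ?sqr_ge0//.
    by rewrite -[LHS]fineK ?f20//; exact: integrable_fin_num.
  move=> /(ae_eq_integral_abs mu measurableT mf2); apply: filterS => x /(_ I) [].
  by move=> /eqP; rewrite sqrf_eq0 => /eqP.
apply/rowP => b; rewrite second_moment_mul mxE /Rintegral.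
rewrite (ae_eq_integral (cst 0%E)) ?integral0//.
- by apply/measurable_EFinP; exact: measurable_funM.
- by apply: filterS f0 => x fx0 _; rewrite fx0 mul0r.
Qed.

End second_moments.

Section rkhs_interpolation.
Context {R : realType} {T : Type}.
Variables (k : T -> T -> R) (H : set (T -> R)) (ip : (T -> R) -> (T -> R) -> R).
Hypothesis rkhsH : is_rkhs k H ip.

Lemma rkhs_sum n (w : 'I_n -> R) (h : 'I_n -> T -> R) f :
  (forall b, H (h b)) -> H f ->
  H (\sum_b w b *: h b) /\ ip (\sum_b w b *: h b) f = \sum_b w b * ip (h b) f.
Proof.
move=> Hh Hf.
have H0 : H 0 by exact: rkhs0 rkhsH.
have ip0 : ip 0 f = 0.
  have := rkhs_ip_lin rkhsH 1 H0 H0 Hf; rewrite scale1r addr0 mul1r.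
  by move=> /eqP; rewrite -subr_eq0 opprD addrA subrr sub0r oppr_eq0 => /eqP.
elim: (index_enum _) => [|b s [ih1 ih2]]; first by rewrite !big_nil.
rewrite !big_cons; split; first exact: rkhs_lin rkhsH _ _ _ (Hh b) ih1.
by rewrite (rkhs_ip_lin rkhsH _ (Hh b) ih1 Hf) ih2.
Qed.

(** Pairing an identity between kernel sections with [f] transfers it to the values of [f], by the
    reproducing property. *)
Lemma rkhs_interpolation n (Z : 'I_n -> T) (w : 'I_n -> R) x f : H f ->
  (forall z, k x z = \sum_b w b * k (Z b) z) -> f x = \sum_b w b * f (Z b).
Proof.
move=> Hf kxE.
have -> : f x = ip (k x) f.
  rewrite (rkhs_ipC rkhsH)//; last exact: rkhs_kernel rkhsH _.
  by rewrite (rkhs_reproducing rkhsH).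
have -> : k x = \sum_b w b *: k (Z b).
  by apply/funext => z; rewrite kxE fct_sumE.
rewrite (rkhs_sum _ _ Hf).2; last by move=> b; exact: rkhs_kernel rkhsH _.
apply: eq_bigr => b _; congr (_ * _).
rewrite (rkhs_ipC rkhsH)//; last exact: rkhs_kernel rkhsH _.
by rewrite (rkhs_reproducing rkhsH).
Qed.

Lemma rkhs_norm_eq0 f : H f -> rkhs_norm ip f = 0 -> f = cst 0.
Proof.
move=> Hf /eqP; rewrite sqrtr_eq0 => f0; apply: (rkhs_ip_eq0 rkhsH) => //.
by apply/le_anti; rewrite f0 (rkhs_ip_ge0 rkhsH).
Qed.

End rkhs_interpolation.

Section patched_kernel.
Context {R : realType} {d1 : measure_display} {T : measurableType d1}.
Variables (X : set T) (k : T -> T -> R).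

(** Extension by zero: the hypotheses constrain [k] only on X * X, whereas the integrals and the
    compositions with random variables below use functions measurable on the whole space. *)
Definition patched_kernel x z : R :=
  if (x \in X) && (z \in X) then k x z else 0.
Local Notation kt := patched_kernel.

Lemma patched_kernelE x z : X x -> X z -> kt x z = k x z.
Proof. by move=> Xx Xz; rewrite /kt !mem_set. Qed.

Hypothesis X_meas : measurable X.
Hypothesis k_meas : forall z, X z -> measurable_fun X (fun x => k x z).

Lemma measurable_patched_kernel1 z : measurable_fun setT (kt ^~ z).
Proof.
have [zX|zX] := boolP (z \in X); last first.
  rewrite (_ : kt^~ z = cst 0)//; apply/funext => x.
  by rewrite /kt (negbTE zX) andbF.
have /(measurable_restrictT _ X_meas) : measurable_fun X (fun x => k x z).
  by apply: k_meas; exact/set_mem.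
congr (measurable_fun _ _); apply/funext => x; rewrite /patch /kt zX andbT.
by [].
Qed.

Variables (N : nat) (phi : T -> 'rV[R]_N).
Hypothesis kE : forall x z, X x -> X z -> k x z = (phi x *m (phi z)^T) 0 0.
Hypothesis k_ge0 : forall x z, X x -> X z -> 0 <= k x z.
Hypothesis k_diag : forall x, X x -> k x x = 1.

Lemma feature_kernelC x z : X x -> X z -> k x z = k z x.
Proof.
move=> Xx Xz; rewrite !kE// !mxE; apply: eq_bigr => j _.
by rewrite !mxE mulrC.
Qed.

Lemma feature_kernel_le1 x z : X x -> X z -> k x z <= 1.
Proof.
move=> Xx Xz; have := sqr_dot_le (phi x 0) (phi z 0).
have dotE y t : X y -> X t -> \sum_i phi y 0 i * phi t 0 i = k y t.
  by move=> Xy Xt; rewrite kE// mxE; apply: eq_bigr => i _; rewrite mxE.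
rewrite dotE//.
under eq_bigr do rewrite expr2.
under [X in _ * X]eq_bigr do rewrite expr2.
by rewrite !dotE// !k_diag// mulr1 expr_le1// k_ge0.
Qed.

Lemma feature_kernel_psd n (xs : 'I_n -> T) (v : 'cV[R]_n) :
  (forall i, X (xs i)) ->
  0 <= (v^T *m (\matrix_(i, j) k (xs i) (xs j)) *m v) 0 0.
Proof.
move=> Xxs; pose F := \matrix_(i < n) phi (xs i).
rewrite (_ : \matrix_(i, j) _ = F *m F^T); last first.
  apply/matrixP => i j; rewrite !mxE kE// !mxE.
  by apply: eq_bigr => l _; rewrite !mxE.
rewrite mulmxA -mulmxA -[X in X *m _]trmxK trmx_mul trmxK.
exact: tr_mulmx_ge0.
Qed.

Lemma patched_kernel_itv x z : 0 <= kt x z <= 1.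
Proof.
rewrite /kt; case: ifPn => [/andP[/set_mem Xx /set_mem Xz]|_]; last by rewrite lexx ler01.
by rewrite k_ge0// feature_kernel_le1.
Qed.

Lemma patched_kernelC x z : kt x z = kt z x.
Proof.
rewrite /kt andbC; case: ifPn => // /andP[/set_mem Xx /set_mem Xz].
by rewrite feature_kernelC.
Qed.

Lemma patched_kernel_skeleton (X' : set T) : X' `<=` X ->
  exists (s : nat) (Z : 'I_s -> T),
    [/\ forall a, X' (Z a),
        (\matrix_(a, b) kt (Z a) (Z b)) \in unitmx &
        forall x z, X' x ->
          kt x z = \sum_b (\sum_a kt x (Z a) *
            invmx (\matrix_(a, b) kt (Z a) (Z b)) a b) * kt (Z b) z].
Proof.
move=> X'X; have [s [Z [ZX' uG kZ]]] := kernel_skeleton kE X'X.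
have GE : \matrix_(a, b) kt (Z a) (Z b) = \matrix_(a, b) k (Z a) (Z b).
  by apply/matrixP => a b; rewrite !mxE patched_kernelE//; exact: X'X.
exists s, Z; rewrite GE; split => // x z X'x.
have Xx := X'X _ X'x.
have [zX|zX] := boolP (z \in X); last first.
  rewrite {1}/kt (negbTE zX) andbF big1// => b _.
  by rewrite [kt (Z b) z]/kt (negbTE zX) andbF mulr0.
have Xz := set_mem zX.
rewrite patched_kernelE// kZ// exchange_big/=; apply: eq_bigr => b _.
rewrite mulr_suml; apply: eq_bigr => a _.
by rewrite !patched_kernelE//; exact: X'X.
Qed.

(** Joint measurability follows from that of the sections because the skeleton writes the kernel as
    a finite sum of products of a function of [x] and a function of [z]. *)
Lemma measurable_patched_kernel : measurable_fun setT (fun p : T * T => kt p.1 p.2).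
Proof.
have [s [Z [ZX _ kZ]]] := patched_kernel_skeleton (@subset_refl _ X).
rewrite (_ : (fun _ => _) = (fun p : T * T => \sum_b (\sum_a kt p.1 (Z a) *
            invmx (\matrix_(a, b) kt (Z a) (Z b)) a b) * kt p.2 (Z b))).
  apply: measurable_sum => b; apply: measurable_funM.
    apply: measurable_sum => a; apply: measurable_funM => //.
    by apply: (measurableT_comp (measurable_patched_kernel1 _)); exact: measurable_fst.
  by apply: (measurableT_comp (measurable_patched_kernel1 _)); exact: measurable_snd.
apply/funext => -[x z] /=; have [xX|xX] := boolP (x \in X).
  rewrite kZ//; last exact/set_mem.
  by apply: eq_bigr => b _; rewrite [kt (Z b) z]patched_kernelC.
rewrite {1}/kt (negbTE xX)/= big1// => b _; rewrite big1 ?mul0r// => a _.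
by rewrite [kt x _]/kt (negbTE xX)/= mul0r.
Qed.

Variable mu : probability T R.
Hypothesis mu_X : mu X = 1%E.

(* Kernel sections may vanish almost everywhere without being zero; restricting
   to a set [X0] of full measure makes the second moment matrix invertible. *)
Lemma regression_basis : exists (X0 : set T) (s : nat) (Z : 'I_s -> T),
  [/\ X0 `<=` X /\ measurable X0, mu (~` X0) = 0%E, forall a, X0 (Z a),
      (\matrix_(a, b) kt (Z a) (Z b)) \in unitmx /\
      (forall x z, X0 x ->
          kt x z = \sum_b (\sum_a kt x (Z a) *
            invmx (\matrix_(a, b) kt (Z a) (Z b)) a b) * kt (Z b) z) &
      second_moment mu (fun a => kt ^~ (Z a)) \in unitmx].
Proof.
have [r [Z [ZX uG kZ]]] := patched_kernel_skeleton (@subset_refl _ X).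
have kt_meas s (W : 'I_s -> T) a : measurable_fun setT (kt^~ (W a)).
  exact: measurable_patched_kernel1.
have kt_le1 s (W : 'I_s -> T) a x : `|kt x (W a)| <= 1.
  by have /andP[? ?] := patched_kernel_itv x (W a); rewrite ger0_norm.
pose S := second_moment mu (fun a => kt^~ (Z a)).
(* The rows of [K] span the relations among the sections that hold almost everywhere; [X0] collects
   the points where all of them hold exactly. *)
pose K := kermx S.
pose X0 := X `&` [set x | forall j, \sum_a K j a * kt x (Z a) = 0].
have mK j : measurable_fun setT (fun x => \sum_a K j a * kt x (Z a)).
  by apply: measurable_sum => a; apply: measurable_funM => //; exact: kt_meas.
have mX0 : measurable X0.
  apply: measurableI => //.
  apply: (measurable_forall_ord
    (F := fun j => [set x | \sum_a K j a * kt x (Z a) = 0])) => j.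
  rewrite -[X in measurable X]setTI.
  by have := mK j measurableT [set 0] (measurable_set1 _).
have muXC : mu (~` X) = 0%E by rewrite probability_setC// mu_X subee.
have muX0 : mu (~` X0) = 0%E.
  apply: measure_negligible; first exact: measurableC.
  rewrite setCI; apply: negligibleU.
    exists (~` X); split => //; first exact: measurableC.
  have : forall j, {ae mu, forall x, \sum_a K j a * kt x (Z a) = 0}.
    move=> j; have /second_moment_ker : row j K *m S = 0.
      by rewrite -row_mul mulmx_ker; apply/rowP => a; rewrite !mxE.
    move=> /(_ (kt_meas _ Z) (kt_le1 _ Z)); apply: filterS => x.
    by under eq_bigr do rewrite mxE.
  move=> aeK; rewrite (_ : ~` _ = \big[setU/set0]_(j < r)
      ~` [set x | \sum_a K j a * kt x (Z a) = 0]); last first.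
    rewrite -bigcup_seq; apply/seteqP; split=> x /=.
      by move=> /existsNP[j Kj]; exists j => //=; exact: mem_index_enum.
    by move=> [j _ Kj] /(_ j).
  elim/big_ind : _ => [|A B|j _]; [exact: negligible_set0|exact: negligibleU|exact: aeK].
have [s [W [WX0 uGW kW]]] :=
  patched_kernel_skeleton (@subIsetl _ X [set x | forall j, \sum_a K j a * kt x (Z a) = 0]).
exists X0, s, W; split => //; first by split => //; exact: subIsetl.
rewrite -row_free_unit; apply: inj_row_free => v vS0.
have /second_moment_ker := vS0.
move=> /(_ (kt_meas _ W) (kt_le1 _ W)) v0.
pose G := \matrix_(a, b) kt (Z a) (Z b).
(* The combination [v] of the new sections, expressed in the old ones. It vanishes almost
   everywhere, so [w] lies in the row span of [K]. *)
pose w : 'rV[R]_r := \row_a \sum_b invmx G a b * \sum_c v 0 c * kt (Z b) (W c).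
have wE x : X x -> \sum_c v 0 c * kt x (W c) = \sum_a w 0 a * kt x (Z a).
  move=> Xx; under eq_bigr => c _ do rewrite kZ// mulr_sumr.
  rewrite exchange_big/=; under eq_bigr => b _.
    under eq_bigr do rewrite mulrCA.
    rewrite -mulr_sumr mulr_suml.
    over.
  rewrite exchange_big/=; apply: eq_bigr => a _; rewrite mxE mulr_suml.
  by apply: eq_bigr => b _; rewrite -/G -mulrA [LHS]mulrC.
have /second_moment_ker : {ae mu, forall x, \sum_a w 0 a * kt x (Z a) = 0}.
  have aeX : {ae mu, forall x, X x}.
    by exists (~` X); split => //; exact: measurableC.
  by apply: filterS2 aeX v0 => x Xx v0x; rewrite -wE.
move=> /(_ (kt_meas _ Z) (kt_le1 _ Z)) /sub_kermxP/submxP[D wD].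
(* The new points lie in [X0], where the relations hold exactly: the almost-everywhere identity
   becomes a pointwise one, v G = 0 for the invertible Gram matrix of [W]. *)
have vW b : \sum_c v 0 c * kt (W b) (W c) = 0.
  have [XWb KWb] := WX0 b; rewrite wE// wD.
  under eq_bigr => a _ do rewrite mxE mulr_suml.
  rewrite exchange_big/= big1// => j _.
  under eq_bigr do rewrite -mulrA.
  by rewrite -mulr_sumr KWb mulr0.
apply: (can_inj (mulmxK uGW)); rewrite mul0mx; apply/rowP => b.
rewrite !mxE -[RHS](vW b); apply: eq_bigr => c _.
by rewrite mxE patched_kernelC.
Qed.

End patched_kernel.

(** * Measurability and bounds for the risk *)

Section measurable_matrix.
Context {R : realType} {d0 : measure_display} {Omega : measurableType d0}.

(** x^-1 = x (x^2)^-1, also at 0, reduces inversion to a real power of a nonnegative function. *)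
Lemma measurable_funV (f : Omega -> R) :
  measurable_fun setT f -> measurable_fun setT (fun w => (f w)^-1).
Proof.
move=> mf; rewrite (_ : (fun _ => _) = (fun w => f w * (f w ^+ 2) `^ (-1))).
  apply: measurable_funM => //.
  by apply: (measurableT_comp (measurable_powR _)); exact: measurable_funX.
apply/funext => w; rewrite powR_inv1 ?sqr_ge0// expr2 invfM mulrA.
by have [->|w0] := eqVneq (f w) 0; rewrite ?invr0 ?mul0r// divff// mul1r.
Qed.

Lemma measurable_det n (A : Omega -> 'M[R]_n) :
  (forall i j, measurable_fun setT (fun w => A w i j)) ->
  measurable_fun setT (fun w => \det (A w)).
Proof.
move=> mA; apply: measurable_sum => s; apply: measurable_funM => //.
by apply: measurable_prod => i _; exact: mA.
Qed.

Lemma measurable_invmx n (A : Omega -> 'M[R]_n) i j :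
  (forall i j, measurable_fun setT (fun w => A w i j)) ->
  (forall w, A w \in unitmx) ->
  measurable_fun setT (fun w => invmx (A w) i j).
Proof.
move=> mA uA.
rewrite (_ : (fun _ => _) = (fun w => (\det (A w))^-1 * cofactor (A w) j i)).
  apply: measurable_funM; first exact/measurable_funV/measurable_det.
  rewrite /cofactor; apply: measurable_funM => //; apply: measurable_det => a b.
  by under eq_fun do rewrite !mxE; exact: mA.
by apply/funext => w; rewrite /invmx uA !mxE.
Qed.

(** The regularized matrices are invertible for every outcome, so their inverses are measurable by
    Cramer's rule; the pseudoinverse is their limit. *)
Lemma measurable_moore_penrose n (A : Omega -> 'M[R]_n) i j :
  (forall i j, measurable_fun setT (fun w => A w i j)) ->
  measurable_fun setT (fun w => moore_penrose (A w) i j).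
Proof.
move=> mA.
apply: (@measurable_fun_cvg _ _ _ setT (fun l w =>
  (invmx ((A w)^T *m A w + (l.+1%:R^-1)%:M) *m (A w)^T) i j)); last first.
  by move=> w _; exact: cvg_moore_penrose.
move=> l; under eq_fun do rewrite mxE.
apply: measurable_sum => a; apply: measurable_funM; last first.
  by under eq_fun do rewrite mxE; exact: mA.
apply: measurable_invmx => [b c|w]; last by apply: tikhonov_unitmx; rewrite invr_gt0.
under eq_fun do rewrite !mxE; apply: measurable_funD => //.
apply: measurable_sum => e; apply: measurable_funM; last exact: mA.
by under eq_fun do rewrite mxE; exact: mA.
Qed.

End measurable_matrix.

Section measurable_risk.
Context {R : realType} {d : nat} {d0 : measure_display} {Omega : measurableType d0}.
Variables (k : d.-tuple R -> d.-tuple R -> R) (n : nat).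
Variables (xs : nat -> Omega -> d.-tuple R) (ys : nat -> Omega -> R).
Hypothesis k_meas : measurable_fun setT (fun p => k p.1 p.2).
Hypothesis xs_meas : forall i, measurable_fun setT (xs i).
Hypothesis ys_meas : forall i, measurable_fun setT (ys i).

Lemma measurable_kernel_comp d1 (T : measurableType d1) (f g : T -> d.-tuple R) :
  measurable_fun setT f -> measurable_fun setT g ->
  measurable_fun setT (fun t => k (f t) (g t)).
Proof.
move=> mf mg.
apply: (measurableT_comp (f := fun p => k p.1 p.2) (g := fun t => (f t, g t))) => //.
exact: measurable_fun_pair.
Qed.

Lemma measurable_ridgeless : measurable_fun setT (fun wx : Omega * d.-tuple R =>
  ridgeless k n (fun i => xs i wx.1) (fun i => ys i wx.1) wx.2).
Proof.
have mfst := @measurable_fst _ _ Omega (d.-tuple R).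
have msnd := @measurable_snd _ _ Omega (d.-tuple R).
rewrite /ridgeless; under eq_fun => w do rewrite mxE.
apply: measurable_sum => i; apply: measurable_funM; last first.
  by under eq_fun do rewrite mxE; exact: (measurableT_comp (ys_meas i)).
under eq_fun do rewrite mxE; apply: measurable_sum => j; apply: measurable_funM.
  under eq_fun do rewrite mxE.
  by apply: measurable_kernel_comp => //; exact: (measurableT_comp (xs_meas j)).
apply: (measurable_moore_penrose (A := fun w : Omega * d.-tuple R =>
  \matrix_(i, j) k (xs i w.1) (xs j w.1))) => a b.
under eq_fun do rewrite mxE.
by apply: measurable_kernel_comp; exact: (measurableT_comp (xs_meas _)).
Qed.

(** Tonelli's theorem, the domain of integration being moved into the integrand as an indicator. *)
Lemma measurable_integral_error (mu : probability (d.-tuple R) R)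
    (X : set (d.-tuple R)) (f : d.-tuple R -> R) :
  measurable X -> measurable_fun setT f ->
  measurable_fun setT (fun w => (\int[mu]_(x in X)
    (`| ridgeless k n (fun i => xs i w) (fun i => ys i w) x - f x | ^+ 2)%:E)%E).
Proof.
move=> mX mf.
pose F (wx : Omega * d.-tuple R) : \bar R := ((\1_X wx.2) * (`| ridgeless k n
  (fun i => xs i wx.1) (fun i => ys i wx.1) wx.2 - f wx.2 | ^+ 2))%:E.
have mF : measurable_fun setT F.
  apply/measurable_EFinP; apply: measurable_funM.
    by apply: (measurableT_comp (f := (\1_X : _ -> R)) (g := snd)) => //;
      exact: measurable_indic.
  apply: measurable_funX; apply: measurableT_comp => //.
  apply: measurable_funB; first exact: measurable_ridgeless.
  by apply: (measurableT_comp mf); exact: measurable_snd.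
have F0 wx : (0 <= F wx)%E by rewrite lee_fin mulr_ge0// exprn_ge0.
have := measurable_fun_fubini_tonelli_F (m2 := mu) F mF F0.
congr (measurable_fun _ _); apply/funext => w.
rewrite /fubini_F [RHS]integral_mkcond; apply: eq_integral => x _.
by rewrite /F /patch /= indicE; case: ifPn => _; rewrite ?mul1r ?mul0r.
Qed.

End measurable_risk.

Section risk_bound.
Context {R : realType} {d : nat}.
Let T := d.-tuple R.
Variables (mu : probability T R) (X X0 : set T) (kt : T -> T -> R).
Variables (N : nat) (phi : T -> 'rV[R]_N).
Hypothesis X_meas : measurable X.
Hypothesis kt_meas : forall z, measurable_fun setT (kt ^~ z).
Hypothesis ktC : forall x z, kt x z = kt z x.
Hypothesis kt01 : forall x z, 0 <= kt x z <= 1.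
Hypothesis X0X : X0 `<=` X.
Hypothesis ktE : forall x z, X0 x -> X0 z -> kt x z = (phi x *m (phi z)^T) 0 0.
Hypothesis kt_diag : forall x, X0 x -> kt x x = 1.
Hypothesis X0_meas : measurable X0.
Hypothesis mu_X0 : mu (~` X0) = 0%E.

Variables (s : nat) (Z : 'I_s -> T).
Let G := \matrix_(a, b) kt (Z a) (Z b).
Hypothesis G_unit : G \in unitmx.
Hypothesis kt_Z : forall x z, X0 x -> kt x z =
  \sum_b (\sum_a kt x (Z a) * invmx G a b) * kt (Z b) z.
Let S := second_moment mu (fun a => kt ^~ (Z a)).
Hypothesis S_unit : S \in unitmx.

Variables (n q : nat) (rho eta L h tau gamma cU A2 : R).
Variables (xs : nat -> T) (ys : nat -> R) (f : T -> R) (c : 'cV[R]_s).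
Variable U : nat -> set T.
Hypothesis n_gt0 : (0 < n)%N.
Hypothesis rho_gt0 : 0 < rho.
Hypothesis eta_ge0 : 0 <= eta.
Hypothesis eta_lt1 : n%:R * eta < 1.
Hypothesis f_meas : measurable_fun setT f.
Hypothesis f_Z : forall x, X0 x -> f x = \sum_a kt x (Z a) * c a 0.
Hypothesis xs_X0 : forall i, (i < n)%N -> X0 (xs i).
Hypothesis xs_eta : forall i j, (i < n)%N -> (j < n)%N -> i != j ->
  kt (xs i) (xs j) ^+ q <= eta.
Hypothesis L_ge0 : 0 <= L.
Hypothesis S_le : forall a b, `|invmx S a b| <= L.
Hypothesis h_ge0 : 0 <= h.
Hypothesis Lh_le : s%:R * s%:R * L * h <= 2^-1.
Hypothesis moment_le : forall a b,
  `|n%:R^-1 * (\sum_(i < n) kt (xs i) (Z a) * kt (xs i) (Z b)) - S a b| <= h / 2.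
Hypothesis rhoG_le : forall a b, `|n%:R^-1 * rho * G a b| <= h / 2.
Hypothesis noise_le : forall a,
  `|\sum_(i < n) kt (xs i) (Z a) * (ys i - f (xs i))| <= tau.
Hypothesis bias_le : forall a, `|(G *m c) a 0| <= gamma.
Hypothesis tau_ge0 : 0 <= tau.
Hypothesis gamma_ge0 : 0 <= gamma.
Hypothesis U_meas : forall i, measurable (U i).
Hypothesis cU_ge0 : 0 <= cU.
Hypothesis mu_U : forall i, (mu (U i) <= cU%:E)%E.
Hypothesis U_eta : forall i x, (i < n)%N -> X0 x -> ~ U i x ->
  kt x (xs i) ^+ q <= eta.
Hypothesis Y_le : \sum_(i < n) ys i ^+ 2 <= A2.

Let D := A2 / (1 - n%:R * eta) ^+ 2.
Let C := 24 * s%:R ^+ 4 * L ^+ 2 / n%:R ^+ 2 *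
  (tau ^+ 2 + rho ^+ 2 * gamma ^+ 2 + n%:R * ((n%:R * eta) ^+ 2 * D)).

Lemma A2_ge0 : 0 <= A2.
Proof. by rewrite (le_trans _ Y_le)// sumr_ge0// => i _; exact: sqr_ge0. Qed.

(** By [kt_Z] the kernel matrix is Psi G^-1 Psi^T + rho Q with [Q] near the identity. It is
    invertible, so the pseudoinverse is an inverse and [prediction_error_le] applies. *)
Lemma ridgeless_error_le x : X0 x ->
  `|ridgeless (spiked_kernel kt rho q) n xs ys x - f x| ^+ 2 <=
  C + 2 * D * \sum_(i < n) (kt x (xs i) ^+ q) ^+ 2.
Proof.
move=> X0x.
pose Psi := \matrix_(i < n, a < s) kt (xs i) (Z a).
pose Q := \matrix_(i < n, j < n) kt (xs i) (xs j) ^+ q.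
pose Y := \col_(i < n) ys i.
pose eps := \col_(i < n) (ys i - f (xs i)).
pose psi := \row_a kt x (Z a).
pose kq := \row_(i < n) kt x (xs i) ^+ q.
have PsiE y : X0 y -> forall z,
    (\row_a kt y (Z a) *m invmx G *m \col_b kt (Z b) z) 0 0 = kt y z.
  move=> X0y z; rewrite [RHS]kt_Z// mxE; apply: eq_bigr => b _.
  by rewrite !mxE; congr (_ * _); apply: eq_bigr => a _; rewrite mxE.
have KE : Psi *m invmx G *m Psi^T = \matrix_(i < n, j < n) kt (xs i) (xs j).
  apply/matrixP => i j; rewrite [RHS]mxE -[RHS]PsiE; last exact: xs_X0.
  rewrite !mxE; apply: eq_bigr => b _; rewrite !mxE [kt (xs j) _]ktC; congr (_ * _).
  by apply: eq_bigr => a _; rewrite !mxE.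
have kE : psi *m invmx G *m Psi^T = \row_(j < n) kt x (xs j).
  apply/rowP => j; rewrite [RHS]mxE -[RHS]PsiE//.
  by rewrite !mxE; apply: eq_bigr => b _; rewrite !mxE [kt (xs j) _]ktC.
have AE : \matrix_(i < n, j < n) spiked_kernel kt rho q (xs i) (xs j) =
    Psi *m invmx G *m Psi^T + rho *: Q.
  by rewrite KE; apply/matrixP => i j; rewrite !mxE.
have YE : Psi *m c + eps = Y.
  apply/colP => i; rewrite !mxE f_Z; last exact: xs_X0.
  by under eq_bigr do rewrite mxE; rewrite addrC subrK.
have Kpsd (v : 'cV[R]_n) : 0 <= (v^T *m (Psi *m invmx G *m Psi^T) *m v) 0 0.
  rewrite KE; apply: (feature_kernel_psd ktE) => i; exact: xs_X0.
have Q1 i : Q i i = 1 by rewrite mxE kt_diag ?expr1n//; exact: xs_X0.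
have Qeta i j : i != j -> `|Q i j| <= eta.
  move=> ij; rewrite mxE ger0_norm; last by 
    rewrite exprn_ge0//; case/andP: (kt01 (xs i) (xs j)).
  by apply: xs_eta => //.
have uA := near_identity_unitmx Kpsd Q1 Qeta rho_gt0 eta_ge0 eta_lt1.
pose u := invmx (Psi *m invmx G *m Psi^T + rho *: Q) *m Y.
have uE : (Psi *m invmx G *m Psi^T + rho *: Q) *m u = Psi *m c + eps.
  by rewrite /u mulKVmx// YE.
have kt_le1 y z : `|kt y z| <= 1 by have /andP[? ?] := kt01 y z; rewrite ger0_norm.
have Psi1 i a : `|Psi i a| <= 1 by rewrite mxE.
have psi1 a : `|psi 0 a| <= 1 by rewrite mxE.
have mom a b : `|n%:R^-1 * (Psi^T *m Psi) a b - S a b| <= h / 2.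
  have := moment_le a b; congr (`|_ * _ - _| <= _); rewrite mxE.
  by apply: eq_bigr => i _; rewrite !mxE.
have noi a : `|(Psi^T *m eps) a 0| <= tau.
  have := noise_le a; congr (`|_| <= _); rewrite mxE.
  by apply: eq_bigr => i _; rewrite !mxE.
have := prediction_error_le n_gt0 Psi1 G_unit Kpsd Q1 Qeta rho_gt0 eta_ge0 eta_lt1
  S_unit S_le L_ge0 mom rhoG_le Lh_le h_ge0 noi bias_le tau_ge0 gamma_ge0 uE kq psi1.
rewrite YE.
have -> : ((psi *m invmx G *m Psi^T + rho *: kq) *m u - psi *m c) 0 0 =
    ridgeless (spiked_kernel kt rho q) n xs ys x - f x.
  rewrite mxE [X in _ + X]mxE; congr (_ - _); last first.
    by rewrite f_Z// mxE; apply: eq_bigr => a _; rewrite mxE.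
  rewrite /ridgeless AE moore_penrose_unit// /u mulmxA kE.
  congr ((_ *m _ *m _) 0 0); apply/rowP => j.
  by rewrite !mxE.
rewrite real_normK ?num_real// => /le_trans; apply.
have -> : \sum_i kq 0 i ^+ 2 = \sum_(i < n) (kt x (xs i) ^+ q) ^+ 2.
  by apply: eq_bigr => i _; rewrite mxE.
have YA : sqnorm Y <= A2.
  by move: Y_le; congr (_ <= _); apply: eq_bigr => i _; rewrite mxE.
have DD : sqnorm Y / (1 - n%:R * eta) ^+ 2 <= D.
  by rewrite ler_wpM2r// invr_ge0 sqr_ge0.
apply: lerD.
  rewrite ler_wpM2l//.
    by rewrite divr_ge0 ?sqr_ge0// mulr_ge0 ?sqr_ge0// mulr_ge0// exprn_ge0.
  by rewrite lerD2l ler_wpM2l// ler_wpM2l// sqr_ge0.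
apply: ler_wpM2r; last by rewrite ler_wpM2l.
by apply: sumr_ge0 => i _; exact: sqr_ge0.
Qed.

(** The squared spike at [xs i] is at most 1 on [U i] and at most eta^2 elsewhere; integrating gives
    cU + eta^2 for each sample point. *)
Lemma ridgeless_risk_le :
  (\int[mu]_(x in X) (`|ridgeless (spiked_kernel kt rho q) n xs ys x - f x| ^+ 2)%:E
   <= (C + 2 * D * (n%:R * (cU + eta ^+ 2)))%:E)%E.
Proof.
have A20 := A2_ge0.
have D0 : 0 <= D by rewrite divr_ge0// sqr_ge0.
have C0 : 0 <= C.
  apply: mulr_ge0.
    by rewrite divr_ge0 ?sqr_ge0// mulr_ge0 ?sqr_ge0// mulr_ge0// exprn_ge0.
  by rewrite !addr_ge0 ?sqr_ge0// mulr_ge0// ?sqr_ge0// mulr_ge0 ?sqr_ge0.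
pose F x := C + 2 * D * \sum_(i < n) (\1_(U i) x + eta ^+ 2).
have mF : measurable_fun setT F.
  apply: measurable_funD => //; apply: measurable_funM => //.
  by apply: measurable_sum => i; apply: measurable_funD => //; exact: measurable_indic.
have F0 x : 0 <= F x.
  rewrite addr_ge0//; apply: mulr_ge0; first exact: mulr_ge0.
  apply: sumr_ge0 => i _.
  by rewrite addr_ge0 ?sqr_ge0.
have mE : measurable_fun setT (fun x =>
    `|ridgeless (spiked_kernel kt rho q) n xs ys x - f x| ^+ 2).
  apply: measurable_funX; apply: measurableT_comp => //; apply: measurable_funB => //.
  rewrite /ridgeless; under eq_fun do rewrite mxE.
  apply: measurable_sum => i; apply: measurable_funM => //.
  under eq_fun do rewrite mxE; apply: measurable_sum => j; apply: measurable_funM => //.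
  under eq_fun do rewrite mxE; apply: measurable_funD => //.
  by apply: measurable_funM => //; exact: measurable_funX.
apply: (@le_trans _ _ (\int[mu]_(x in X) (F x)%:E)%E).
  apply: ae_ge0_le_integral => //.
  - by apply/measurable_EFinP; exact: measurable_funTS.
  - by move=> x _; rewrite lee_fin.
  - by apply/measurable_EFinP; exact: measurable_funTS.
  - have : {ae mu, forall x, X0 x}.
      by exists (~` X0); split => //; exact: measurableC.
    apply: filterS => x X0x _; rewrite lee_fin (le_trans (ridgeless_error_le X0x))//.
    rewrite /F lerD2l; apply: ler_wpM2l; first exact: mulr_ge0.
    apply: ler_sum => i _.
    have /andP[k0 k1] := kt01 x (xs i).
    rewrite indicE; have [xU|xU] := boolP (x \in U i).
      by rewrite (le_trans (_ : _ <= 1)) ?lerDl ?sqr_ge0// !exprn_ile1 ?exprn_ge0.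
    rewrite add0r lerXn2r ?nnegrE ?exprn_ge0// U_eta//.
    by move=> /mem_set; exact/negP.
apply: (@le_trans _ _ (\int[mu]_x (F x)%:E)%E).
  by apply: ge0_subset_integral => //; [exact/measurable_EFinP|move=> x _; rewrite lee_fin].
have FE x : ((F x)%:E = (C + 2 * D * (n%:R * eta ^+ 2))%:E +
    \sum_(i < n) (2 * D)%:E * (\1_(U i) x)%:E)%E.
  rewrite -ge0_sume_distrr; last by move=> i _; rewrite lee_fin.
  rewrite sumEFin -EFinM -EFinD /F big_split/= sumr_const card_ord.
  by congr EFin; rewrite -[_ *+ n]mulr_natl; ring.
under eq_integral do rewrite FE.
have mU i : measurable_fun setT (fun x => (2 * D)%:E * (\1_(U i) x)%:E)%E.
  by apply/measurable_EFinP; apply: measurable_funM => //; exact: measurable_indic.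
have U0 i x : (0 <= (2 * D)%:E * (\1_(U i) x)%:E)%E.
  by rewrite mule_ge0// lee_fin// mulr_ge0.
have C'0 : 0 <= C + 2 * D * (n%:R * eta ^+ 2).
  apply: addr_ge0 => //; apply: mulr_ge0; first exact: mulr_ge0.
  by rewrite mulr_ge0 ?sqr_ge0.
rewrite ge0_integralD//=; last 2 first.
- by move=> x _; apply: sume_ge0 => i _; exact: U0.
- by apply: emeasurable_sum => i; exact: mU.
rewrite integral_cst// ge0_integral_sum//.
have -> : C + 2 * D * (n%:R * (cU + eta ^+ 2)) =
    (C + 2 * D * (n%:R * eta ^+ 2)) + \sum_(i < n) (2 * D) * cU.
  by rewrite sumr_const card_ord -[_ *+ n]mulr_natl; ring.
rewrite [leRHS]EFinD -sumEFin; apply: leeD.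
  rewrite -[leRHS]mule1 lee_wpmul2l ?lee_fin//.
  exact: (probability_le1 mu measurableT).
apply: lee_sum => i _.
have D20 : 0 <= 2 * D by rewrite mulr_ge0.
have mi : measurable_fun setT (fun x => (\1_(U i) x : R)%:E).
  by apply/measurable_EFinP; exact: measurable_indic.
rewrite ge0_integralZl//.
rewrite integral_indic// setIT [leRHS]EFinM; apply: lee_wpmul2l => //.
exact: mu_U.
Qed.

End risk_bound.

Lemma integral_cst_prob {R : realType} {d1 : measure_display}
    {T : measurableType d1} (mu : probability T R) (r : R) :
  (\int[mu]_x r%:E = r%:E)%E.
Proof.
transitivity (r%:E * mu setT)%E; first exact: integral_cst.
by rewrite probability_setT mule1.
Qed.

(** * Moment and deviation bounds for the random sample *)

Section sampling.
Context {R : realType} {d0 d1 : measure_display}.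
Context {Omega : measurableType d0} {T : measurableType d1}.
Variables (P : probability Omega R) (mu : probability T R).
Variables (xs : nat -> {RV P >-> T}) (ys : nat -> {RV P >-> R}).
Hypothesis xs_mu : forall i A, measurable A -> P (xs i @^-1` A) = mu A.
Hypothesis indep : mutually_independent P (fun i w => (xs i w, ys i w)).

Let mxys i : measurable_fun setT (fun w => (xs i w, ys i w)).
Proof. exact: measurable_fun_pair. Qed.

Definition sample_pair i : {mfun Omega >-> (T * R)%type} :=
  HB.pack (fun w => (xs i w, ys i w)) (isMeasurableFun.Build _ _ _ _ _ (mxys i)).

Lemma ge0_integral_sample i (h : T -> \bar R) :
  measurable_fun setT h -> (forall x, (0 <= h x)%E) ->
  (\int[P]_w h (xs i w) = \int[mu]_x h x)%E.
Proof.
move=> mh h0; have mxi : measurable_fun setT (xs i) by [].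
transitivity (\int[pushforward P (xs i)]_x h x)%E.
  by rewrite ge0_integral_pushforward.
by apply: eq_measure_integral => A mA _; exact: xs_mu.
Qed.

(** Chebyshev's inequality; the centred summands have absolute value at most 1, hence variance at
    most 1. *)
Lemma moment_concentration n (h : T -> R) (e : R) : (0 < n)%N -> 0 < e ->
  measurable_fun setT h -> (forall x, 0 <= h x <= 1) ->
  (P [set w | (e < `|n%:R^-1 * (\sum_(i < n) h (xs i w)) - \int[mu]_x h x|)%R]
   <= ((n%:R * e ^+ 2)^-1)%:E)%E.
Proof.
move=> n0 e0 mh h01; set m := Rintegral _ _ _.
have nR : 0 < n%:R :> R by rewrite ltr0n.
have ih : mu.-integrable setT (EFin \o h).
  apply: integrable_bounded => //; exists 1 => x.
  by have /andP[? ?] := h01 x; rewrite ger0_norm.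
have hfin : (\int[mu]_x (h x)%:E)%E \is a fin_num.
  exact: (integrable_fin_num measurableT ih).
have m0 : 0 <= m by apply: Rintegral_ge0 => x _; case/andP: (h01 x).
have m1 : m <= 1.
  rewrite -lee_fin fineK//; apply: (@le_trans _ _ (\int[mu]_x 1)%E).
    apply: ge0_le_integral => //.
    - by move=> x _; rewrite lee_fin; case/andP: (h01 x).
    - exact/measurable_EFinP.
    - by move=> x _; rewrite lee_fin; case/andP: (h01 x).
  by rewrite integral_cst_prob.
pose u (z : T * R) := h z.1 - m.
have mu_ : measurable_fun setT u.
  by apply: measurable_funB => //; apply: (measurableT_comp mh); exact: measurable_fst.
have u1 z : u z ^+ 2 <= 1.
  have /andP[? ?] := h01 z.1.
  by rewrite -real_normK ?num_real// expr_le1// ler_norml /u; apply/andP; split; lra.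
have mux i : measurable_fun setT (fun w => u (sample_pair i w)) by exact: measurableT_comp.
have := @variance_indep_sum _ _ _ _ _ P sample_pair indep n u 1 mu_.
have iu2 i : P.-integrable setT (fun w => (u (sample_pair i w) ^+ 2)%:E).
  apply: (integrable_bounded P (f := fun w => u (sample_pair i w) ^+ 2)).
    exact: measurable_funX.
  by exists 1 => w; rewrite ger0_norm ?sqr_ge0.
have u0 i : (\int[P]_w (u (sample_pair i w))%:E = 0)%E.
  rewrite /u /=; under eq_integral do rewrite EFinB.
  rewrite integralB//=.
  - rewrite (ge0_integral_sample i (h := EFin \o h)); last 2 first.
    + exact/measurable_EFinP.
    + by move=> x; rewrite lee_fin; case/andP: (h01 x).
    by rewrite integral_cst_prob /m fineK// subee.
  - apply: (integrable_bounded P (f := fun w => h (xs i w))); first exact: measurableT_comp.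
    by exists 1 => w; have /andP[? ?] := h01 (xs i w); rewrite ger0_norm.
  - exact: finite_measure_integrable_cst.
have u2 i : (\int[P]_w (u (sample_pair i w) ^+ 2)%:E <= 1%:E)%E.
  apply: (@le_trans _ _ (\int[P]_w 1)%E).
    apply: ge0_le_integral => //.
    - by move=> w _; rewrite lee_fin sqr_ge0.
    - by apply/measurable_EFinP; exact: measurable_funX.
    - by move=> w _; rewrite lee_fin.
  by rewrite integral_cst_prob.
move=> /(_ iu2 u0 u2); rewrite mulr1 -[n%:R in X in (_ <= X)%E -> _]mul1r => VW.
have mW : measurable_fun setT (fun w => (\sum_(i < n) u (sample_pair i w)) ^+ 2).
  by apply: measurable_funX; exact: measurable_sum.
have t0 : 0 < (n%:R * e) ^+ 2 by rewrite exprn_gt0// mulr_gt0.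
have := markov_scaled mW (fun w => sqr_ge0 _) ler01 (ler0n _ n) t0 VW.
rewrite mul1r (_ : n%:R / (n%:R * e) ^+ 2 = (n%:R * e ^+ 2)^-1); last first.
  by field; rewrite !gt_eqF.
congr (_ <= _)%E; congr (P _).
have key w : ((n%:R * e) ^+ 2 < (\sum_(i < n) u (sample_pair i w)) ^+ 2) =
    (e < `|n%:R^-1 * (\sum_(i < n) h (xs i w)) - m|).
  have -> : \sum_(i < n) u (sample_pair i w) =
      n%:R * (n%:R^-1 * (\sum_(i < n) h (xs i w)) - m).
    by rewrite sumrB sumr_const card_ord -[m *+ n]mulr_natl mulrBr mulVKf// gt_eqF.
  rewrite !exprMn ltr_pM2l ?exprn_gt0// -[in LHS](real_normK (num_real (_ - m))).
  by rewrite ltr_pXn2r// nnegrE ltW.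
by apply/seteqP; split => w /=; rewrite key.
Qed.

(** The products h(x_i) W_i are centred by [cond_mean0_ge0] and independent. Keeping [W] apart from
    [f] lets the conditional moments be stated with [fstar] and used with its extension by zero. *)
Lemma noise_second_moment n (h : T -> R) (W : nat -> Omega -> R) (f : T -> R) (sigma : R) :
  measurable_fun setT h -> (forall x, 0 <= h x <= 1) ->
  measurable_fun setT f ->
  (forall i w, W i w = ys i w - f (xs i w)) ->
  (forall i, is_cond_expectation P (xs i) (W i) (cst 0)) ->
  (forall i, is_cond_expectation P (xs i) (fun w => W i w ^+ 2) (cst (sigma ^+ 2))) ->
  (\int[P]_w ((\sum_(i < n) h (xs i w) * (ys i w - f (xs i w))) ^+ 2)%:E
   <= (n%:R * sigma ^+ 2)%:E)%E.
Proof.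
move=> mh h01 mf WE W0 W2.
have iW i : P.-integrable setT (EFin \o W i) by case: (W0 i).
have iW2 i : P.-integrable setT (EFin \o (fun w => W i w ^+ 2)) by case: (W2 i).
pose u (z : T * R) := h z.1 * (z.2 - f z.1).
have mu_ : measurable_fun setT u.
  apply: measurable_funM; first by apply: (measurableT_comp mh); exact: measurable_fst.
  apply: measurable_funB; first exact: measurable_snd.
  by apply: (measurableT_comp mf); exact: measurable_fst.
have uW i w : u (sample_pair i w) = h (xs i w) * W i w by rewrite /u WE.
have mux i : measurable_fun setT (fun w => u (sample_pair i w)) by exact: measurableT_comp.
have h1 x : `|h x| <= 1 by have /andP[? ?] := h01 x; rewrite ger0_norm.
have h2 x : h x ^+ 2 <= 1 by have /andP[? ?] := h01 x; rewrite expr_le1.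
have iu2 i : P.-integrable setT (fun w => (u (sample_pair i w) ^+ 2)%:E).
  apply: (le_integrable measurableT _ _ (iW2 i)).
    by apply/measurable_EFinP; exact: measurable_funX.
  move=> w _; rewrite lee_fin uW !normrX normrM exprMn ler_piMl ?exprn_ge0//.
  by rewrite expr_le1.
apply: (@variance_indep_sum _ _ _ _ _ P sample_pair indep n u (sigma ^+ 2) mu_ iu2).
- move=> i; under eq_integral do rewrite uW.
  exact: (cond_mean0_ge0 (W0 i)).
- move=> i; apply: (@le_trans _ _ (\int[P]_w (W i w ^+ 2)%:E)%E).
    apply: ge0_le_integral => //.
    + by move=> w _; rewrite lee_fin sqr_ge0.
    + by apply/measurable_EFinP; exact: measurable_funX.
    + exact: (measurable_int P (iW2 i)).
    + by move=> w _; rewrite lee_fin uW exprMn ler_piMl ?sqr_ge0.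
  have [_ _ /(_ setT measurableT)] := W2 i.
  by rewrite preimage_setT => ->; rewrite integral_cst_prob.
Qed.

(** From y^2 <= 2 f(x)^2 + 2 W^2, which is the origin of the factor 2. *)
Lemma label_second_moment n (W : nat -> Omega -> R) (f : T -> R) (sigma : R) :
  measurable_fun setT f ->
  (forall i w, W i w = ys i w - f (xs i w)) ->
  (forall i, is_cond_expectation P (xs i) (fun w => W i w ^+ 2) (cst (sigma ^+ 2))) ->
  mu.-integrable setT (fun x => (f x ^+ 2)%:E) ->
  (\int[P]_w (\sum_(i < n) ys i w ^+ 2)%:E
   <= ((\int[mu]_x (f x ^+ 2) + sigma ^+ 2) * (2 * n%:R))%:E)%E.
Proof.
move=> mf WE W2 if2.
have iW2 i : P.-integrable setT (EFin \o (fun w => W i w ^+ 2)) by case: (W2 i).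
under eq_integral do rewrite -sumEFin.
rewrite ge0_integral_sum//; last 2 first.
- by move=> i; apply/measurable_EFinP; exact: measurable_funX.
- by move=> i w _; rewrite lee_fin sqr_ge0.
have -> : (\int[mu]_x (f x ^+ 2) + sigma ^+ 2) * (2 * n%:R) =
    \sum_(i < n) 2 * (\int[mu]_x (f x ^+ 2) + sigma ^+ 2).
  by rewrite sumr_const card_ord -[_ *+ n]mulr_natl; ring.
rewrite -sumEFin; apply: lee_sum => i _.
have mfx : measurable_fun setT (fun w => f (xs i w) ^+ 2).
  by apply: measurable_funX; exact: measurableT_comp.
have mW2 : measurable_fun setT (EFin \o (fun w => W i w ^+ 2)).
    exact: (measurable_int P (iW2 i)).
apply: (@le_trans _ _ (\int[P]_w (2%:E * ((f (xs i w) ^+ 2)%:E + (W i w ^+ 2)%:E)))%E).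
  apply: ge0_le_integral => //.
  - by move=> w _; rewrite lee_fin sqr_ge0.
  - by apply/measurable_EFinP; exact: measurable_funX.
  - by apply: measurable_funeM; apply: emeasurable_funD => //; exact/measurable_EFinP.
  - move=> w _; rewrite -EFinD -EFinM lee_fin WE.
    by have := sqr_ge0 (f (xs i w) - (ys i w - f (xs i w))); nra.
rewrite ge0_integralZl//; last 2 first.
- by apply: emeasurable_funD => //; exact/measurable_EFinP.
- by move=> w _; rewrite -EFinD lee_fin addr_ge0 ?sqr_ge0.
rewrite ge0_integralD//; last 3 first.
- by move=> w _; rewrite lee_fin sqr_ge0.
- exact/measurable_EFinP.
- by move=> w _; rewrite lee_fin sqr_ge0.
rewrite (ge0_integral_sample i (h := fun x => (f x ^+ 2)%:E)); last 2 first.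
- by apply/measurable_EFinP; exact: measurable_funX.
- by move=> x; rewrite lee_fin sqr_ge0.
have [_ _ /(_ setT measurableT)] := W2 i.
rewrite preimage_setT => ->; rewrite integral_cst_prob.
by rewrite -[X in (X + _)%E]fineK ?(integrable_fin_num measurableT if2)// -EFinD -EFinM.
Qed.

Lemma separation_fail n (A : set (T * T)) (c : R) : measurable A ->
  (forall z, (mu [set y | A (z, y)] <= c%:E)%E) ->
  (P (\big[setU/set0]_(ij : 'I_n * 'I_n | ij.1 != ij.2)
     [set w | A (xs ij.1 w, xs ij.2 w)]) <= ((n * n)%:R * c)%:E)%E.
Proof.
move=> mA Ac.
have c0 : 0 <= c by rewrite -lee_fin (le_trans _ (Ac point)).
have mAx x : measurable [set y | A (x, y)].
  by have := measurable_xsection x mA; rewrite xsectionE.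
(* Independence is assumed for the pairs (x_i, y_i), so the event is lifted to pairs. *)
pose A' := [set z : (T * R) * (T * R) | A (z.1.1, z.2.1)].
have mA' : measurable A'.
  rewrite -[A']setTI; apply: (measurable_fun_pair (f := fun z : (T * R) * (T * R) => z.1.1)
    (g := fun z => z.2.1)) => //.
    by apply: (measurableT_comp (f := fst) (g := fst)); exact: measurable_fst.
  by apply: (measurableT_comp (f := fst) (g := snd));
    [exact: measurable_fst|exact: measurable_snd].
have pairle i j : i != j -> (P [set w | A (xs i w, xs j w)] <= c%:E)%E.
  move=> ij; apply: (pair_preimage_le (Z := sample_pair) indep ij mA') => -[x y].
  have := Ac x; rewrite -(xs_mu j)//.
have mpair i j : measurable [set w | A (xs i w, xs j w)].
  rewrite -[X in measurable X]setTI.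
  by apply: (measurable_fun_pair (f := xs i) (g := xs j)).
have : (P (\big[setU/set0]_(ij : 'I_n * 'I_n | ij.1 != ij.2)
     [set w | A (xs ij.1 w, xs ij.2 w)]) <=
     \sum_(ij : 'I_n * 'I_n | ij.1 != ij.2) c%:E)%E.
  suff [] : (P (\big[setU/set0]_(ij : 'I_n * 'I_n | ij.1 != ij.2)
     [set w | A (xs ij.1 w, xs ij.2 w)]) <=
     \sum_(ij : 'I_n * 'I_n | ij.1 != ij.2) c%:E)%E /\
     measurable (\big[setU/set0]_(ij : 'I_n * 'I_n | ij.1 != ij.2)
     [set w | A (xs ij.1 w, xs ij.2 w)]) by [].
  apply: (big_ind2 (fun (B : set Omega) b => (P B <= b)%E /\ measurable B)).
  - by rewrite measure0.
  - move=> B1 b1 B2 b2 [h1 m1] [h2 m2]; split; last exact: measurableU.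
    by rewrite (le_trans (measureU2 _ _ _))// leeD.
  - by move=> [i j] /= ij; split; [apply: pairle|exact: mpair].
move=> /le_trans; apply; rewrite sumEFin lee_fin.
rewrite big_mkcond/=; apply: (@le_trans _ _ (\sum_(ij : 'I_n * 'I_n) c)).
  by apply: ler_sum => ij _; case: ifP.
by rewrite sumr_const card_prod card_ord mulr_natl.
Qed.

End sampling.

(** * Rates *)

Section asymptotics.
Context {R : realType}.
Implicit Types (a c e : R).

Lemma cvg_powR_neg a : 0 < a -> (fun n => n%:R `^ (- a) : R) @ \oo --> (0 : R).
Proof.
move=> a0; apply/cvgrPdist_le => e e0; near=> n.
rewrite sub0r normrN ger0_norm ?powR_ge0// powRN.
have n0 : 0 < n%:R :> R by near: n; exact: nbhs_infty_gtr.
have ne : e^-1 `^ a^-1 <= n%:R by near: n; exact: nbhs_infty_ger.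
rewrite invf_ple ?posrE ?powR_gt0//.
rewrite (_ : e^-1 = (e^-1 `^ a^-1) `^ a); last first.
  by rewrite -powRrM mulVf ?gt_eqF// powRr1// invr_ge0 ltW.
by apply: ge0_ler_powR => //; rewrite ?nnegrE ?powR_ge0// ltW.
Unshelve. all: by end_near. Qed.

Lemma powR_nat_eta (m : R) (q n : nat) c : 0 <= m < 1 -> (0 < q)%N -> (0 < n)%N ->
  0 < c -> c * ln n%:R / - ln m <= q%:R -> m ^+ q <= n%:R `^ (- c).
Proof.
move=> /andP[m0 m1] q0 n0 c0.
(* At m = 0 the logarithm takes its default value 0 and the lower bound on [q] says nothing; [q > 0]
   makes the power vanish. *)
have [->|mN0] := eqVneq m 0; first by rewrite expr0n gtn_eqF// powR_ge0.
have {}m0 : 0 < m by rewrite lt_def mN0.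
have lnm : 0 < - ln m by rewrite oppr_gt0 ln_lt0// m0.
rewrite ler_pdivrMr// => h.
rewrite -(@lnK _ (m ^+ q)) ?posrE ?exprn_gt0// lnXn// /powR gt_eqF ?ltr0n//.
by rewrite ler_expR -[ln m *+ q]mulr_natl mulNr lerNr -mulrN.
Qed.

Lemma natr_powRD n a c : (0 < n)%N -> n%:R `^ (a + c) = n%:R `^ a * n%:R `^ c :> R.
Proof. by move=> n0; rewrite powRD// pnatr_eq0 -lt0n n0 implybT. Qed.

Section rates.
Variables (alpha alpha0 beta c : R) (delta rho E : nat -> R).
Hypothesis alpha_gt0 : 0 < alpha.
Hypothesis alpha0_gt0 : 0 < alpha0.
Hypothesis alpha0_lt1 : alpha0 < 1.
Hypothesis beta_gt0 : 0 < beta.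
Hypothesis c_gt : (6 + alpha) / 2 < c.
Hypothesis delta_gt0 : forall n, (0 < n)%N -> 0 < delta n.
Hypothesis rho_gt0 : forall n, (0 < n)%N -> 0 < rho n.
Hypothesis delta_o : delta =o_\oo (fun n => n%:R `^ (- ((2 + alpha) / beta))).
Hypothesis rho_n0 : (fun n => rho n * n%:R `^ alpha0) @ \oo --> (0 : R).
Hypothesis rho_ny : (fun n => rho n * n%:R) @ \oo --> +oo.
Hypothesis E_ge0 : forall n, 0 <= E n.
Hypothesis E_le : forall n, (0 < n)%N -> E n <= n%:R `^ (- c).

Lemma near_delta_le e : 0 < e ->
  \forall n \near \oo, delta n `^ beta <= e * n%:R `^ (- (2 + alpha)).
Proof.
(* The little-o constant whose power of exponent [beta] is [e]. *)
move=> e0; have e'0 : 0 < e `^ beta^-1 by rewrite powR_gt0.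
have /eqoP/(_ _ e'0) := delta_o; apply: filter_app; near=> n.
have n0 : (0 < n)%N by near: n; exact: nbhs_infty_gt.
rewrite !ger0_norm ?powR_ge0 ?(ltW (delta_gt0 n0))// => dn.
have := ge0_ler_powR (ltW beta_gt0) _ _ dn.
rewrite !nnegrE mulr_ge0 ?powR_ge0 ?(ltW (delta_gt0 n0))// => /(_ isT isT).
rewrite powRM ?powR_ge0// -!powRrM mulVf ?gt_eqF// powRr1 ?(ltW e0)//.
by rewrite mulNr -mulrA mulVf ?gt_eqF// mulr1.
Unshelve. all: by end_near. Qed.

Lemma cvg_delta : (fun n => n%:R `^ (2 + alpha) * delta n `^ beta) @ \oo --> (0 : R).
Proof.
apply/cvgrPdist_le => e e0; have := near_delta_le e0; apply: filter_app; near=> n.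
have n0 : (0 < n)%N by near: n; exact: nbhs_infty_gt.
move=> dn; rewrite sub0r normrN ger0_norm ?mulr_ge0 ?powR_ge0//.
rewrite (le_trans (ler_wpM2l (powR_ge0 _ _) dn))// mulrCA -natr_powRD// subrr.
by rewrite powRr0 mulr1.
Unshelve. all: by end_near. Qed.

Lemma cvg_powR_E (a : R) (j : nat) : a < c * j%:R ->
  (fun n => n%:R `^ a * E n ^+ j) @ \oo --> (0 : R).
Proof.
move=> acj.
apply: (@squeeze_cvgr _ _ _ _ (cst 0) (fun n => n%:R `^ (- (c * j%:R - a)))).
- near=> n; have n0 : (0 < n)%N by near: n; exact: nbhs_infty_gt.
  rewrite mulr_ge0 ?powR_ge0 ?exprn_ge0//= opprB natr_powRD// ler_wpM2l ?powR_ge0//.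
  rewrite -mulNr powRrM powR_mulrn ?powR_ge0//.
  by apply: lerXn2r; rewrite ?nnegrE ?powR_ge0// E_le.
- exact: cvg_cst.
- by apply: cvg_powR_neg; rewrite subr_gt0.
Unshelve. all: by end_near. Qed.

Lemma c_gt3 : 3 < c. Proof. by move: alpha_gt0 c_gt; lra. Qed.

Lemma cvg_nE : (fun n => n%:R * E n) @ \oo --> (0 : R).
Proof.
have : (fun n => n%:R `^ 1 * E n ^+ 1) @ \oo --> (0 : R).
  by apply: cvg_powR_E; have := c_gt3; lra.
by under eq_fun do rewrite powRr1// expr1.
Qed.

Lemma cvg_denominator : (fun n => ((1 - n%:R * E n) ^+ 2)^-1) @ \oo --> (1 : R).
Proof.
have h : (fun n => 1 - n%:R * E n) @ \oo --> (1 - 0 : R).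
  by apply: cvgB; [exact: cvg_cst|exact: cvg_nE].
rewrite subr0 in h.
have h2 : (fun n => (1 - n%:R * E n) ^+ 2) @ \oo --> (1 * 1 : R).
  by under eq_fun do rewrite expr2; exact: (cvgM h h).
rewrite mulr1 in h2; rewrite -[X in _ --> X]invr1.
by apply: cvgV h2; exact: oner_neq0.
Qed.

Lemma cvg_rhoV : (fun n => (rho n * n%:R)^-1) @ \oo --> (0 : R).
Proof.
have pos : \forall n \near \oo, 0 < rho n * n%:R.
  by exists 1%N => // n /= n0; rewrite mulr_gt0 ?rho_gt0// ltr0n.
exact: (gtr0_cvgV0 pos).2 rho_ny.
Qed.

Lemma cvg_rho : rho @ \oo --> (0 : R).
Proof.
apply: (@squeeze_cvgr _ _ _ _ (cst 0) (fun n => rho n * n%:R `^ alpha0)) => //.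
- near=> n; have n0 : (0 < n)%N by near: n; exact: nbhs_infty_gt.
  have r0 := rho_gt0 n0; rewrite (ltW r0)/= ler_pMr//.
  have : n%:R `^ 0 <= n%:R `^ alpha0 :> R by rewrite ler_powR// ?ler1n// ltW.
  by rewrite powRr0.
- exact: cvg_cst.
Unshelve. all: by end_near. Qed.

Lemma cvg_B0 (v b : R) : (fun n => v * n%:R `^ (alpha0 - 1) * (1 + (rho n * n%:R)^-1)
    + b * rho n * n%:R `^ alpha0 * (1 + (rho n * n%:R)^-1) ^+ 2) @ \oo --> (0 : R).
Proof.
have h1 : (fun n => 1 + (rho n * n%:R)^-1) @ \oo --> (1 + 0 : R).
  by apply: cvgD; [exact: cvg_cst|exact: cvg_rhoV].
rewrite (_ : 0 = v * 0 * (1 + 0) + b * 0 * (1 + 0) ^+ 2); last by ring.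
apply: cvgD; apply: cvgM => //.
- apply: cvgMr; rewrite (_ : alpha0 - 1 = - (1 - alpha0)); last by ring.
  by apply: cvg_powR_neg; rewrite subr_gt0.
- by under eq_fun do rewrite -mulrA; exact: cvgMr.
- by under eq_fun do rewrite expr2; rewrite expr2; exact: cvgM.
Qed.

(** Moving n^2 from rho^2 to the numerator leaves n^(6 + alpha) E^2 / (rho n)^2. This is where 2 c >
    6 + alpha enters, together with rho n tending to infinity. *)
Lemma cvg_B1 (v : R) : (fun n => v * (n%:R `^ (4 + alpha) * E n ^+ 2
    / (rho n ^+ 2 * (1 - n%:R * E n) ^+ 2))) @ \oo --> (0 : R).
Proof.
rewrite -(mulr0 v); apply: cvgMr.
have h : (fun n => n%:R `^ (6 + alpha) * E n ^+ 2 * (rho n * n%:R)^-1 ^+ 2 *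
    ((1 - n%:R * E n) ^+ 2)^-1) @ \oo --> (0 * 0 ^+ 2 * 1 : R).
  apply: cvgM; last exact: cvg_denominator.
  apply: cvgM; first by apply: cvg_powR_E; move: c_gt; lra.
  by under eq_fun do rewrite expr2; rewrite expr2; apply: cvgM; exact: cvg_rhoV.
rewrite !mul0r in h; apply: cvg_trans h; apply: near_eq_cvg; near=> n.
have n0 : (0 < n)%N by near: n; exact: nbhs_infty_gt.
have nR : 0 < n%:R :> R by rewrite ltr0n.
rewrite (_ : 6 + alpha = (4 + alpha) + 2%:R); last by ring.
rewrite natr_powRD// [n%:R `^ 2%:R]powR_mulrn//.
have r0 := rho_gt0 n0; rewrite (invfM (rho n ^+ 2)).
move: (((1 - n%:R * E n) ^+ 2)^-1) => z.
by field; rewrite !gt_eqF.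
Unshelve. all: by end_near. Qed.

Lemma cvg_B2 (v C : R) : (fun n => v * (n%:R `^ (2 + alpha)
    * (C * delta n `^ beta + E n ^+ 2) / (1 - n%:R * E n) ^+ 2)) @ \oo --> (0 : R).
Proof.
rewrite -(mulr0 v); apply: cvgMr.
rewrite -(mul0r 1); apply: cvgM; last exact: cvg_denominator.
rewrite (_ : 0 = C * 0 + 0); last by ring.
under eq_fun do rewrite mulrDr mulrCA.
apply: cvgD; first by apply: cvgMr; exact: cvg_delta.
by apply: cvg_powR_E; move: alpha_gt0 c_gt; lra.
Qed.

End rates.

End asymptotics.

(** * Probability of failure *)

Lemma measure_bigsetU_le {R : realType} {d0} {Omega : measurableType d0}
    (P : {measure set Omega -> \bar R}) (I : finType) (Q : pred I)
    (F : I -> set Omega) (c : R) : 0 <= c ->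
  (forall i, measurable (F i)) -> (forall i, (P (F i) <= c%:E)%E) ->
  measurable (\big[setU/set0]_(i | Q i) F i) /\
  (P (\big[setU/set0]_(i | Q i) F i) <= (#|I|%:R * c)%:E)%E.
Proof.
move=> c0 mF Fc.
have [mU PU] : measurable (\big[setU/set0]_(i | Q i) F i) /\
    (P (\big[setU/set0]_(i | Q i) F i) <= \sum_(i | Q i) c%:E)%E.
  apply: (big_ind2 (fun (B : set Omega) b => measurable B /\ (P B <= b)%E)).
  - by rewrite measure0.
  - move=> B1 b1 B2 b2 [m1 h1] [m2 h2]; split; first exact: measurableU.
    by rewrite (le_trans (measureU2 _ _ _))// leeD.
  - by move=> i _; split.
split => //; apply: (le_trans PU); rewrite sumEFin lee_fin big_mkcond/=.
apply: (@le_trans _ _ (\sum_(i : I) c)).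
  by apply: ler_sum => i _; case: ifP.
by rewrite sumr_const mulr_natl.
Qed.

Lemma fin_bigsetUP (I : finType) T (Q : pred I) (F : I -> set T) x :
  (\big[setU/set0]_(i | Q i) F i) x <-> exists2 i, Q i & F i x.
Proof.
split; last first.
  by move=> [i Qi Fix]; rewrite (bigD1 i)//; left.
by elim/big_rec: _ => // i A Qi IH [Fix|/IH //]; exists i.
Qed.

Section off_spike.
Context {R : realType} {d : nat}.
Variables (X : set (d.-tuple R)) (k : d.-tuple R -> d.-tuple R -> R).
Variable delta : R.
Hypothesis k01 : forall x z, X x -> X z -> 0 <= k x z <= 1.

Lemma off_spike_sup_ge0 : 0 <= off_spike_sup X k delta.
Proof.
rewrite /off_spike_sup.
have [->|/set0P[y Sy]] := eqVneq
  [set k p.1 p.2 | p in (X `*` X) `\` spike_nbhd X k delta] set0.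
  by rewrite sup0.
have y0 : 0 <= y by case: Sy => -[x z] [[/= Xx Xz] _] <-; case/andP: (k01 Xx Xz).
apply: (le_trans y0); apply: sup_upper_bound => //; split; first by exists y.
by exists 1 => _ [[x z] [[/= Xx Xz] _] <-]; case/andP: (k01 Xx Xz).
Qed.

Lemma off_spike_sup_ge x z : X x -> X z ->
  ~ (dist_spike X k (x, z) <= delta%:E)%E -> k x z <= off_spike_sup X k delta.
Proof.
move=> Xx Xz xz; apply: sup_upper_bound.
  split; first by exists (k x z); exists (x, z) => //; split => // -[_ _].
  by exists 1 => _ [[x' z'] [[/= Xx' Xz'] _] <-]; case/andP: (k01 Xx' Xz').
by exists (x, z) => //; split => // -[_ _].
Qed.

End off_spike.

Lemma eq_ridgeless {R : realType} {d : nat} (k k' : d.-tuple R -> d.-tuple R -> R) n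
    (xs : nat -> d.-tuple R) (ys : nat -> R) x :
  (forall j, k x (xs j) = k' x (xs j)) ->
  (forall i j, k (xs i) (xs j) = k' (xs i) (xs j)) ->
  ridgeless k n xs ys x = ridgeless k' n xs ys x.
Proof.
move=> kx kxs; rewrite /ridgeless.
have -> : \row_(j < n) k x (xs j) = \row_j k' x (xs j).
  by apply/rowP => j; rewrite !mxE.
have -> // : \matrix_(i < n, j < n) k (xs i) (xs j) = \matrix_(i, j) k' (xs i) (xs j).
by apply/matrixP => i j; rewrite !mxE.
Qed.

Section bad_event.
Context {R : realType} {d : nat} {d0 : measure_display} {Omega : measurableType d0}.
Let T := d.-tuple R.
Variables (X : set T) (k : T -> T -> R) (tau : T).
Hypothesis X_bounded : ebounded X.
Hypothesis X_meas : measurable X.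
Hypothesis k_meas : forall z, X z -> measurable_fun X (fun x => k x z).
Hypothesis tau_gt0 : forall i, 0 < tnth tau i.
Hypothesis k_eq1 : forall x z, X x -> X z ->
  (k x z = 1 <-> exists a : d.-tuple int, esub x z = lattice_pt tau a).
Variables (N : nat) (phi : T -> 'rV[R]_N).
Hypothesis kE : forall x z, X x -> X z -> k x z = (phi x *m (phi z)^T) 0 0.
Hypothesis k_ge0 : forall x z, X x -> X z -> 0 <= k x z.
Hypothesis k_diag : forall x, X x -> k x x = 1.
Let kt := patched_kernel X k.

Variables (mu : probability T R) (P : probability Omega R).
Variables (xs : nat -> {RV P >-> T}) (ys : nat -> {RV P >-> R}).
Hypothesis xs_X : forall i w, X (xs i w).
Hypothesis xs_mu : forall i A, measurable A -> P (xs i @^-1` A) = mu A.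
Hypothesis indep : mutually_independent P (fun i w => (xs i w, ys i w)).
Variables (fstar : T -> R) (sigma : R).
Hypothesis eps_mean : forall i, is_cond_expectation P (xs i)
  (fun w => ys i w - fstar (xs i w)) (cst 0).
Hypothesis eps_var : forall i, is_cond_expectation P (xs i)
  (fun w => (ys i w - fstar (xs i w)) ^+ 2) (cst (sigma ^+ 2)).

Variables (X0 : set T) (s : nat) (Z : 'I_s -> T).
Hypothesis X0X : X0 `<=` X.
Hypothesis X0_meas : measurable X0.
Hypothesis mu_X0 : mu (~` X0) = 0%E.
Let G := \matrix_(a, b) kt (Z a) (Z b).
Hypothesis G_unit : G \in unitmx.
Hypothesis kt_Z : forall x z, X0 x -> kt x z =
  \sum_b (\sum_a kt x (Z a) * invmx G a b) * kt (Z b) z.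
Let S := second_moment mu (fun a => kt ^~ (Z a)).
Hypothesis S_unit : S \in unitmx.
Let ft x := if x \in X then fstar x else 0.
Hypothesis ft_meas : measurable_fun setT ft.
Hypothesis ft_bounded : exists M, forall x, `|ft x| <= M.
Variable c : 'cV[R]_s.
Hypothesis ft_Z : forall x, X0 x -> ft x = \sum_a kt x (Z a) * c a 0.

Variables (n q : nat) (rho delta L h gamma cU t1 t2 : R).
Let eta := off_spike_sup X k delta ^+ q.
Let Cy := \int[mu]_(x in X) (fstar x ^+ 2) + sigma ^+ 2.
Hypothesis n_gt0 : (0 < n)%N.
Hypothesis rho_gt0 : 0 < rho.
Hypothesis delta_gt0 : 0 < delta.
Hypothesis eta_lt1 : n%:R * eta < 1.
Hypothesis L_ge0 : 0 <= L.
Hypothesis S_le : forall a b, `|invmx S a b| <= L.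
Hypothesis h_gt0 : 0 < h.
Hypothesis Lh_le : s%:R * s%:R * L * h <= 2^-1.
Hypothesis rhoG_le : forall a b, `|n%:R^-1 * rho * G a b| <= h / 2.
Hypothesis gamma_ge0 : 0 <= gamma.
Hypothesis bias_le : forall a, `|(G *m c) a 0| <= gamma.
Hypothesis cU_ge0 : 0 <= cU.
Hypothesis mu_near : forall z, (mu (near_spike X tau delta z) <= cU%:E)%E.
Hypothesis t1_gt0 : 0 < t1.
Hypothesis t2_gt0 : 0 < t2.

Let risk w := (\int[mu]_(x in X)
  (`| ridgeless (spiked_kernel k rho q) n (fun i => xs i w) (fun i => ys i w) x
      - fstar x | ^+ 2)%:E)%E.

Let D := Cy * t2 / (1 - n%:R * eta) ^+ 2.
Let B := 24 * s%:R ^+ 4 * L ^+ 2 / n%:R ^+ 2 *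
  (sigma ^+ 2 * t1 + rho ^+ 2 * gamma ^+ 2 + n%:R * ((n%:R * eta) ^+ 2 * D)) +
  2 * D * (n%:R * (cU + eta ^+ 2)).

(** Sample and integration points all lie in [X], where the extensions by zero agree with the
    original functions. *)
Let riskE w : risk w = (\int[mu]_(x in X)
  (`| ridgeless (spiked_kernel kt rho q) n (fun i => xs i w) (fun i => ys i w) x
      - ft x | ^+ 2)%:E)%E.
Proof.
apply: eq_integral => x xX; have Xx := set_mem xX.
rewrite /ft xX; congr ((`|_ - _| ^+ 2)%:E).
by apply: eq_ridgeless => [j|i j]; rewrite /spiked_kernel /kt patched_kernelE.
Qed.

Lemma measurable_risk_fun : measurable_fun setT risk.
Proof.
rewrite (funext riskE).
have mkt := measurable_patched_kernel X_meas k_meas kE.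
apply: measurable_integral_error => //.
by apply: measurable_funD => //; apply: measurable_funM => //; exact: measurable_funX.
Qed.

(** The four terms are the failure probabilities of separation ([N1]), labels ([N2]), empirical
    moments ([N3]) and noise ([N4]). The event [N0], a sample point outside [X0], is null. Off these
    events [ridgeless_risk_le] applies with [U i] the neighbourhood of the spikes of the i-th sample
    point. *)
Lemma bad_event_le : (P (~` [set w | (risk w <= B%:E)%E]) <=
  ((n * n)%:R * cU + 2 * n%:R / t2 + (s * s)%:R * (n%:R * (h / 2) ^+ 2)^-1
   + s%:R * (n%:R / t1))%:E)%E.
Proof.
have k01 x z : X x -> X z -> 0 <= k x z <= 1.
  by move=> Xx Xz; rewrite k_ge0//= (feature_kernel_le1 kE k_ge0 k_diag).
have kt01 := patched_kernel_itv kE k_ge0 k_diag.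
have ktC := patched_kernelC kE.
have mkt1 := measurable_patched_kernel1 X_meas k_meas.
have ft_xs i w : ft (xs i w) = fstar (xs i w) by rewrite /ft mem_set.
have eta0 : 0 <= eta by rewrite exprn_ge0// off_spike_sup_ge0.
have CyE : Cy = \int[mu]_x (ft x ^+ 2) + sigma ^+ 2.
  rewrite /Cy; congr (_ + _); rewrite Rintegral_mkcond; apply: eq_Rintegral => x _.
  by rewrite /patch /ft; case: ifP => // _; rewrite expr0n.
have Cy0 : 0 <= Cy by rewrite addr_ge0 ?sqr_ge0// Rintegral_ge0// => x _; exact: sqr_ge0.
have mf2 : measurable_fun setT (fun x => ft x ^+ 2) by exact: measurable_funX.
have if2 : mu.-integrable setT (fun x => (ft x ^+ 2)%:E).
  have [M fM] := ft_bounded; apply: (integrable_bounded mu (f := fun x => ft x ^+ 2)) => //.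
  by exists (M ^+ 2) => x; rewrite normrX lerXn2r// nnegrE (le_trans _ (fM x)).
pose N0 := \big[setU/set0]_(i < n) [set w | (~` X0) (xs i w)].
(* Both orders of each pair are included, so no symmetry of [near_spike] has to be proved. *)
pose N1 := \big[setU/set0]_(ij : 'I_n * 'I_n | ij.1 != ij.2)
  [set w | near_spike X tau delta (xs ij.1 w) (xs ij.2 w)].
pose N2 := [set w | (Cy * t2 < \sum_(i < n) ys i w ^+ 2)].
pose N3 := \big[setU/set0]_(ab : 'I_s * 'I_s) [set w | (h / 2 <
  `|n%:R^-1 * (\sum_(i < n) kt (xs i w) (Z ab.1) * kt (xs i w) (Z ab.2)) - S ab.1 ab.2|)].
pose N4 := \big[setU/set0]_(a < s) [set w | (sigma ^+ 2 * t1 <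
  (\sum_(i < n) kt (xs i w) (Z a) * (ys i w - ft (xs i w))) ^+ 2)].
have mpre i A : measurable A -> measurable (xs i @^-1` A).
  by move=> mA; rewrite -[X in measurable X]setTI; exact: (measurable_funP (xs i)).
have PX0 i : (P (xs i @^-1` (~` X0)) <= 0%:E)%E.
  by rewrite xs_mu ?mu_X0//; exact: measurableC.
have [mN0 PN0] : measurable N0 /\ (P N0 <= (#|'I_n|%:R * 0)%:E)%E.
  by apply: measure_bigsetU_le => // i; [apply: mpre; exact: measurableC|exact: PX0].
have mA : measurable [set p : T * T | near_spike X tau delta p.1 p.2].
  have := measurable_near_spike X tau delta.
  move=> /(@measurable_swap _ _ T T measurableT); rewrite setTI.
  by congr measurable.
have mN1 : measurable N1.
  apply: bigsetU_measurable => -[i j] _ /=.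
  have mxx := measurable_fun_pair (measurable_funP (xs i)) (measurable_funP (xs j)).
  by have := mxx measurableT _ mA; rewrite setTI.
have PN1 : (P N1 <= ((n * n)%:R * cU)%:E)%E.
  exact: (separation_fail xs_mu indep n mA mu_near).
have mY : measurable_fun setT (fun w => \sum_(i < n) ys i w ^+ 2).
  by apply: measurable_sum => i; exact: measurable_funX.
have mN2 : measurable N2 by exact: measurable_lt_set.
have WE i w : ys i w - fstar (xs i w) = ys i w - ft (xs i w) by rewrite ft_xs.
have PN2 : (P N2 <= (2 * n%:R / t2)%:E)%E.
  apply: markov_scaled => //.
  - by move=> w; apply: sumr_ge0 => i _; exact: sqr_ge0.
  - by rewrite CyE; exact: (label_second_moment xs_mu _ ft_meas WE eps_var).
have kt2 a b x : 0 <= kt x (Z a) * kt x (Z b) <= 1.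
  have /andP[a0 a1] := kt01 x (Z a); have /andP[b0 b1] := kt01 x (Z b).
  by rewrite mulr_ge0//= mulr_ile1.
have mkt2 a b : measurable_fun setT (fun x => kt x (Z a) * kt x (Z b)).
  by apply: measurable_funM; exact: mkt1.
have [mN3 PN3] : measurable N3 /\
    (P N3 <= (#|{: 'I_s * 'I_s}|%:R * (n%:R * (h / 2) ^+ 2)^-1)%:E)%E.
  apply: measure_bigsetU_le => [|[a b]|[a b]] /=.
  - by rewrite invr_ge0 mulr_ge0// sqr_ge0.
  - apply: measurable_lt_set => //; apply: measurableT_comp => //.
    apply: measurable_funB => //; apply: measurable_funM => //.
    by apply: measurable_sum => i; apply: (measurableT_comp (mkt2 a b)).
  - rewrite mxE; apply: (moment_concentration xs_mu indep) => //.
    by rewrite divr_gt0.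
have [mN4 PN4] : measurable N4 /\ (P N4 <= (#|'I_s|%:R * (n%:R / t1))%:E)%E.
  have mW a : measurable_fun setT (fun w =>
      (\sum_(i < n) kt (xs i w) (Z a) * (ys i w - ft (xs i w))) ^+ 2).
    apply: measurable_funX; apply: measurable_sum => i; apply: measurable_funM.
      by apply: (measurableT_comp (mkt1 (Z a))).
    by apply: measurable_funB => //; apply: (measurableT_comp ft_meas).
  apply: measure_bigsetU_le => [|a|a].
  - by rewrite divr_ge0// ltW.
  - by apply: measurable_lt_set.
  - apply: markov_scaled => //; [by move=> w; exact: sqr_ge0|exact: sqr_ge0|].
    rewrite [sigma ^+ 2 * _]mulrC.
    apply: (noise_second_moment indep n (mkt1 (Z a)) (fun x => kt01 x (Z a))
      ft_meas WE eps_mean eps_var).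
have mbad : measurable (~` [set w | (risk w <= B%:E)%E]).
  apply: measurableC; have := emeasurable_fun_infty_c measurableT measurable_risk_fun B%:E.
  by rewrite setTI.
pose U := N1 `|` N2 `|` N3 `|` N4 `|` N0.
have mU : measurable U by do 4 (apply: measurableU => //).
have badU : ~` [set w | (risk w <= B%:E)%E] `<=` U.
  move=> w /=; apply: contra_notP => /not_orP[/not_orP[/not_orP[/not_orP[w1 w2] w3] w4] w0].
  have xs0 i : (i < n)%N -> X0 (xs i w).
    move=> ltin; apply: contrapT => xX0; apply: w0.
    by apply/fin_bigsetUP; exists (Ordinal ltin).
  have sep i j : (i < n)%N -> (j < n)%N -> i != j ->
      ~ near_spike X tau delta (xs i w) (xs j w).
    move=> ltin ltjn ij wij; apply: w1; apply/fin_bigsetUP.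
    by exists (Ordinal ltin, Ordinal ltjn).
  have near_eta x z : X x -> X z -> ~ near_spike X tau delta z x -> kt x z ^+ q <= eta.
    move=> Xx Xz xz; rewrite /kt patched_kernelE// lerXn2r ?nnegrE ?k_ge0//.
      exact: off_spike_sup_ge0.
    apply: off_spike_sup_ge => // xzd; apply: xz.
    exact: (dist_spike_near X_bounded tau_gt0 k_eq1).
  have st0 : 0 <= sigma ^+ 2 * t1 by rewrite mulr_ge0 ?sqr_ge0// ltW.
  have ktphi x z : X0 x -> X0 z -> kt x z = (phi x *m (phi z)^T) 0 0.
    by move=> /X0X Xx /X0X Xz; rewrite /kt patched_kernelE// kE.
  have ktdiag x : X0 x -> kt x x = 1.
    by move=> /X0X Xx; rewrite /kt patched_kernelE// k_diag.
  (* The regression bound is stated with the square of the noise level, so the level is the square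
     root of sigma^2 t1. *)
  rewrite riskE /B /D -[sigma ^+ 2 * t1](sqr_sqrtr st0).
  apply: (ridgeless_risk_le X_meas mkt1 ktC kt01 ktphi ktdiag X0_meas mu_X0 G_unit
    kt_Z S_unit n_gt0 rho_gt0 eta0 eta_lt1 ft_meas ft_Z xs0 _ L_ge0 S_le (ltW h_gt0) Lh_le
    _ rhoG_le _ bias_le _ gamma_ge0 (U := fun i => near_spike X tau delta (xs i w))) => //.
  - move=> i j ltin ltjn ij; apply: near_eta; [exact: xs_X|exact: xs_X|].
    by apply: sep => //; rewrite eq_sym.
  - move=> a b; rewrite leNgt; apply/negP => hab; apply: w3.
    by apply/fin_bigsetUP; exists (a, b).
  - move=> a; rewrite -sqrtr_sqr ler_sqrt// leNgt; apply/negP => ha; apply: w4.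
    by apply/fin_bigsetUP; exists a.
  - by move=> i; exact: measurable_near_spike1.
  - by move=> i x ltin X0x; apply: near_eta; [exact: X0X|exact: xs_X].
  - by rewrite leNgt; apply/negP.
apply: (@le_trans _ _ (P U)); first by apply: le_measure; rewrite ?inE.
have PU2 (A1 A2 : set Omega) (a1 a2 : R) : measurable A1 -> measurable A2 ->
    (P A1 <= a1%:E)%E -> (P A2 <= a2%:E)%E -> (P (A1 `|` A2) <= (a1 + a2)%:E)%E.
  by move=> m1 m2 h1 h2; rewrite (le_trans (measureU2 _ m1 m2))// EFinD leeD.
(* The added zero is the share of the null event [N0]. *)
rewrite -[X in X%:E]addr0; apply: (PU2) => //.
- by do 3 (apply: measurableU => //).
- apply: (PU2) => //; first by do 2 (apply: measurableU => //).
    apply: (PU2) => //; first exact: measurableU.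
      exact: PU2.
    by move: PN3; rewrite card_prod card_ord.
  by move: PN4; rewrite card_ord.
- by move: PN0; rewrite mulr0.
Qed.

End bad_event.

(** Here N stands for n, a0 and a for n^alpha0 and n^alpha, v for sigma^2, M4 for 4^m, nf for the
    squared RKHS norm, g2 for gamma^2, cm for Cmu delta^beta and w for (1 - n eta)^2. The noise goes
    into the first term of [B0] since K0 t1 <= 1, the bias into the second by the last hypothesis,
    and the spikes into [B2] since t2, K0 t2 <= 1 and t2 cU <= cm. *)
Lemma error_bound_le (R : realFieldType)
    (N a0 a K0 t1 t2 v g2 nf rho M4 eta Cy cU cm w : R) :
  1 <= N -> 1 <= a0 -> 0 <= a -> 0 <= K0 -> 0 <= t1 -> 0 <= t2 -> 0 <= v ->
  0 <= g2 -> 0 <= nf -> 0 < rho -> 1 <= M4 -> 0 <= Cy -> 0 < w -> 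
  K0 * t1 <= 1 -> K0 * t2 <= 1 -> t2 <= 1 -> t2 * cU <= cm -> 0 <= cm ->
  K0 * rho * g2 <= 2 * nf ->
  K0 / N ^+ 2 * (v * (t1 * (N * a0)) + rho ^+ 2 * g2 +
      N * ((N * eta) ^+ 2 * (Cy * (t2 * (N * a)) / w))) +
    2 * (Cy * (t2 * (N * a)) / w) * (N * (cU + eta ^+ 2)) <=
  (2 * v * M4 * (a0 / N) * (1 + (rho * N)^-1) +
   2 * nf * rho * a0 * (1 + (rho * N)^-1) ^+ 2) +
  4 * Cy * (N ^+ 2 * a * (cm + eta ^+ 2) / w).
Proof.
move=> N1 a01 a_ge0 K00 t10 t20 v0 g20 nf0 rho0 M41 Cy0 w0 Kt1 Kt2 t21 tcU cm0 Kg.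
have N0 : 0 < N by rewrite (lt_le_trans ltr01).
have i0 : 0 <= (rho * N)^-1 by rewrite invr_ge0 mulr_ge0// ltW.
have i1 : 1 <= 1 + (rho * N)^-1 by rewrite lerDl.
have i2 : 1 <= (1 + (rho * N)^-1) ^+ 2 by rewrite exprn_ege1.
have a00 : 0 <= a0 by rewrite (le_trans ler01).
pose A := v * (a0 / N).
have A0 : 0 <= A by rewrite mulr_ge0// divr_ge0// ltW.
have h1 : K0 * t1 * A <= 2 * A * M4 * (1 + (rho * N)^-1).
  have e1 : K0 * t1 * A <= A by rewrite ler_piMl.
  have e2 : A <= A * M4 by rewrite ler_peMr.
  have e3 : A * M4 <= A * M4 * (1 + (rho * N)^-1).
    by rewrite ler_peMr// mulr_ge0// (le_trans ler01).
  rewrite (_ : 2 * A * M4 * _ = 2 * (A * M4 * (1 + (rho * N)^-1))); last by ring.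
  have := le_trans (le_trans e1 e2) e3; have := le_trans (le_trans A0 e2) e3.
  by move: (A * M4 * _) => z; lra.
have h2 : K0 * rho * g2 * rho / N ^+ 2 <= 2 * nf * rho * a0 * (1 + (rho * N)^-1) ^+ 2.
  have e1 : K0 * rho * g2 * rho <= 2 * nf * rho by rewrite ler_wpM2r// ltW.
  have q0 : 0 <= K0 * rho * g2 * rho by rewrite !mulr_ge0// ltW.
  have e2 : K0 * rho * g2 * rho / N ^+ 2 <= K0 * rho * g2 * rho.
    by rewrite ler_pdivrMr ?exprn_gt0// ler_peMr// exprn_ege1.
  have q1 : 0 <= 2 * nf * rho by rewrite !mulr_ge0// ltW.
  have e3 : 2 * nf * rho <= 2 * nf * rho * a0 by rewrite ler_peMr.
  have e4 : 2 * nf * rho * a0 <= 2 * nf * rho * a0 * (1 + (rho * N)^-1) ^+ 2.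
    by rewrite ler_peMr// mulr_ge0.
  exact: le_trans (le_trans e2 e1) (le_trans e3 e4).
pose Q := Cy * (N ^+ 2 * a / w).
have Q0 : 0 <= Q by rewrite mulr_ge0// divr_ge0 ?(ltW w0)// mulr_ge0// sqr_ge0.
have h3 : Q * ((K0 * t2 + 2 * t2) * eta ^+ 2 + 2 * (t2 * cU)) <=
    Q * (4 * (cm + eta ^+ 2)).
  rewrite ler_wpM2l//; have e0 := sqr_ge0 eta.
  have e1 : (K0 * t2 + 2 * t2) * eta ^+ 2 <= 3 * eta ^+ 2.
    by rewrite ler_wpM2r//; lra.
  lra.
have -> : K0 / N ^+ 2 * (v * (t1 * (N * a0)) + rho ^+ 2 * g2 +
      N * ((N * eta) ^+ 2 * (Cy * (t2 * (N * a)) / w))) +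
    2 * (Cy * (t2 * (N * a)) / w) * (N * (cU + eta ^+ 2)) =
    K0 * t1 * A + K0 * rho * g2 * rho / N ^+ 2 +
    Q * ((K0 * t2 + 2 * t2) * eta ^+ 2 + 2 * (t2 * cU)).
  by rewrite /A /Q; field; rewrite !gt_eqF.
have -> : 2 * v * M4 * (a0 / N) * (1 + (rho * N)^-1) = 2 * A * M4 * (1 + (rho * N)^-1).
  by rewrite /A; ring.
have -> : 4 * Cy * (N ^+ 2 * a * (cm + eta ^+ 2) / w) = Q * (4 * (cm + eta ^+ 2)).
  by rewrite /Q; ring.
by apply: lerD => //; exact: lerD.
Qed.

(** * The target function and the constants of the density *)

Section patched_function.
Context {R : realType} {d1 : measure_display} {T : measurableType d1}.
Variables (X : set T) (k : T -> T -> R).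
Variables (H : set (X -> R)) (ip : (X -> R) -> (X -> R) -> R).
Hypothesis H_rkhs : is_rkhs (fun x z : X => k (val x) (val z)) H ip.
Variable f : T -> R.
Hypothesis f_H : H (fun x : X => f (val x)).
Local Notation kt := (patched_kernel X k).

Definition patched_function x := if x \in X then f x else 0.
Local Notation ft := patched_function.

(** The RKHS consists of functions on the subtype [X], so the points are lifted there to apply
    [rkhs_interpolation]. *)
Lemma patched_function_interpolation (X' : set T) s (Z : 'I_s -> T)
    (M : 'M[R]_s) : X' `<=` X -> (forall a, X' (Z a)) ->
  (forall x z, X' x ->
    kt x z = \sum_b (\sum_a kt x (Z a) * M a b) * kt (Z b) z) ->
  forall x, X' x -> ft x = \sum_b (\sum_a kt x (Z a) * M a b) * ft (Z b).
Proof.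
move=> X'X ZX' kZ x X'x; have Xx := X'X _ X'x.
have XZ a : X (Z a) by exact: X'X.
pose x' : X := exist _ x (mem_set Xx).
pose Z' a : X := exist _ (Z a) (mem_set (XZ a)).
transitivity (\sum_b (\sum_a kt x (Z a) * M a b) * f (Z b)); last first.
  by apply: eq_bigr => b _; rewrite /ft mem_set//; exact: XZ.
rewrite /ft mem_set//.
apply: (rkhs_interpolation H_rkhs (Z := Z') (x := x')
  (w := fun b => \sum_a kt x (Z a) * M a b) f_H).
move=> [z zX] /=; have Xz := set_mem zX.
rewrite -(patched_kernelE k Xx Xz) kZ//; apply: eq_bigr => b _.
by rewrite (patched_kernelE k (XZ b) Xz).
Qed.

Lemma patched_function_eq0 : rkhs_norm ip (fun x : X => f (val x)) = 0 ->
  forall x, ft x = 0.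
Proof.
move=> /(rkhs_norm_eq0 H_rkhs f_H) f0 x; rewrite /ft; case: ifPn => // xX.
by have := congr1 (fun g => g (exist _ x xX)) f0.
Qed.

End patched_function.

Section constants.
Context {R : realType} {d : nat}.

Lemma leb_setT_gt0 : (0 < leb d [set: d.-tuple R])%E.
Proof.
apply: (@lt_le_trans _ _ (leb d (cube [tuple 0 | i < d] (1 : R)))).
  by rewrite leb_cube// lte_fin exprn_gt0// mulr1.
by apply: le_measure; rewrite ?inE//; exact: measurable_cube.
Qed.

Lemma le_coord_enorm (x : d.-tuple R) i : `|tnth x i| <= enorm x.
Proof.
rewrite -sqrtr_sqr ler_sqrt; last by apply: sumr_ge0 => j _; rewrite sqr_ge0.
by rewrite (bigD1 i)//= lerDl; apply: sumr_ge0 => j _; rewrite sqr_ge0.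
Qed.

(** The ball lies between cubes of half-sides 1 / (d + 1) and 1. The outer one matters because
    [fine] would send an infinite volume to 0. *)
Lemma leb_unit_ball_gt0 :
  0 < fine (leb d (eball [tuple 0 | i < d] (1 : R))).
Proof.
set o := [tuple _ | _ < _].
have esubo (x : d.-tuple R) : esub x o = x.
  by apply: eq_from_tnth => i; rewrite !tnth_mktuple subr0.
have mball : measurable (eball o (1 : R)).
  rewrite (_ : eball _ _ = [set x | \sum_(i < d) tnth x i ^+ 2 < 1]).
    apply: measurable_lt_set => //; apply: measurable_sum => i.
    by apply: measurable_funX; exact: measurable_tnth.
  have lt1 (x : d.-tuple R) : (enorm x < 1) = (\sum_(i < d) tnth x i ^+ 2 < 1).
    by rewrite /enorm -[X in (_ < X) = _]sqrtr1 ltr_sqrt.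
  by apply/seteqP; split => x; rewrite /eball /= esubo lt1.
pose r : R := d.+1%:R^-1.
have r0 : 0 < r by rewrite invr_gt0.
have sub1 : cube o r `<=` eball o 1.
  move=> x xr; rewrite /eball /= esubo /enorm -[X in _ < X]sqrtr1 ltr_sqrt//.
  apply: (@le_lt_trans _ _ (\sum_(i < d) r)).
    apply: ler_sum => i _; have := xr i; rewrite tnth_mktuple subr0 => xir.
    rewrite -real_normK ?num_real//.
    have r1 : r <= 1 by rewrite invf_le1// ler1n.
    rewrite expr2 (le_trans (ler_pM _ _ xir (le_trans xir r1)))// mulr1//.
  by rewrite sumr_const card_ord -[_ *+ d]mulr_natl ltr_pdivrMr// mul1r ltr_nat.
have sub2 : eball o 1 `<=` cube o 1.
  move=> x; rewrite /eball /= esubo => x1 i; rewrite tnth_mktuple subr0.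
  by rewrite (le_trans (le_coord_enorm x i))// ltW.
have lt_oo : (leb d (eball o (1 : R)) < +oo)%E.
  apply: (@le_lt_trans _ _ (leb d (cube o (1 : R)))).
    by apply: le_measure; rewrite ?inE//; exact: measurable_cube.
  by rewrite leb_cube// ltry.
rewrite fine_gt0// lt_oo andbT; apply: (@lt_le_trans _ _ (leb d (cube o r))).
  by rewrite leb_cube// lte_fin exprn_gt0// mulr_gt0.
by apply: le_measure; rewrite ?inE//; exact: measurable_cube.
Qed.

Variables (mu : probability (d.-tuple R) R) (p : \bar R) (g : d.-tuple R -> R).
Hypothesis p_gt1 : (1 < p)%E.
Hypothesis g_Lp : g \in Lfun (leb d) p.
Hypothesis mu_density : forall A, measurable A ->
  mu A = (\int[leb d]_(x in A) (g x)%:E)%E.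
Let p' := fine (hoelder_conjugate p).
Let ng := fine ('N[leb d]_p[EFin \o g])%E.

Lemma cube_measure_le y (r : R) : 0 < r ->
  (mu (cube y (4 * r)) <= (ng * ((8 ^+ d) `^ p'^-1 * r `^ (d%:R / p')))%:E)%E.
Proof.
move=> r0; have mc := measurable_cube y (4 * r).
have lc : leb d (cube y (4 * r)) = ((8 * r) ^+ d)%:E.
  by rewrite leb_cube ?mulr_gt0//; congr ((_ ^+ d)%:E); ring.
rewrite mu_density//.
have := density_le leb_setT_gt0 p_gt1 g_Lp mc lc.
rewrite -/ng -/p' exprMn powRM ?exprn_ge0//; last exact: ltW.
by rewrite -[r ^+ d]powR_mulrn ?(ltW r0)// -powRrM.
Qed.

(** [X] lies in a cube, so a zero norm would make [cube_measure_le] read 1 <= 0. Positivity makes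
    [Cmu] a legitimate divisor. *)
Lemma density_norm_gt0 (X : set (d.-tuple R)) :
  measurable X -> ebounded X -> mu X = 1%E -> 0 < ng.
Proof.
move=> mX [M XM] muX.
have Xc : X `<=` cube [tuple 0 | i < d] (4 * (`|M| + 1)).
  move=> x /XM xM i; rewrite tnth_mktuple subr0 (le_trans (le_coord_enorm x i))//.
  rewrite (le_trans xM)// (le_trans (ler_norm M))//.
  by have := normr_ge0 M; lra.
have M0 : 0 < `|M| + 1 by rewrite ltr_wpDl.
have : (1%:E <= (ng * ((8 ^+ d) `^ p'^-1 * (`|M| + 1) `^ (d%:R / p')))%:E)%E.
  rewrite -muX; apply: le_trans (cube_measure_le [tuple 0 | i < d] M0).
  by apply: le_measure; rewrite ?inE//; exact: measurable_cube.
have ng0 : 0 <= ng by rewrite fine_ge0// Lnorm_ge0.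
rewrite lt_def ng0 andbT lee_fin => h; apply/eqP => ng00.
by move: h; rewrite ng00 mul0r leNgt ltr01.
Qed.

End constants.

(** * From failure probabilities to the probabilistic conclusions *)

Section probability_conclusion.
Context {R : realType} {d0 : measure_display} {Omega : measurableType d0}.
Variables (P : probability Omega R) (good : nat -> set Omega) (Pn : nat -> R).
Variables (alpha alpha0 Ca Cb : R).
Hypothesis good_meas : forall n, measurable (good n).
Hypothesis Pn_ge0 : forall n, 0 <= Pn n.
Hypothesis Ca_ge0 : 0 <= Ca.
Hypothesis Cb_ge0 : 0 <= Cb.
Hypothesis bad_le : \forall n \near \oo,
  (P (~` good n) <= (Ca * n%:R `^ (- alpha0) + Cb * n%:R `^ (- alpha))%:E)%E.

Lemma product_probability_bound : exists a b : nat -> R,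
  [/\ a =O_\oo (fun n => n%:R `^ (- alpha0)),
      b =O_\oo (fun n => n%:R `^ (- alpha)) &
      forall n, (((1 - a n) * (1 - b n) * (1 - Pn n))%:E <= P (good n))%E].
Proof.
have [N0 _ badN] := bad_le.
(* Capping at 1 makes the product zero, hence the claim trivial, for small [n] and wherever the
   doubled bounds are too large. *)
pose u (C c : R) n := if (n < N0)%N then 1 else Num.min 1 (2 * C * n%:R `^ (- c)).
have uO C c : 0 <= C -> u C c =O_\oo (fun n => n%:R `^ (- c)).
  move=> C0; apply/eqO_exP; exists (2 * C + 1); first by rewrite ltr_wpDl// mulr_ge0.
  exists N0 => // n /= N0n; rewrite /u ltnNge N0n/=.
  have x0 : 0 <= n%:R `^ (- c) :> R by exact: powR_ge0.
  rewrite (ger0_norm x0) ger0_norm; last by rewrite le_min ler01 !mulr_ge0.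
  by rewrite ge_min ler_wpM2r ?orbT// lerDl.
exists (u Ca alpha0), (u Cb alpha); split; [exact: uO|exact: uO|] => n.
have P0 : (0 <= P (good n))%E by exact: measure_ge0.
rewrite /u; case: ltnP => [_|N0n]; first by rewrite subrr !mul0r.
have := badN n N0n; set x := Ca * _; set y := Cb * _ => Pxy.
have x0 : 0 <= x by rewrite mulr_ge0// powR_ge0.
have y0 : 0 <= y by rewrite mulr_ge0// powR_ge0.
have [x1|x1] := leP 1 (2 * Ca * n%:R `^ (- alpha0)); first by rewrite subrr !mul0r.
have [y1|y1] := leP 1 (2 * Cb * n%:R `^ (- alpha)); first by rewrite subrr mulr0 mul0r.
rewrite -!mulrA -/x -/y in x1 y1 *.
have PC : (P (~` good n) = 1 - P (good n))%E by exact: probability_setC.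
have Pfin : P (good n) \is a fin_num.
  by rewrite ge0_fin_numE// (le_lt_trans (probability_le1 P (good_meas n)))// ltry.
apply: (@le_trans _ _ (1 - x - y)%:E).
  rewrite lee_fin mulrA -[leRHS]mulr1.
  have h : 0 <= (1 - 2 * x) * (1 - 2 * y) by rewrite mulr_ge0// subr_ge0 ltW.
  apply: (@le_trans _ _ ((1 - 2 * x) * (1 - 2 * y))).
    by rewrite ler_piMr// gerBl.
  rewrite mulr1.
  have h2 : 0 <= (1 - 2 * x) * y by rewrite mulr_ge0// subr_ge0 ltW.
  have h3 : 0 <= (1 - 2 * y) * x by rewrite mulr_ge0// subr_ge0 ltW.
  by move: h2 h3; nra.
move: Pxy; rewrite PC -(fineK Pfin) -EFinB !lee_fin; lra.
Qed.

Lemma bad_cvg0 : 0 < alpha -> 0 < alpha0 ->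
  (fun n => P (~` good n)) @ \oo --> 0%E.
Proof.
move=> al al0.
apply: (@squeeze_cvge _ _ _ _ (cst 0%E) _
  (fun n => (Ca * n%:R `^ (- alpha0) + Cb * n%:R `^ (- alpha))%:E)).
- by apply: filterS bad_le => n ->; rewrite measure_ge0.
- exact: cvg_cst.
- apply: cvg_EFin; first exact: nearW.
  rewrite (_ : fine \o _ = fun n => Ca * n%:R `^ (- alpha0) + Cb * n%:R `^ (- alpha))//.
  have h : (fun n => Ca * n%:R `^ (- alpha0) + Cb * n%:R `^ (- alpha)) @ \oo -->
      (Ca * 0 + Cb * 0 : R).
    by apply: cvgD; apply: cvgMr; exact: cvg_powR_neg.
  by rewrite !mulr0 addr0 in h.
Qed.

End probability_conclusion.

Lemma bigmin_ltP (R : realType) (I : finType) (Q : pred I) (F : I -> \bar R) (x : R) :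
  (\big[Order.min/+oo]_(i | Q i) F i < x%:E)%E <->
  exists2 i, Q i & (F i < x%:E)%E.
Proof.
split.
  elim/big_rec: _ => [//|i y Qi IH]; rewrite gt_min => /orP[Fi|/IH //].
  by exists i.
move=> [i Qi Fix]; apply: le_lt_trans Fix.
by rewrite (bigD1 i)//= ge_min lexx.
Qed.

Section separation_event.
Context {R : realType} {d : nat} {d0 : measure_display} {Omega : measurableType d0}.
Let T := d.-tuple R.
Variables (X : set T) (k : T -> T -> R) (tau : T).
Hypothesis X_bounded : ebounded X.
Hypothesis tau_gt0 : forall i, 0 < tnth tau i.
Hypothesis k_eq1 : forall x z, X x -> X z ->
  (k x z = 1 <-> exists a : d.-tuple int, esub x z = lattice_pt tau a).
Variables (mu : probability T R) (P : probability Omega R).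
Variables (xs : nat -> {RV P >-> T}) (ys : nat -> {RV P >-> R}).
Hypothesis xs_mu : forall i A, measurable A -> P (xs i @^-1` A) = mu A.
Hypothesis indep : mutually_independent P (fun i w => (xs i w, ys i w)).

(** The event is contained in the union treated by [separation_fail]. Monotonicity of [P] requires
    the event itself to be measurable, which [measurable_dist_lt] supplies. *)
Lemma separation_event_le n (delta cU : R) : 0 < delta ->
  (forall z, (mu (near_spike X tau delta z) <= cU%:E)%E) ->
  (P [set w | (separation X k (fun i => xs i w) n < delta%:E)%E] <=
   ((n * n)%:R * cU)%:E)%E.
Proof.
move=> delta0 mu_near.
have mA : measurable [set p : T * T | near_spike X tau delta p.1 p.2].
  have := measurable_near_spike X tau delta.
  move=> /(@measurable_swap _ _ T T measurableT); rewrite setTI.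
  by congr measurable.
have mxx i j := measurable_fun_pair (measurable_funP (xs i)) (measurable_funP (xs j)).
apply: le_trans (separation_fail xs_mu indep n mA mu_near).
have sepE : [set w | (separation X k (fun i => xs i w) n < delta%:E)%E] =
    \big[setU/set0]_(ij : 'I_n * 'I_n | (ij.1 < ij.2)%N)
      [set w | (dist_spike X k (xs ij.1 w, xs ij.2 w) < delta%:E)%E].
  apply/seteqP; split => w /=; rewrite /separation.
    by move=> /bigmin_ltP[ij ij1 ij2]; apply/fin_bigsetUP; exists ij.
  by move=> /fin_bigsetUP[ij ij1 ij2]; apply/bigmin_ltP; exists ij.
apply: le_measure; rewrite ?inE.
- rewrite sepE; apply: bigsetU_measurable => -[i j] _ /=.
  rewrite (_ : [set w | _] = (fun w => (xs i w, xs j w)) @^-1`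
      [set p | exists2 q, spike X k q & edist2 p q < delta]).
    by have := mxx i j measurableT _ (measurable_dist_lt (spike X k) delta); rewrite setTI.
  apply/seteqP; split => w /=.
    by move=> /ereal_inf_lt[_ [q Xq <-]]; rewrite lte_fin => qd; exists q.
  move=> [q Xq qd]; apply: (@le_lt_trans _ _ (edist2 (xs i w, xs j w) q)%:E).
    by apply: ereal_inf_lbound; exists q.
  by rewrite lte_fin.
- apply: bigsetU_measurable => -[i j] _ /=.
  by have := mxx i j measurableT _ mA; rewrite setTI.
rewrite sepE => w /fin_bigsetUP[[i j] /= ij wij]; apply/fin_bigsetUP.
(* The order is reversed because [near_spike] takes the centre, the second point of the pair, as its
   first argument. *)
exists (j, i); first by rewrite /= gt_eqF.
exact: (dist_spike_near X_bounded tau_gt0 k_eq1 delta0 (ltW wij)).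
Qed.

End separation_event.

(** * Choice of the constants and conclusion *)

Theorem theoremD1 (R : realType) (d m : nat) (d_gt0 : (0 < d)%N)
    (X : set (d.-tuple R)) (X_bounded : ebounded X) (X_meas : measurable X)
    (k : d.-tuple R -> d.-tuple R -> R)
    (k_quantum : quantum_fidelity_kernel X m k)
    (k_meas : forall z, X z -> measurable_fun X (fun x => k x z))
    (tau : d.-tuple R) (tau_gt0 : forall i, 0 < tnth tau i)
    (k_periodic : translation_invariant_periodic X tau k)
    (k_eq1 : forall x z, X x -> X z ->
       (k x z = 1 <-> exists a : d.-tuple int, esub x z = lattice_pt tau a))
    (mu : probability (d.-tuple R) R) (mu_X : mu X = 1%E)
    (mu_full : forall x t, X x -> 0 < t -> (0 < mu (eball x t))%E)
    (p : \bar R) (p_gt1 : (1 < p)%E) (g : d.-tuple R -> R)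
    (g_L1 : g \in Lfun (leb d) 1%E) (g_Lp : g \in Lfun (leb d) p)
    (mu_density : forall A, measurable A ->
       mu A = (\int[leb d]_(x in A) (g x)%:E)%E)
    (H : set (X -> R)) (ip : (X -> R) -> (X -> R) -> R)
    (H_rkhs : is_rkhs (fun x z : X => k (val x) (val z)) H ip)
    (fstar : d.-tuple R -> R) (fstar_H : H (fun x : X => fstar (val x)))
    (d0 : measure_display) (Omega : measurableType d0) (P : probability Omega R)
    (xs : nat -> {RV P >-> d.-tuple R}) (ys : nat -> {RV P >-> R})
    (xs_X : forall i w, X (xs i w))
    (xs_mu : forall i A, measurable A -> P (xs i @^-1` A) = mu A)
    (indep : mutually_independent P (fun i w => (xs i w, ys i w)))
    (ident : identically_distributed P (fun i w => (xs i w, ys i w)))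
    (sigma : R)
    (eps_mean : forall i, is_cond_expectation P (xs i)
       (fun w => ys i w - fstar (xs i w)) (cst 0))
    (eps_var : forall i, is_cond_expectation P (xs i)
       (fun w => (ys i w - fstar (xs i w)) ^+ 2) (cst (sigma ^+ 2)))
    (alpha alpha0 : R) (alpha_gt0 : 0 < alpha)
    (alpha0_gt0 : 0 < alpha0) (alpha0_lt1 : alpha0 < 1)
    (delta rho : nat -> R) (q : nat -> nat) (c : R)
    (delta_gt0 : forall n, (0 < n)%N -> 0 < delta n)
    (rho_gt0 : forall n, (0 < n)%N -> 0 < rho n)
    (q_gt0 : forall n, (0 < n)%N -> (0 < q n)%N) :
  let p' : R := fine (hoelder_conjugate p) in
  let beta : R := d%:R / p' in
  let mdelta (n : nat) : R := off_spike_sup X k (delta n) in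
  delta =o_\oo (fun n => n%:R `^ (- ((2 + alpha) / beta))) ->
  (fun n => rho n * n%:R `^ alpha0) @ \oo --> (0 : R) ->
  (fun n => rho n * n%:R) @ \oo --> +oo ->
  (6 + alpha) / 2 < c ->
  (forall n, (0 < n)%N -> mdelta n < 1) ->
  (forall n, (0 < n)%N -> c * ln n%:R / - ln (mdelta n) <= (q n)%:R) ->
  let Pn (n : nat) : R :=
    fine (P [set w | (separation X k (fun i => xs i w) n < (delta n)%:E)%E]) in
  let risk (n : nat) (w : Omega) : \bar R :=
    (\int[mu]_(x in X)
       (`| ridgeless (spiked_kernel k (rho n) (q n)) n
             (fun i => xs i w) (fun i => ys i w) x - fstar x | ^+ 2)%:E)%E in
  let normf : R := rkhs_norm ip (fun x : X => fstar (val x)) in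
  let Cy : R := \int[mu]_(x in X) (fstar x ^+ 2) + sigma ^+ 2 in
  let vd : R := fine (leb d (eball [tuple 0 | i < d] 1)) in
  let Cmu : R := (lattice_count X tau)%:R
    * fine ('N[leb d]_p[EFin \o g])%E
    * (vd * Num.sqrt 2 ^+ d) `^ (p'^-1) in
  let B0 (n : nat) : R :=
    2 * sigma ^+ 2 * 4 ^+ m * n%:R `^ (alpha0 - 1) * (1 + (rho n * n%:R)^-1)
    + 2 * normf ^+ 2 * rho n * n%:R `^ alpha0
      * (1 + (rho n * n%:R)^-1) ^+ 2 in
  let B1 (n : nat) : R :=
    4 * Cy * (n%:R `^ (4 + alpha) * mdelta n ^+ (2 * q n)
      / (rho n ^+ 2 * (1 - n%:R * mdelta n ^+ q n) ^+ 2)) in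
  let B2 (n : nat) : R :=
    4 * Cy * (n%:R `^ (2 + alpha)
        * (Cmu * delta n `^ beta + mdelta n ^+ (2 * q n))
      / (1 - n%:R * mdelta n ^+ q n) ^+ 2) in
  [/\ Pn @ \oo --> (0 : R),
      exists a b : nat -> R,
        [/\ a =O_\oo (fun n => n%:R `^ (- alpha0)),
            b =O_\oo (fun n => n%:R `^ (- alpha)) &
            forall n, (0 < n)%N ->
              (((1 - a n) * (1 - b n) * (1 - Pn n))%:E <=
               P [set w | risk n w <= (B0 n + B1 n + B2 n)%:E])%E],
      [/\ B0 @ \oo --> (0 : R), B1 @ \oo --> (0 : R) & B2 @ \oo --> (0 : R)] &
      forall e : R, 0 < e ->
        (fun n => P [set w | (e%:E < risk n w)%E]) @ \oo --> 0%E].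

Proof.
move=> p' beta mdelta delta_o rho_n0 rho_ny c_gt md1 qn Pn risk normf Cy vd Cmu B0 B1 B2.
have [N [phi kE]] := fidelity_features k_quantum.
have k_ge0 x z : X x -> X z -> 0 <= k x z.
  by case: k_quantum => U [_ kU] Xx Xz; rewrite kU// sqr_ge0.
have k_diag x : X x -> k x x = 1.
  move=> Xx; apply/k_eq1 => //; exists [tuple 0 | i < d].
  by apply: eq_from_tnth => i; rewrite !tnth_mktuple subrr mulr0.
have k01 x z : X x -> X z -> 0 <= k x z <= 1.
  by move=> Xx Xz; rewrite k_ge0//= (feature_kernel_le1 kE k_ge0 k_diag).
have X0 : X !=set0.
  apply/set0P/eqP => XE; move: mu_X; rewrite XE measure0 => /eqP.
  by rewrite eqe eq_sym oner_eq0.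
have p'0 : 0 < p' by exact: hoelder_conjugate_fin.
have beta0 : 0 < beta by rewrite divr_gt0// ltr0n.
pose ft := patched_function X fstar.
pose kt := patched_kernel X k.
have mkt z : measurable_fun setT (kt ^~ z).
  exact: (measurable_patched_kernel1 X_meas k_meas).
have kt01 x z : 0 <= kt x z <= 1 by exact: (patched_kernel_itv kE k_ge0 k_diag).
(* The skeleton of all of [X] writes [ft] as a finite combination of kernel sections, which are
   measurable and bounded. *)
have [mft ftM] : measurable_fun setT ft /\ exists M, forall x, `|ft x| <= M.
  have [r [W [WX _ kW]]] := patched_kernel_skeleton kE (@subset_refl _ X).
  have ftW := patched_function_interpolation H_rkhs fstar_H (@subset_refl _ X) WX kW.
  set M := invmx _ in ftW.
  have ftE : ft = fun x => \sum_b (\sum_a kt x (W a) * M a b) * ft (W b).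
    apply/funext => x; have [xX|xX] := boolP (x \in X).
      by apply: ftW; exact/set_mem.
    rewrite /ft /patched_function (negbTE xX) big1// => b _.
    rewrite big1 ?mul0r// => a _.
    by rewrite /kt /patched_kernel (negbTE xX) mul0r.
  split.
    rewrite ftE; apply: measurable_sum => b; apply: measurable_funM => //.
    by apply: measurable_sum => a; apply: measurable_funM.
  exists (\sum_b (\sum_a `|M a b|) * `|ft (W b)|) => x; rewrite {1}ftE.
  apply: (le_trans (ler_norm_sum _ _ _)); apply: ler_sum => b _.
  rewrite normrM ler_wpM2r//; apply: (le_trans (ler_norm_sum _ _ _)).
  apply: ler_sum => a _; have /andP[h0 h1] := kt01 x (W a).
  by rewrite normrM ger0_norm// ler_piMl.
have [Xr [s [Z [[XrX mXr] muXr ZX [uG kZ] uS]]]] :=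
  regression_basis X_meas k_meas kE k_ge0 k_diag mu_X.
set G := \matrix_(a, b) _ in uG kZ.
set S := second_moment _ _ in uS.
have ftZ := patched_function_interpolation H_rkhs fstar_H XrX ZX kZ.
pose cc : 'cV[R]_s := invmx G *m \col_b ft (Z b).
have ftc x : Xr x -> ft x = \sum_a kt x (Z a) * cc a 0.
  move=> Xx; rewrite [LHS](ftZ _ Xx).
  under eq_bigr do rewrite mulr_suml; rewrite exchange_big/=.
  apply: eq_bigr => a _; rewrite mxE mulr_sumr; apply: eq_bigr => b _.
  by rewrite mxE mulrA.
have Gc : G *m cc = \col_b ft (Z b) by rewrite mulKVmx.
(* The entries of G c are the values of [ft] at the basis points, so [gamma] bounds the bias and
   vanishes when [fstar] does. *)
pose gamma : R := \sum_a `|ft (Z a)|.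
have gamma0 : 0 <= gamma by exact: sumr_ge0.
have bias_le a : `|(G *m cc) a 0| <= gamma.
  by rewrite Gc mxE /gamma (bigD1 a)//= lerDl; exact: sumr_ge0.
pose L : R := \sum_(ab : 'I_s * 'I_s) `|invmx S ab.1 ab.2|.
have L0 : 0 <= L by exact: sumr_ge0.
have S_le a b : `|invmx S a b| <= L.
  by rewrite /L (bigD1 (a, b))//= lerDl; exact: sumr_ge0.
(* The largest admissible size of the perturbation of [S], up to the 1 that avoids a division by
   zero. *)
pose h : R := (2 * (s%:R * s%:R * L + 1))^-1.
have sL0 : 0 <= s%:R * s%:R * L by rewrite !mulr_ge0.
have h0 : 0 < h by rewrite invr_gt0; lra.
have Lh_le : s%:R * s%:R * L * h <= 2^-1.
  by rewrite ler_pdivrMr; lra.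
have normf0 : 0 <= normf by exact: sqrtr_ge0.
have gamma_normf : normf = 0 -> gamma = 0.
  move=> /(patched_function_eq0 H_rkhs fstar_H) f0; rewrite /gamma big1// => a _.
  by rewrite [ft _]f0 normr0.
pose ng : R := fine ('N[leb d]_p[EFin \o g])%E.
have ng0 : 0 < ng by exact: (density_norm_gt0 p_gt1 g_Lp mu_density X_meas X_bounded mu_X).
have lc0 := lattice_count_gt0 X_bounded tau_gt0 X0.
(* A cube of half-side 4 delta has volume 8^d delta^d, and [near_spike] is a union of
   [lattice_count X tau] cubes. *)
pose C' : R := (lattice_count X tau)%:R * (ng * (8 ^+ d) `^ p'^-1).
have C'0 : 0 < C' by rewrite mulr_gt0 ?ltr0n// mulr_gt0// powR_gt0// exprn_gt0.
have Cmu0 : 0 < Cmu.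
  have vd0 : 0 < vd by exact: leb_unit_ball_gt0.
  by rewrite mulr_gt0 ?powR_gt0 ?mulr_gt0 ?ltr0n ?exprn_gt0 ?sqrtr_gt0.
pose cU n : R := C' * delta n `^ beta.
have cU0 n : 0 <= cU n by rewrite mulr_ge0 ?powR_ge0// ltW.
have mu_near n z : (0 < n)%N -> (mu (near_spike X tau (delta n) z) <= (cU n)%:E)%E.
  move=> n0; rewrite /cU /C' -mulrA; apply: near_spike_le => y; rewrite -mulrA.
  exact: (cube_measure_le p_gt1 g_Lp mu_density y (delta_gt0 _ n0)).
pose E n : R := mdelta n ^+ q n.
have md0 n : 0 <= mdelta n by exact: off_spike_sup_ge0.
have E0 n : 0 <= E n by exact: exprn_ge0.
have c0 : 0 < c by move: alpha_gt0 c_gt; lra.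
have E_le n : (0 < n)%N -> E n <= n%:R `^ (- c).
  by move=> n0; apply: powR_nat_eta => //; rewrite ?md0 ?md1 ?q_gt0 ?qn.
have EE n : mdelta n ^+ (2 * q n) = E n ^+ 2 by rewrite mulnC exprM.
have cB0 : B0 @ \oo --> (0 : R).
  exact: (cvg_B0 alpha0_lt1 rho_gt0 rho_n0 rho_ny (2 * sigma ^+ 2 * 4 ^+ m)
    (2 * normf ^+ 2)).
have cB1 : B1 @ \oo --> (0 : R).
  have := cvg_B1 alpha_gt0 c_gt rho_gt0 rho_ny E0 E_le (4 * Cy).
  by rewrite /B1; under eq_fun do rewrite -EE.
have cB2 : B2 @ \oo --> (0 : R).
  have := cvg_B2 alpha_gt0 beta0 c_gt delta_gt0 delta_o E0 E_le (4 * Cy) Cmu.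
  by rewrite /B2; under eq_fun do rewrite -EE.
pose good n := [set w | (risk n w <= (B0 n + B1 n + B2 n)%:E)%E].
have mrisk n : measurable_fun setT (risk n).
  exact: (measurable_risk_fun X_meas k_meas kE mu ys xs_X mft).
have mgood n : measurable (good n).
  by have := emeasurable_fun_infty_c measurableT (mrisk n)
    (B0 n + B1 n + B2 n)%:E; rewrite setTI.
have Cy0 : 0 <= Cy.
  by rewrite addr_ge0 ?sqr_ge0// Rintegral_ge0// => x _; exact: sqr_ge0.
(* The error constants [K0] and [K1] of the kernel are moved into the Markov
   thresholds [t1] and [t2], hence into the constants of the probability bounds. *)
pose K0 : R := 24 * s%:R ^+ 4 * L ^+ 2.
have K00 : 0 <= K0 by rewrite !mulr_ge0 ?sqr_ge0 ?exprn_ge0.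
pose K1 : R := C' / Cmu.
have K10 : 0 <= K1 by rewrite divr_ge0// ltW.
pose t1 : R := (K0 + 1)^-1.
pose t2 : R := (K0 + K1 + 1)^-1.
have K01 : 0 < K0 + 1 by rewrite ltr_wpDl.
have t10 : 0 < t1 by rewrite invr_gt0.
have K011 : 0 < K0 + K1 + 1 by rewrite ltr_wpDl// addr_ge0.
have t20 : 0 < t2 by rewrite invr_gt0.
(* [Ca] collects the failures of moments and noise, [Cb] those of separation and labels. *)
pose Ca : R := s%:R * s%:R * ((h / 2) ^+ 2)^-1 + s%:R / t1.
pose Cb : R := C' + 2 / t2.
have Ca0 : 0 <= Ca.
  apply: addr_ge0; first by apply: divr_ge0; [exact: mulr_ge0|exact: sqr_ge0].
  by apply: divr_ge0; last exact: ltW.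
have Cb0 : 0 <= Cb by rewrite addr_ge0 ?(ltW C'0)// divr_ge0// ltW.
have bad_le : \forall n \near \oo,
    (P (~` good n) <= (Ca * n%:R `^ (- alpha0) + Cb * n%:R `^ (- alpha))%:E)%E.
  have rho_small e : 0 < e -> \forall n \near \oo, rho n <= e.
    move=> e0; have /cvgrPdist_le/(_ _ e0) := cvg_rho alpha0_gt0 rho_gt0 rho_n0.
    by apply: filterS => n; rewrite sub0r normrN; apply: le_trans; exact: ler_norm.
  (* When the norm is zero the right-hand side is zero for every [n], and smallness of [rho] is of
     no help; there [gamma] itself vanishes. *)
  have bias_small : \forall n \near \oo, K0 * rho n * gamma ^+ 2 <= 2 * normf ^+ 2.
    have [/gamma_normf ->|nf0] := eqVneq normf 0.
      by apply: nearW => n; rewrite expr0n mulr0 mulr_ge0 ?sqr_ge0.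
    have nf2 : 0 < 2 * normf ^+ 2 by rewrite mulr_gt0// exprn_even_gt0.
    have Kg : 0 < K0 * gamma ^+ 2 + 1 by rewrite ltr_wpDl// mulr_ge0 ?sqr_ge0.
    have [N0 _ hN0] := rho_small _ (divr_gt0 nf2 Kg).
    exists N0.+1 => // n /= N0n; have := hN0 n (ltnW N0n).
    have r0 := rho_gt0 _ (leq_ltn_trans (leq0n N0) N0n).
    rewrite ler_pdivlMr//; rewrite mulrDr mulr1 mulrCA mulrA.
    by apply: le_trans; rewrite lerDl ltW.
  near=> n.
  have n0 : (0 < n)%N by near: n; exact: nbhs_infty_gt.
  have nR : 0 < n%:R :> R by rewrite ltr0n.
  have n1 : 1 <= n%:R :> R by rewrite ler1n.
  have nE1 : n%:R * E n < 1.
    near: n.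
    have /cvgrPdist_lt/(_ 1 ltr01) := cvg_nE alpha_gt0 c_gt E0 E_le.
    by apply: filterS => n; rewrite sub0r normrN; apply: le_lt_trans; exact: ler_norm.
  have rho_h : rho n <= h / 2 by near: n; apply: rho_small; rewrite divr_gt0.
  have bias_n : K0 * rho n * gamma ^+ 2 <= 2 * normf ^+ 2 by near: n.
  have delta_n : delta n `^ beta <= 1 * n%:R `^ (- (2 + alpha)).
    by near: n; exact: (near_delta_le beta0 delta_gt0 delta_o).
  rewrite mul1r in delta_n.
  pose a0 : R := n%:R `^ alpha0; pose a : R := n%:R `^ alpha.
  have a00 : 0 < a0 by rewrite powR_gt0.
  have aa0 : 0 < a by rewrite powR_gt0.
  have rhoG a' b' : `|n%:R^-1 * rho n * G a' b'| <= h / 2.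
    have r0 := rho_gt0 _ n0.
    have ir : 0 <= n%:R^-1 * rho n by rewrite mulr_ge0 ?invr_ge0 ?(ltW r0).
    rewrite normrM (ger0_norm ir) mxE.
    have /andP[g0 g1] := kt01 (Z a') (Z b').
    rewrite (ger0_norm g0); apply: le_trans rho_h.
    rewrite (@le_trans _ _ (n%:R^-1 * rho n))//; first by rewrite ler_piMr.
    by rewrite ler_piMl ?(ltW r0)// invf_le1.
  (* With thresholds proportional to n n^alpha0 for the noise and n n^alpha for the labels, Markov's
     bounds become multiples of n^-alpha0 and n^-alpha. *)
  have T1 : 0 < t1 * (n%:R * a0) by rewrite !mulr_gt0.
  have T2 : 0 < t2 * (n%:R * a) by rewrite !mulr_gt0.
  have := bad_event_le X_bounded X_meas k_meas tau_gt0 k_eq1 kE k_ge0 k_diag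
    xs_X xs_mu indep eps_mean eps_var XrX mXr muXr uG kZ uS mft ftM ftc n0
    (rho_gt0 _ n0) (delta_gt0 _ n0) nE1 L0 S_le h0 Lh_le rhoG gamma0 bias_le
    (fun z => mu_near _ z n0) T1 T2.
  set BB := (X in (X%:E)%E); set bad := ~` _.
  have mbad : measurable bad.
    apply: measurableC.
    by have := emeasurable_fun_infty_c measurableT (mrisk n) BB%:E; rewrite setTI.
  have BB_le : BB <= B0 n + B1 n + B2 n.
    have w0 : 0 < (1 - n%:R * E n) ^+ 2 by rewrite exprn_gt0// subr_gt0.
    (* The estimate is already reached by [B0 n + B2 n]; [B1 n] is added as a nonnegative term. *)
    have B10 : 0 <= B1 n.
      rewrite /B1 EE; apply: mulr_ge0; first exact: mulr_ge0.
      by apply: divr_ge0; apply: mulr_ge0; rewrite ?powR_ge0 ?sqr_ge0.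
    have B0E : B0 n = 2 * sigma ^+ 2 * 4 ^+ m * (a0 / n%:R) * (1 + (rho n * n%:R)^-1)
        + 2 * normf ^+ 2 * rho n * a0 * (1 + (rho n * n%:R)^-1) ^+ 2.
      by rewrite /B0 natr_powRD// powR_inv1// ltW.
    have B2E : B2 n = 4 * Cy * (n%:R ^+ 2 * a * (Cmu * delta n `^ beta + E n ^+ 2) /
        (1 - n%:R * E n) ^+ 2).
      by rewrite /B2 EE natr_powRD// [n%:R `^ 2]powR_mulrn ?ltW.
    have a01 : 1 <= a0.
      by have := ler_powR n1 (ltW alpha0_gt0); rewrite powRr0.
    have M41 : 1 <= 4 ^+ m :> R by rewrite exprn_ege1// ler1n.
    have Kt1 : K0 * t1 <= 1 by rewrite ler_pdivrMr// mul1r lerDl.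
    have Kt2 : K0 * t2 <= 1 by rewrite ler_pdivrMr// mul1r -addrA lerDl addr_ge0.
    have t21 : t2 <= 1 by rewrite invf_le1// lerDr addr_ge0.
    (* The ratio [K1] of the cube constant to [Cmu] is cancelled by [t2]. *)
    have tcU : t2 * cU n <= Cmu * delta n `^ beta.
      rewrite mulrA; apply: ler_wpM2r; first exact: powR_ge0.
      rewrite mulrC ler_pdivrMr//.
      have -> : C' = Cmu * K1 by rewrite /K1 mulrC divfK// gt_eqF.
      apply: ler_wpM2l; first exact: ltW.
      by rewrite -addrA addrCA lerDl addr_ge0.
    have cm0 : 0 <= Cmu * delta n `^ beta by rewrite mulr_ge0 ?powR_ge0// ltW.
    have := error_bound_le (E n) n1 a01 (ltW aa0) K00 (ltW t10) (ltW t20) (sqr_ge0 sigma)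
      (sqr_ge0 gamma) (sqr_ge0 normf) (rho_gt0 _ n0) M41 Cy0 w0 Kt1 Kt2 t21 tcU cm0
      bias_n.
    rewrite -B0E -B2E => H'; apply: (le_trans H').
    by rewrite [leRHS]addrAC -[leLHS]addr0 lerD2l.
  have bad_sub : ~` good n `<=` bad.
    move=> w /=; apply: contra_not => H'; apply: (le_trans H').
    by rewrite lee_fin.
  have Pbad : (P (~` good n) <= P bad)%E.
    by apply: le_measure => //; rewrite inE//; exact: measurableC.
  move=> /(le_trans Pbad) H'; apply: (le_trans H'); rewrite lee_fin.
  have xE : n%:R `^ (- alpha0) = a0^-1 by rewrite powRN.
  have yE : n%:R `^ (- alpha) = a^-1 by rewrite powRN.
  rewrite xE yE /Ca /Cb.
  (* The n^2 pairs are compensated by delta^beta <= n^-(2 + alpha). *)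
  have e1 : (n * n)%:R * cU n <= C' / a.
    rewrite natrM /cU mulrCA ler_wpM2l ?(ltW C'0)//.
    rewrite (le_trans (ler_wpM2l _ delta_n))// powRN natr_powRD//.
    rewrite [n%:R `^ 2]powR_mulrn ?(ltW nR)// -/a.
    by rewrite le_eqVlt; apply/orP; left; apply/eqP; field; rewrite !gt_eqF.
  have e2 : 2 * n%:R / (t2 * (n%:R * a)) = 2 / t2 / a.
    by field; rewrite !gt_eqF.
  have e3 : s%:R * (n%:R / (t1 * (n%:R * a0))) = s%:R / t1 / a0.
    by field; rewrite !gt_eqF.
  (* The moments fail with probability O(1 / n), which is O(n^-alpha0) because alpha0 < 1. *)
  have e4 : (s * s)%:R / (n%:R * (h / 2) ^+ 2) <= s%:R * s%:R / (h / 2) ^+ 2 / a0.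
    have H2 : 0 < (h / 2) ^+ 2 by rewrite exprn_gt0// divr_gt0.
    move: H2; move: ((h / 2) ^+ 2) => H2 H20.
    rewrite natrM -[leRHS]mulrA -invfM [n%:R * _]mulrC.
    apply: ler_wpM2l; first exact: mulr_ge0.
    rewrite lef_pV2 ?posrE; [|exact: mulr_gt0|exact: mulr_gt0].
    apply: ler_wpM2l; first exact: ltW.
    by rewrite /a0 -[leRHS]powRr1 ?(ltW nR)// ler_powR// ltW.
  rewrite e2 e3 [leRHS]addrC !mulrDl; move: e1 e4; lra.
have Pn0 n : 0 <= Pn n by rewrite fine_ge0.
split.
- apply: (@squeeze_cvgr _ _ _ _ (cst 0) (fun n => C' * n%:R `^ (- alpha))).
  + near=> n.
    have n0 : (0 < n)%N by near: n; exact: nbhs_infty_gt.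
    have nR : 0 < n%:R :> R by rewrite ltr0n.
    have delta_n : delta n `^ beta <= 1 * n%:R `^ (- (2 + alpha)).
      by near: n; exact: (near_delta_le beta0 delta_gt0 delta_o).
    rewrite mul1r in delta_n.
    have sep := separation_event_le X_bounded tau_gt0 k_eq1 xs_mu indep n
      (delta_gt0 _ n0) (fun z => mu_near _ z n0).
    rewrite Pn0/=; apply: (le_trans (fine_le _ _ sep)) => //=.
      by rewrite ge0_fin_numE// (le_lt_trans sep)// ltry.
    rewrite natrM /cU mulrCA ler_wpM2l ?(ltW C'0)//.
    rewrite (le_trans (ler_wpM2l _ delta_n))// opprD natr_powRD// [n%:R `^ (- 2)]powRN.
    rewrite [n%:R `^ 2]powR_mulrn ?(ltW nR)// mulrA -expr2 divff ?mul1r//.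
    by rewrite expf_neq0// gt_eqF.
  + exact: cvg_cst.
  + by rewrite -(mulr0 C'); apply: cvgMr; exact: cvg_powR_neg.
- have [a [b [aO bO ab]]] := product_probability_bound mgood Pn0 Ca0 Cb0 bad_le.
  by exists a, b; split.
- by split.
move=> e e0.
apply: (@squeeze_cvge _ _ _ _ (cst 0%E) _ (fun n => P (~` good n))).
(* Once the deterministic bound drops below [e], a risk above [e] is a failure of the bound. *)
- have sB : (fun n => B0 n + B1 n + B2 n) @ \oo --> (0 + 0 + 0 : R).
    by apply: cvgD => //; exact: cvgD.
  rewrite !addr0 in sB; have /cvgrPdist_lt/(_ _ e0) := sB; apply: filterS => n.
  rewrite sub0r normrN => /(le_lt_trans (ler_norm _)) Be.
  rewrite measure_ge0/=; apply: le_measure; rewrite ?inE.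
  + by have := emeasurable_fun_o_infty measurableT (mrisk n) e%:E; rewrite setTI.
  + exact: measurableC.
  move=> w /= ew; rewrite /good /= => H'; have := lt_le_trans ew H'.
  by rewrite lte_fin ltNge ltW.
- exact: cvg_cst.
- exact: bad_cvg0 bad_le alpha_gt0 alpha0_gt0.
Unshelve. all: by end_near. Qed.
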